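(* Let $\boldsymbol\lambda=(\lambda_i)_{i\in\mathbb N}$ and $\boldsymbol d=(d_i)_{i\in\mathbb N}$ be two real sequences, each of which has $0$ and $1$ as accumulation points and no other accumulation points, and such that $f_{\boldsymbol\lambda}(1/2)<\infty$ and $f_{\boldsymbol d}(1/2)<\infty$. Define \[\delta^L=\liminf_{\beta\nearrow 0}(f_{\boldsymbol\lambda}(\beta)-f_{\boldsymbol d}(\beta)),\qquad \delta^U=\liminf_{\beta\searrow 1}(f_{\boldsymbol\lambda}(\beta)-f_{\boldsymbol d}(\beta)).\] Assume that $\delta^L+\delta^U<\infty$, that \[f_{\boldsymbol d}(\alpha)\le f_{\boldsymbol\lambda}(\alpha)\qquad\text{for all }\alpha\in\mathbb R\setminus[0,1],\] and that there exist $\delta_0\in[0,\delta^L]$ and $\delta_1\in[0,\delta^U]$ such that \[f_{\boldsymbol\lambda}(\alpha)\le f_{\boldsymbol d}(\alpha)+(1-\alpha)\delta_0+\alpha\delta_1\quad\text{for all }\alpha\in(0,1),\] \[f_{\boldsymbol\lambda}'(\alpha)-f_{\boldsymbol d}'(\alpha)\equiv\delta_1-\delta_0\mod 1\quad\text{for some }\alpha\in(0,1),\] \[\sum_{\lambda_i<0}|\lambda_i|<\infty\implies\delta^L-\delta_0\le\delta^U-\delta_1,\qquad \sum_{\lambda_i>1}(\lambda_i-1)<\infty\implies\delta^U-\delta_1\le\delta^L-\delta_0.\] In addition, in the case when $\delta_0=\delta^L$ or $\delta_1=\delta^U$, assume that \[\delta_0,\delta_1>0\quad\text{and}\quad f_{\boldsymbol\lambda}(\alpha)<f_{\boldsymbol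 d}(\alpha)+(1-\alpha)\delta_0+\alpha\delta_1\ \text{ for all }\alpha\in(0,1).\] If $\boldsymbol\lambda$ is a diagonal of a self-adjoint operator $E$, then so is $\boldsymbol d$.
   Context: Operators are bounded, on separable Hilbert spaces; $(d_i)$ is a diagonal of a self-adjoint $E$ if $d_i=\langle Ee_i,e_i\rangle$ for all $i$, for some orthonormal basis $(e_i)$. Majorization function: for a countable real sequence $\boldsymbol d=(d_i)$ let $C_{\boldsymbol d}(\alpha)=\sum_{0\le d_i<\alpha}d_i$, $D_{\boldsymbol d}(\alpha)=\sum_{\alpha\le d_i\le1}(1-d_i)$, and $f_{\boldsymbol d}:\mathbb R\to[0,\infty]$, $f_{\boldsymbol d}(\alpha)=\sum_{d_i\le\alpha}(\alpha-d_i)$ for $\alpha\le0$; $f_{\boldsymbol d}(\alpha)=(1-\alpha)C_{\boldsymbol d}(\alpha)+\alpha D_{\boldsymbol d}(\alpha)$ for $\alpha\in(0,1)$; $f_{\boldsymbol d}(\alpha)=\sum_{d_i\ge\alpha}(d_i-\alpha)$ for $\alpha\ge1$. When finite on $(0,1)$ it is piecewise linear there; statements on derivatives at $\alpha$ mean that the functions involved are differentiable at $\alpha$. $x$ is an accumulation point of $(d_i)_{i\in I}$ if for every $\varepsilon>0$ there are infinitely many $i\in I$ with $|x-d_i|<\varepsilon$. *)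

(* Defs.v *)
From HB Require Import structures.
From mathcomp Require Import all_boot all_order all_algebra.
From mathcomp Require Import sesquilinear.
From mathcomp Require Import complex.
From mathcomp Require Import all_classical all_reals all_analysis.

Set Implicit Arguments.
Unset Strict Implicit.
Unset Printing Implicit Defensive.

Import Order.TTheory GRing.Theory Num.Theory.
Import numFieldNormedType.Exports.

Local Open Scope classical_set_scope.
Local Open Scope ring_scope.
Local Open Scope complex_scope.

Section Majorization.
Context {R : realType} {I : choiceType}.
Implicit Types (d : I -> R) (a x : R).

Definition accumulation_point d x :=
  forall eps : R, 0 < eps -> infinite_set [set i | `|x - d i| < eps].

Definition majC d a : \bar R :=
  (\esum_(i in [set i | (0 <= d i < a)%R]) (d i)%:E)%E.

Definition majD d a : \bar R :=
  (\esum_(i in [set i | (a <= d i <= 1)%R]) (1 - d i)%:E)%E.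

Definition majf d a : \bar R :=
  (if (a <= 0)%R then \esum_(i in [set i | (d i <= a)%R]) (a - d i)%:E
   else if (a < 1)%R then (1 - a)%:E * majC d a + a%:E * majD d a
   else \esum_(i in [set i | (a <= d i)%R]) (d i - a)%:E)%E.

End Majorization.

Section Hilbert.
Context {R : realType} {H : completeNormedModType R[i]}.

(* Linear in the first argument. With [H] complete, a positive definite
   hermitian form satisfying this condition makes [H] a complex Hilbert space. *)
Definition induces_norm (ip : {dot H for Num.conj}) :=
  forall x : H, `|x| ^+ 2 = ip x x.

Definition separable_space := exists2 S : set H, countable S & dense S.

Definition bounded_operator (E : {linear H -> H}) :=
  exists M : R, forall x : H, `|E x| <= M%:C * `|x|.

Definition self_adjoint (ip : {dot H for Num.conj}) (E : {linear H -> H}) :=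
  forall x y : H, ip (E x) y = ip x (E y).

Definition orthonormal_basis (ip : {dot H for Num.conj}) (e : nat -> H) :=
  (forall i j, ip (e i) (e j) = (i == j)%:R) /\
  dense [set x : H | exists (n : nat) (c : nat -> R[i]),
                       x = \sum_(i < n) c i *: e i].

Definition is_diagonal (ip : {dot H for Num.conj}) (E : {linear H -> H})
    (d : nat -> R) :=
  exists e : nat -> H, orthonormal_basis ip e /\
    forall i, (d i)%:C = ip (E (e i)) (e i).

End Hilbert.
Arguments separable_space {R} H.

(* Main.v *)
(* Everything is expressed through one relation, [conv lam d]: whenever a hermitian form has
   diagonal [lam] on an orthonormal family, it has diagonal [d] on another orthonormal family
   with the same closed span. This relation is transitive, compatible with direct sums and with
   affine changes of variable, and it is generated by plane rotations: finitely many of them give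
   the Schur-Horn theorem, and infinitely many, all sharing one pivot vector, a "sweep".

   Split [lam] and [d] at the point of the trace condition into the terms near 0 and the terms
   near 1; by symmetry consider the terms near 0, say [a] and [b]. Increasing [delta0] and [delta1]
   by the same amount, one may assume that they equal [delta^L], [delta^U] on every side where
   the excess over [[0,1]] is summable. If the negative part of [a] is summable, then so is that
   of [b]. Otherwise, list the negative terms of [a] and [b] in decreasing order of magnitude, up
   to a sparse summable subsequence kept in reserve: the total magnitude of the first [n] terms of
   [a] exceeds that of [b] by an amount whose limit inferior is at least some [x] slightly below
   [delta0].
   Finitely many equal positive numbers with sum [x] are swept along the listed part of [a],
   and what remains is converted block by block into the listed part of [b].

   On each side only summable sequences remain, and the hypothesis on (0,1), together with the
   reserve near 0 and 1, makes their majorization functions strictly ordered on [[0,1]]. By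
   compactness the gap is uniform, so that two sweeps can exchange the tails of the sequences
   and the finite Schur-Horn theorem handles the rest, the trace condition matching dimensions. *)
Require Import Defs.
From HB Require Import structures.
From mathcomp Require Import all_boot all_order all_algebra.
From mathcomp Require Import fingroup perm sesquilinear.
From mathcomp Require Import complex.
From mathcomp Require Import all_classical all_reals all_analysis.
From mathcomp Require Import ring lra zify.
Set Implicit Arguments.
Unset Strict Implicit.
Unset Printing Implicit Defensive.
Import Order.TTheory GRing.Theory Num.Theory.
Import numFieldNormedType.Exports.
Local Open Scope classical_set_scope.
Local Open Scope ring_scope.
Local Open Scope complex_scope.

(** * Hermitian forms, rotations and the conversion relation *)

(** The obstacle is that traces are not preserved in infinite dimension. Where the negative part is
    summable, the trace lost at that end is exactly [del]; where it is not, a positive amount can be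
    swallowed by the negative part, and the limit inferior of the gaps limits how much. The reserve
    is there for strictness: the hypothesis concerns the open interval, while compactness needs a
    strict inequality at 0 and 1 as well. The reserve kept from [lam] outweighs the one kept from
    [d] by some [rho > 0], and this is why only [x = del - rho] is swept away. One pivot of value
    [x] would not do: a pivot [sig] yields the required term [(1 - al) * sig] only for [al >= sig].
    For smaller [al] the surplus [rho] has to win alone, which it does because positive terms
    contribute little there. So [rho] is fixed first and the size of the pivots afterwards. Closed
    spans are expressed through orthogonality, so that a series of vectors has to converge only
    once, in [total_basis]. *)

Definition sumf {T I J : Type} (f : I -> T) (g : J -> T) (x : I + J) : T :=
  match x with inl i => f i | inr j => g j end.

Lemma expr_small (R : realType) (q eps : R) : 0 <= q < 1 -> 0 < eps ->
  exists n, q ^+ n < eps.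
Proof.
move=> /andP[q0 q1] e0.
have /cvgrPdist_lt/(_ _ e0) [n _ /(_ n (leqnn _))] : q ^+ n @[n --> \oo] --> (0 : R).
  by apply: cvg_expr; rewrite ger0_norm.
by rewrite sub0r normrN ger0_norm ?exprn_ge0 //; exists n.
Qed.

Lemma ge0_complexE (R : realType) (z : R[i]) : 0 <= z -> z = (complex.Re z)%:C.
Proof. by case: z => a b; rewrite lecE /= => /andP[/eqP -> _]. Qed.

Section HermitianForms.
Context {R : realType} {H : lmodType R[i]}.
Local Notation C := R[i].

(** General enough to cover [ip], the form [ip (E x) y], and the real combinations of the two that
    [conv_affine] needs. *)
Definition hform (f : H -> H -> C) :=
  (forall (a : C) x y z, f (a *: x + y) z = a * f x z + f y z) /\
  (forall x y, f y x = (f x y)^*%R).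

Section HformTheory.
Variable (f : H -> H -> C).
Hypothesis hf : hform f.

Lemma hf0l z : f 0 z = 0.
Proof.
have := hf.1 1 0 0 z; rewrite scale1r addr0 mul1r => /eqP.
by rewrite -subr_eq0 opprD addNKr oppr_eq0 => /eqP.
Qed.

Lemma hfDl x y z : f (x + y) z = f x z + f y z.
Proof. by have := hf.1 1 x y z; rewrite scale1r mul1r. Qed.

Lemma hfZl a x z : f (a *: x) z = a * f x z.
Proof. by have := hf.1 a x 0 z; rewrite addr0 hf0l addr0. Qed.

Lemma hfC x y : f y x = (f x y)^*%R. Proof. exact: hf.2. Qed.

Lemma hfDr x y z : f z (x + y) = f z x + f z y.
Proof. by rewrite hfC hfDl rmorphD /= -!hfC. Qed.

Lemma hfZr a x z : f z (a *: x) = a^*%R * f z x.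
Proof. by rewrite hfC hfZl rmorphM /= -hfC. Qed.

Lemma hfNl x z : f (- x) z = - f x z.
Proof. by rewrite -scaleN1r hfZl mulN1r. Qed.

Lemma hfNr x z : f z (- x) = - f z x.
Proof. by rewrite hfC hfNl rmorphN /= -hfC. Qed.

Lemma hf_eq0C x y : f x y = 0 -> f y x = 0.
Proof. by move=> h; rewrite hfC h conjC0. Qed.

End HformTheory.

(* Rotating [u] towards [phase (f u w) *: w] makes the cross term imaginary, so that the diagonal
   of [f] moves along convex combinations of [f u u] and [f w w]. *)
Definition phase (z : C) : C := if z == 0 then 1 else 'i * z / `|z|.

Lemma phase_norm z : phase z * (phase z)^*%R = 1.
Proof.
rewrite -normCK /phase; case: eqP => [_|/eqP z0]; first by rewrite normr1 expr1n.
by rewrite !normrM normfV normr_id normCi mul1r divff ?expr1n // normr_eq0.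
Qed.

Lemma phase_imaginary z : (phase z)^*%R * z + phase z * z^*%R = 0.
Proof.
rewrite /phase; case: eqP => [->|/eqP z0]; first by rewrite conjC0 !mulr0 addr0.
rewrite !rmorphM /= fmorphV /= conj_normC conjCi.
have n0 : `|z| != 0 by rewrite normr_eq0.
by field.
Qed.

(** For [om] of modulus 1, [rot1] and [rot2] form the image of the pair under a unitary of the
    plane. Square roots are used so that [p] itself becomes the convex weight on the diagonal. *)
Definition rot1 (p : R) (om : C) (u w : H) : H :=
  (Num.sqrt p)%:C *: u + ((Num.sqrt (1 - p))%:C * om) *: w.
Definition rot2 (p : R) (om : C) (u w : H) : H :=
  (Num.sqrt (1 - p))%:C *: u - ((Num.sqrt p)%:C * om) *: w.

Lemma conj_realC (x : R) : ((x%:C)^*)%R = x%:C.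
Proof. exact: conjc_real. Qed.

Section Rotation.
Variables (p : R) (om : C) (u w : H).
Hypothesis p01 : 0 <= p <= 1.
Hypothesis om1 : om * om^*%R = 1.

Let PP : (Num.sqrt p)%:C * (Num.sqrt p)%:C = p%:C :> C.
Proof. by rewrite -rmorphM /= -expr2 sqr_sqrtr //; case/andP: p01. Qed.

Let QQ : (Num.sqrt (1 - p))%:C * (Num.sqrt (1 - p))%:C = 1 - p%:C :> C.
Proof.
rewrite -rmorphM /= -expr2 sqr_sqrtr ?rmorphB //=.
by rewrite subr_ge0; case/andP: p01.
Qed.


Let comb (a b c d e g : C) (x y : H) :
  a *: (b *: x + c *: y) + d *: (e *: x - g *: y)
  = (a * b + d * e) *: x + (a * c - d * g) *: y.
Proof. by rewrite scalerBr scalerDr !scalerA scalerDl scalerBl addrACA. Qed.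


(** Inverting the unitary recovers the old pair from the new one; this is how spans are shown not to
    shrink. *)
Lemma rot_fst : (Num.sqrt p)%:C *: rot1 p om u w
                + (Num.sqrt (1 - p))%:C *: rot2 p om u w = u.
Proof.
rewrite /rot1 /rot2 comb PP QQ [p%:C + _]addrC subrK scale1r.
by rewrite [X in (X - _) *: w]mulrCA subrr scale0r addr0.
Qed.

Lemma rot_snd : om^*%R *: ((Num.sqrt (1 - p))%:C *: rot1 p om u w
                - (Num.sqrt p)%:C *: rot2 p om u w) = w.
Proof.
rewrite /rot1 /rot2.
have -> : (Num.sqrt p)%:C *: ((Num.sqrt (1 - p))%:C *: u - ((Num.sqrt p)%:C * om) *: w)
  = - ((- (Num.sqrt p)%:C) *: ((Num.sqrt (1 - p))%:C *: u - ((Num.sqrt p)%:C * om) *: w)).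
  by rewrite scaleNr opprK.
rewrite opprK comb mulNr mulrC subrr scale0r add0r mulNr opprK !mulrA PP QQ.
by rewrite -mulrDl subrK mul1r scalerA mulrC om1 scale1r.
Qed.

Section Values.
Variable (f : H -> H -> C).
Hypothesis hf : hform f.
Variables (a b : R).
Hypotheses (fu : f u u = a%:C) (fw : f w w = b%:C).
Hypothesis cross : om^*%R * f u w + om * (f u w)^*%R = 0.

Let expand (x y x' y' : C) : f (x *: u + y *: w) (x' *: u + y' *: w) =
  x * x'^*%R * a%:C + x * y'^*%R * f u w
  + y * x'^*%R * (f u w)^*%R + y * y'^*%R * b%:C.
Proof.
rewrite (hfDl hf) !(hfDr hf) !(hfZl hf) !(hfZr hf) fu fw (hfC hf u w).
by rewrite !mulrA !addrA.
Qed.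

(** By [cross] the off-diagonal terms cancel. The same [om] serves two forms: [f] by the choice of
    [phase], and [ip] because the vectors are orthogonal. *)
Lemma rot1_val : f (rot1 p om u w) (rot1 p om u w) = (p * a + (1 - p) * b)%:C.
Proof.
rewrite /rot1 expand !rmorphM /= !conj_realC PP.
transitivity (p%:C * a%:C
   + (Num.sqrt p)%:C * (Num.sqrt (1 - p))%:C *
       (om^*%R * f u w + om * (f u w)^*%R)
   + ((Num.sqrt (1 - p))%:C * (Num.sqrt (1 - p))%:C) * (om * om^*%R) * b%:C); first by ring.
by rewrite cross QQ om1 mulr0 addr0 mulr1 rmorphD !rmorphM rmorphB.
Qed.

Lemma rot2_val : f (rot2 p om u w) (rot2 p om u w) = ((1 - p) * a + p * b)%:C.
Proof.
rewrite /rot2 -scaleNr expand rmorphN !rmorphM /= !conj_realC QQ.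
transitivity ((1 - p%:C) * a%:C
   - (Num.sqrt p)%:C * (Num.sqrt (1 - p))%:C *
       (om^*%R * f u w + om * (f u w)^*%R)
   + ((Num.sqrt p)%:C * (Num.sqrt p)%:C) * (om * om^*%R) * b%:C); first by ring.
by rewrite cross PP om1 mulr0 subr0 mulr1 rmorphD !rmorphM rmorphB.
Qed.

Lemma rot12_val : f u w = 0 -> a = b -> f (rot1 p om u w) (rot2 p om u w) = 0.
Proof.
move=> uw0 ab; rewrite /rot1 /rot2 -scaleNr expand rmorphN !rmorphM /= !conj_realC uw0.
rewrite conjC0 !mulr0 !addr0 ab mulrN mulNr mulrACA om1 mulr1.
by rewrite [(Num.sqrt p)%:C * _]mulrC subrr.
Qed.

End Values.

Lemma rot1_orthl (f : H -> H -> C) z : hform f ->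
  f u z = 0 -> f w z = 0 -> f (rot1 p om u w) z = 0.
Proof. by move=> hf h1 h2; rewrite (hfDl hf) !(hfZl hf) h1 h2 !mulr0 addr0. Qed.

Lemma rot2_orthl (f : H -> H -> C) z : hform f ->
  f u z = 0 -> f w z = 0 -> f (rot2 p om u w) z = 0.
Proof.
by move=> hf h1 h2; rewrite (hfDl hf) (hfNl hf) !(hfZl hf) h1 h2 !mulr0 oppr0 addr0.
Qed.

End Rotation.
End HermitianForms.

Section Conversion.
Context {R : realType} {H : lmodType R[i]}.
Local Notation C := R[i].
Variable (ip : H -> H -> C).
Hypothesis hip : hform ip.

Definition orthofam (I : Type) (u : I -> H) :=
  (forall i, ip (u i) (u i) = 1) /\ (forall i j, i <> j -> ip (u i) (u j) = 0).

(* In a Hilbert space this says that [x] lies in the closed span of [u]. *)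
Definition wspan (I : Type) (u : I -> H) (x : H) :=
  forall z, (forall i, ip (u i) z = 0) -> ip x z = 0.

(** Quantifying over all [f] and [u] frees conversions from the operator, so that they can be
    composed and run side by side. Arbitrary index types let pivots, finite lists and sequences be
    joined by [sumf]. *)
Definition conv (I J : Type) (lam : I -> R) (d : J -> R) :=
  forall (f : H -> H -> C) (u : I -> H), hform f -> orthofam u ->
    (forall i, f (u i) (u i) = (lam i)%:C) ->
  exists v : J -> H, [/\ orthofam v, forall j, f (v j) (v j) = (d j)%:C,
    forall j, wspan u (v j) & forall i, wspan v (u i)].

Lemma wspan_mem (I : Type) (u : I -> H) i : wspan u (u i).
Proof. by move=> z; exact. Qed.

Lemma wspan_trans (I J : Type) (u : I -> H) (v : J -> H) x :
  (forall i, wspan v (u i)) -> wspan u x -> wspan v x.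
Proof. by move=> uv ux z vz; apply: ux => i; apply: uv. Qed.

Lemma wspan_orth (I J : Type) (u : I -> H) (v : J -> H) x y :
  (forall i j, ip (u i) (v j) = 0) -> wspan u x -> wspan v y -> ip x y = 0.
Proof.
move=> uv ux vy; apply: ux => i; apply: (hf_eq0C hip); apply: vy => j.
exact: (hf_eq0C hip).
Qed.

Lemma conv_trans (I J K : Type) (l : I -> R) (m : J -> R) (d : K -> R) :
  conv l m -> conv m d -> conv l d.
Proof.
move=> lm md f u hf ou fu.
have [v [ov fv uv vu]] := lm f u hf ou fu.
have [w [ow fw vw wv]] := md f v hf ov fv.
exists w; split=> // [j|i]; [exact: wspan_trans (vw j)|exact: wspan_trans (vu i)].
Qed.

Lemma conv_reindex (I J : Type) (g : J -> I) (l : I -> R) (d : J -> R) :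
  injective g -> (forall i, exists j, g j = i) -> (forall j, d j = l (g j)) ->
  conv l d.
Proof.
move=> ginj gsurj dl f u hf [ou1 ou0] fu; exists (fun j => u (g j)); split=> //.
- by split=> // i j ij; apply: ou0 => /ginj.
- by move=> j; rewrite dl.
- by move=> j; apply: wspan_mem.
- by move=> i z uz; have [j <-] := gsurj i.
Qed.

Lemma conv_refl (I : Type) (l d : I -> R) : (forall i, d i = l i) -> conv l d.
Proof. by move=> e; apply: (@conv_reindex _ _ id) => // i; exists i. Qed.

Lemma conv_sum (I J I' J' : Type) (l : I -> R) (d : J -> R) (l' : I' -> R)
    (d' : J' -> R) :
  conv l d -> conv l' d' -> conv (sumf l l') (sumf d d').
Proof.
move=> ld ld' f u hf [ou1 ou0] fu.
have [] := ld f (u \o inl) hf _ (fun i => fu (inl i)).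
  by split=> [i|i j ij]; [exact: ou1|apply: ou0 => -[]].
move=> v [ [ov1 ov0] fv uv vu].
have [] := ld' f (u \o inr) hf _ (fun i => fu (inr i)).
  by split=> [i|i j ij]; [exact: ou1|apply: ou0 => -[]].
move=> v' [ [ov1' ov0'] fv' uv' vu'].
have o i j : ip (v i) (v' j) = 0.
  by apply: (wspan_orth _ (uv i) (uv' j)) => i' j'; apply: ou0.
exists (sumf v v'); split.
- split; first by case.
  move=> [i|i] [j|j] ij /=.
  + by apply: ov0 => e; apply: ij; rewrite e.
  + exact: o.
  + by apply: (hf_eq0C hip); apply: o.
  + by apply: ov0' => e; apply: ij; rewrite e.
- by case.
- case=> j z uz; [apply: uv => i|apply: uv' => i]; exact: uz.
- case=> i z vz; [apply: vu => j|apply: vu' => j]; [exact: (vz (inl j))|exact: (vz (inr j))].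
Qed.

(** Any number of fibres of [b] can be converted at once: new vectors stay in the closed span of
    their own fibre, and distinct fibres span orthogonal spaces. *)
Lemma conv_blocks (I K : Type) (b : I -> K) (l d : I -> R) :
  (forall k, conv (fun i : {i | b i = k} => l (sval i))
                  (fun i : {i | b i = k} => d (sval i))) ->
  conv l d.
Proof.
move=> ld f u hf [ou1 ou0] fu.
have {}ld k : exists v : {i | b i = k} -> H,
    [/\ orthofam v, forall j, f (v j) (v j) = (d (sval j))%:C,
      forall j, wspan (fun i : {i | b i = k} => u (sval i)) (v j)
    & forall i : {i | b i = k}, wspan v (u (sval i))].
  apply: (ld k) => //; split=> // i j ij; apply: ou0 => e; apply: ij.
  by case: i j e => [i bi] [j bj] /= e; subst j; congr exist; exact: Prop_irrelevance.
pose v i := sval (cid (ld (b i))) (exist _ i erefl).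
have vE k (i : {i | b i = k}) : v (sval i) = sval (cid (ld k)) i.
  by case: i => i e; subst k.
exists v; split.
- split=> [i|i j ij].
    by rewrite /v; case: cid => w /= [ [w1 _] _ _ _].
  case: (pselect (b i = b j)) => bij.
    have -> : v j = v (sval (exist _ j (esym bij) : {x | b x = b i})) by [].
    rewrite vE /v; case: cid => w /= [ [_ w0] _ _ _].
    by apply: w0 => -[].
  rewrite /v; case: cid => w /= [_ _ /(_ (exist _ i erefl)) wi _].
  case: cid => w' /= [_ _ /(_ (exist _ j erefl)) wj _].
  apply: (wspan_orth _ wi wj) => -[i' bi'] [j' bj'] /=.
  by apply: ou0 => e; apply: bij; rewrite -bi' -bj' e.
- by move=> i; rewrite /v; case: cid => w /= [_ -> _ _].
- move=> i z uz; rewrite /v; case: cid => w /= [_ _ wi _].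
  by apply: wi => -[j bj] /=.
- move=> i z vz.
  case: (cid (ld (b i))) (vE (b i)) => w /= [_ _ _ wu] wE.
  by apply: (wu (exist _ i erefl)) => j; rewrite -wE.
Qed.

(** The given conversion is applied to the form [(f - q ip) / p], whose diagonal on [u] is [l]. The
    case [p = -1], [q = 1] exchanges the ends 0 and 1. *)
Lemma conv_affine (I J : Type) (p q : R) (l : I -> R) (d : J -> R) : p != 0 ->
  conv l d -> conv (fun i => p * l i + q) (fun j => p * d j + q).
Proof.
move=> p0 ld f u hf ou fu.
pose g x y := (p^-1)%:C * (f x y - q%:C * ip x y).
have hg : hform g.
  split=> [a x y z|x y]; rewrite /g.
    by rewrite hf.1 hip.1; ring.
  by rewrite (hfC hf) (hfC hip) rmorphM rmorphB rmorphM /= !conj_realC.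
have p0' : p%:C != 0 :> C.
  by rewrite -[0](rmorph0 (real_complex R)) (inj_eq (fmorph_inj _)).
have [i|v [ov gv uv vu]] := ld g u hg ou.
  rewrite /g fu ou.1 rmorphD rmorphM /= fmorphV /= mulr1 addrK mulKf //.
exists v; split=> // j; move: (gv j); rewrite /g ov.1 => /(congr1 ( *%R p%:C)).
rewrite fmorphV /= mulVKf // mulr1 => /(canRL (subrK _)) ->.
by rewrite rmorphD rmorphM.
Qed.

Lemma conv_transfer (I : eqType) (l : I -> R) (i j : I) (p : R) :
  i != j -> 0 <= p <= 1 ->
  conv l (fun k => if k == i then p * l i + (1 - p) * l j
                   else if k == j then (1 - p) * l i + p * l j
                   else l k).
Proof.
move=> ij p01 f u hf [ou1 ou0] fu.
pose om := phase (f (u i) (u j)).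
have om1 : om * om^*%R = 1 by exact: phase_norm.
pose v k := if k == i then rot1 p om (u i) (u j)
            else if k == j then rot2 p om (u i) (u j) else u k.
have uij : ip (u i) (u j) = 0 by apply: ou0; apply/eqP.
have cr : om^*%R * ip (u i) (u j) + om * (ip (u i) (u j))^*%R = 0.
  by rewrite uij conjC0 !mulr0 addr0.
have cf := phase_imaginary (f (u i) (u j)).
have vi : v i = rot1 p om (u i) (u j) by rewrite /v eqxx.
have vj : v j = rot2 p om (u i) (u j) by rewrite /v eq_sym (negPf ij) eqxx.
have w1 : ip (u i) (u i) = (1 : R)%:C by rewrite ou1.
have w2 : ip (u j) (u j) = (1 : R)%:C by rewrite ou1.
have o12 : ip (rot1 p om (u i) (u j)) (rot2 p om (u i) (u j)) = 0.
  exact: (rot12_val p om1 hip w1 w2 uij erefl).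
exists v; split.
- split=> [k|k m km]; rewrite /v.
    case: eqP => _.
      by rewrite (rot1_val p01 om1 hip w1 w2 cr) !mulr1 addrC subrK.
    case: eqP => _ //.
    by rewrite (rot2_val p01 om1 hip w1 w2 cr) !mulr1 subrK.
  case: (eqVneq k i) => [ki|/eqP ki]; case: (eqVneq m i) => [mi|/eqP mi].
  + by rewrite ki mi in km.
  + case: eqP => mj //; apply: rot1_orthl => //; apply: ou0 => e; [exact: mi|exact: mj].
  + case: eqP => kj; first exact: (hf_eq0C hip).
    apply: (hf_eq0C hip); apply: rot1_orthl => //; apply: ou0 => e; [exact: ki|exact: kj].
  + case: (eqVneq k j) => [kj|/eqP kj]; case: (eqVneq m j) => [mj|/eqP mj].
    * by rewrite kj mj in km.
    * by apply: rot2_orthl => //; apply: ou0 => e; [exact: mi|exact: mj].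
    * apply: (hf_eq0C hip).
      by apply: rot2_orthl => //; apply: ou0 => e; [exact: ki|exact: kj].
    * exact: ou0.
- move=> k; rewrite /v; case: eqP => _; first exact: (rot1_val p01 om1 hf (fu i) (fu j)).
  case: eqP => _ //; exact: (rot2_val p01 om1 hf (fu i) (fu j)).
- move=> k z uz; rewrite /v; case: eqP => _; first exact: rot1_orthl.
  case: eqP => _ //; exact: rot2_orthl.
- move=> k z vz.
  have v1 := vz i; have v2 := vz j; rewrite vi in v1; rewrite vj in v2.
  case: (eqVneq k i) => [->|ki].
    by rewrite -(rot_fst om (u i) (u j) p01) (hfDl hip) !(hfZl hip) v1 v2 !mulr0 addr0.
  case: (eqVneq k j) => [->|kj].
    by rewrite -(rot_snd (u i) (u j) p01 om1) (hfZl hip) (hfDl hip) (hfNl hip) !(hfZl hip) v1 v2 !mulr0 oppr0 addr0 mulr0.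
  by move: (vz k); rewrite /v (negPf ki) (negPf kj).
Qed.

Lemma hfCS x z : (forall y, 0 <= ip y y) -> ip x x = 1 -> `|ip x z| ^+ 2 <= ip z z.
Proof.
move=> ip0 x1; have := ip0 (z - ip z x *: x).
rewrite (hfDl hip) !(hfDr hip) !(hfNl hip) !(hfNr hip) !(hfZl hip) !(hfZr hip) x1 mulr1.
rewrite (hfC hip z x) subrr addr0 norm_conjC normCK mulrC.
by rewrite subr_ge0.
Qed.

Section Sweep.
Variables (x y t : nat -> R).
Hypotheses (t_gt0 : forall n, 0 < t n)
  (t_to0 : forall m eps, 0 < eps -> exists2 n, (m <= n)%N & t n <= eps)
  (tS : forall n, t n.+1 = t n - (x n - y n))
  (xy : forall n, y n <= x n) (yt : forall n, - t n <= y n)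
  (xt : forall n, x n = y n \/ x n <= t n).

(** The weight that moves the pivot from [- t n] to [- t n.+1]; conservation of the trace then gives
    the other vector the value [y n]. If [x n = y n] nothing has to move, and the quotient could be
    0/0. *)
Let p n := if x n == y n then 1 else (x n + t n.+1) / (x n + t n).

Let xt_gt0 n : x n != y n -> 0 < x n + t n.
Proof.
move=> xyn; have := xy n; rewrite le_eqVlt eq_sym (negPf xyn) /= => lt.
by have := yt n; lra.
Qed.

Let p01 n : 0 <= p n <= 1.
Proof.
rewrite /p; case: eqVneq => [_|xyn]; first by rewrite ler01 lexx.
have h := xt_gt0 xyn; have := tS n; have := xy n; have := yt n => h1 h2 h3.
by rewrite ler_pdivrMr // ler_pdivlMr //; apply/andP; split; lra.
Qed.

Let pE n : p n * - t n + (1 - p n) * x n = - t n.+1.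
Proof.
rewrite /p; case: eqVneq => [e|xyn]; first by rewrite tS e; ring.
by have /lt0r_neq0 h := xt_gt0 xyn; field.
Qed.

Let qE n : (1 - p n) * - t n + p n * x n = y n.
Proof. by have := pE n; rewrite tS; lra. Qed.

(** By [xt] the denominator is at most [2 * t n], so [1 - p n] controls the relative decrease of
    [t]. The convergence of [t] to 0 thereby forces the products of the [p n] to 0. *)
Let p_drop n : (t n - t n.+1) / (2 * t n) <= 1 - p n.
Proof.
rewrite /p; case: eqVneq => [e|xyn]; first by rewrite tS e; lra.
have h := xt_gt0 xyn; case: (xt n) => [e|xtn]; first by rewrite e eqxx in xyn.
have -> : 1 - (x n + t n.+1) / (x n + t n) = (t n - t n.+1) / (x n + t n).
  by have /lt0r_neq0 h' := h; field.
rewrite ler_pM2l ?lef_pV2 ?posrE; first by lra.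
- by have := t_gt0 n; lra.
- by [].
rewrite tS; have := xy n; rewrite le_eqVlt eq_sym (negPf xyn) /= => lt; lra.
Qed.

(** A division-free form of the bound of the product by [1 / (1 + sum)]. *)
Let prod_le m M : (m <= M)%N ->
  (\prod_(m <= k < M) p k) * (1 + \sum_(m <= k < M) (1 - p k)) <= 1.
Proof.
elim: M => [|M IH]; first by rewrite leqn0 => /eqP ->; rewrite !big_geq // addr0 mulr1.
rewrite leq_eqVlt => /predU1P[->|mM]; first by rewrite !big_geq // addr0 mulr1.
rewrite !big_nat_recr //=; set P := \prod_(_ <= _ < _) _ ; set S := \sum_(_ <= _ < _) _.
have {}IH : P * (1 + S) <= 1 := IH mM.
have P0 : 0 <= P by apply: prodr_ge0 => k _; case/andP: (p01 k).
have S0 : 0 <= S by apply: sumr_ge0 => k _; case/andP: (p01 k) => _; rewrite subr_ge0.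
case/andP: (p01 M) => pM0 pM1; apply: le_trans IH.
rewrite -mulrA ler_wpM2l //.
have : 0 <= (1 - p M) * (S + (1 - p M)) by apply: mulr_ge0; lra.
lra.
Qed.

Let t_nincr m n : (m <= n)%N -> t n <= t m.
Proof.
move=> /subnK <-; elim: (n - m)%N => [|k IH]; first by rewrite add0n.
rewrite addSn; apply: le_trans IH; rewrite tS; have := xy (k + m)%N; lra.
Qed.

Let sum_drop m M : (m <= M)%N ->
  (t m - t M) / (2 * t m) <= \sum_(m <= k < M) (1 - p k).
Proof.
elim: M => [|M IH]; first by rewrite leqn0 => /eqP ->; rewrite big_geq // subrr mul0r.
rewrite leq_eqVlt => /predU1P[->|mM]; first by rewrite big_geq // subrr mul0r.
rewrite big_nat_recr //=; apply: le_trans (lerD (IH mM) (p_drop M)).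
have -> : (t m - t M.+1) / (2 * t m) =
   (t m - t M) / (2 * t m) + (t M - t M.+1) / (2 * t m) by rewrite -mulrDl addrA subrK.
rewrite lerD2l; have := t_nincr (leqnSn M); rewrite le_eqVlt => /predU1P[->|lt].
  by rewrite subrr !mul0r.
by rewrite ler_pM2l ?subr_gt0 // lef_pV2 ?posrE ?mulr_gt0 // ler_pM2l // t_nincr.
Qed.

Let prod_step m : exists2 M, (m <= M)%N & \prod_(m <= k < M) p k <= 4 / 5.
Proof.
(* Once [t] has halved, the [1 - p k] add up to at least 1/4, and 4/5 is 1 / (1 + 1/4). *)
have [M mM tM] := t_to0 m (divr_gt0 (t_gt0 m) (ltr0n _ 2)).
exists M => //.
have tm := t_gt0 m.
have S4 : 1 / 4 <= \sum_(m <= k < M) (1 - p k).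
  apply: le_trans (sum_drop mM); rewrite ler_pdivlMr ?mulr_gt0 //; lra.
have P0 : 0 <= \prod_(m <= k < M) p k by apply: prodr_ge0 => k _; case/andP: (p01 k).
have := prod_le mM; have := ler_wpM2l P0 S4; lra.
Qed.

Let prod_small m n : exists2 M, (m <= M)%N & \prod_(m <= k < M) p k <= (4 / 5) ^+ n.
Proof.
elim: n => [|n [M mM IH]]; first by exists m; rewrite // big_geq.
have [M' MM' h] := prod_step M.
exists M'; first exact: leq_trans MM'.
rewrite (@big_cat_nat _ _ _ M) //= exprSr; apply: ler_pM => //;
  by apply: prodr_ge0 => k _; case/andP: (p01 k).
Qed.

Let sx : unit + nat -> R := sumf (fun _ => - t 0%N) x.

(* The pivot has diagonal value [- t n] after [n] rotations. As [t n] tends to 0, the product of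
   the [p n] vanishes, so the pivot escapes weakly and nothing of the span is lost. *)
Fixpoint sweep_pivot (f : H -> H -> C) (u : unit + nat -> H) n : H :=
  if n is m.+1 then
    let g := sweep_pivot f u m in
    rot1 (p m) (phase (f g (u (inr m)))) g (u (inr m))
  else u (inl tt).

Lemma conv_sweep : (forall z, 0 <= ip z z) -> conv sx y.
Proof.
move=> ip0 f u hf [ou1 ou0] fu.
pose g := sweep_pivot f u.
pose om n := phase (f (g n) (u (inr n))).
pose v n := rot2 (p n) (om n) (g n) (u (inr n)).
have gS n : g n.+1 = rot1 (p n) (om n) (g n) (u (inr n)) by [].
have om1 n : om n * (om n)^*%R = 1 by exact: phase_norm.
have gu n : forall k, (n <= k)%N -> ip (g n) (u (inr k)) = 0.
  elim: n => [|n IH] k nk; first exact: ou0.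
  rewrite gS; apply: rot1_orthl => //; first by apply: IH; exact: ltnW.
  by apply: ou0 => -[nk']; rewrite nk' ltnn in nk.
have uu1 k : ip (u k) (u k) = (1 : R)%:C by rewrite ou1.
have cr n : (om n)^*%R * ip (g n) (u (inr n)) + om n * (ip (g n) (u (inr n)))^*%R = 0.
  by rewrite gu // conjC0 !mulr0 addr0.
have g1 n : ip (g n) (g n) = (1 : R)%:C.
  elim: n => [|n IH]; first exact: ou1.
  by rewrite gS (rot1_val (p01 n) (om1 n) hip IH (uu1 _) (cr n)) !mulr1 addrC subrK.
have fg n : f (g n) (g n) = (- t n)%:C.
  elim: n => [|n IH]; first by rewrite fu.
  by rewrite gS (rot1_val (p01 n) (om1 n) hf IH (fu (inr n)) (phase_imaginary _)) pE.
have v1 n : ip (v n) (v n) = 1.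
  by rewrite /v (rot2_val (p01 n) (om1 n) hip (g1 n) (uu1 _) (cr n)) !mulr1 subrK.
have vg1 n : ip (v n) (g n.+1) = 0.
  by apply: (hf_eq0C hip); exact: (rot12_val (p n) (om1 n) hip (g1 n) (uu1 _) (gu n n (leqnn _)) erefl).
have vu n k : (n < k)%N -> ip (v n) (u (inr k)) = 0.
  move=> nk; apply: rot2_orthl => //; first by apply: gu; exact: ltnW.
  by apply: ou0 => -[nk']; rewrite nk' ltnn in nk.
have vg n k : (n < k)%N -> ip (v n) (g k) = 0.
  elim: k => [//|k IH]; rewrite ltnS leq_eqVlt => /predU1P[<-|nk]; first exact: vg1.
  rewrite gS; apply: (hf_eq0C hip); apply: rot1_orthl => //; apply: (hf_eq0C hip).
    exact: IH.
  exact: vu.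
have vv n k : (n < k)%N -> ip (v n) (v k) = 0.
  move=> nk; rewrite {2}/v; apply: (hf_eq0C hip); apply: rot2_orthl => //;
    apply: (hf_eq0C hip); [exact: vg|exact: vu].
exists v; split.
- split=> // n k /eqP; rewrite neq_ltn => /orP[|] h; first exact: vv.
  by apply: (hf_eq0C hip); exact: vv.
- move=> n.
  by rewrite (rot2_val (p01 n) (om1 n) hf (fg n) (fu (inr n)) (phase_imaginary _)) qE.
- move=> n z uz; have gz m : ip (g m) z = 0.
    by elim: m => [|m IH]; [exact: uz|rewrite gS; exact: rot1_orthl].
  exact: rot2_orthl.
(* If [z] is orthogonal to every [v n], the squared modulus of [ip (g m) z] is the product of the
   [p k] for [m <= k < M] times that of [ip (g M) z], which never exceeds [ip z z]. Hence it is
   0. *)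
- have key z : (forall n, ip (v n) z = 0) -> forall n, ip (g n) z = 0.
    move=> vz.
    have step n : ip (g n) z = (Num.sqrt (p n))%:C * ip (g n.+1) z.
      by rewrite -{1}(rot_fst (om n) (g n) (u (inr n)) (p01 n)) (hfDl hip) !(hfZl hip) vz mulr0 addr0.
    have step2 n : `|ip (g n) z| ^+ 2 = (p n)%:C * `|ip (g n.+1) z| ^+ 2.
      rewrite step normrM exprMn; congr (_ * _).
      by rewrite normCK conj_realC -rmorphM /= -expr2 sqr_sqrtr //; case/andP: (p01 n).
    have steps m M : (m <= M)%N ->
        `|ip (g m) z| ^+ 2 = (\prod_(m <= k < M) p k)%:C * `|ip (g M) z| ^+ 2.
      elim: M => [|M IH]; first by rewrite leqn0 => /eqP ->; rewrite big_geq // mul1r.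
      rewrite leq_eqVlt => /predU1P[->|mM]; first by rewrite big_geq // mul1r.
      by rewrite IH // step2 big_nat_recr //= rmorphM mulrA.
    move=> m; apply/eqP; rewrite -normr_eq0 -sqrf_eq0.
    apply/negPn/negP => nz.
    have : 0 < `|ip (g m) z| ^+ 2 by rewrite lt_def nz exprn_ge0.
    have bnd n : `|ip (g m) z| ^+ 2 <= ((4 / 5) ^+ n : R)%:C * ip z z.
      have [M mM hM] := prod_small m n.
      rewrite (steps _ _ mM); apply: ler_pM.
      + by rewrite ler0c; apply: prodr_ge0 => k _; case/andP: (p01 k).
      + by rewrite exprn_ge0.
      + by rewrite lecR.
      + exact: hfCS.
    have nz0 : 0 <= ip z z := ip0 z.
    move: bnd; rewrite (ge0_complexE nz0) (ge0_complexE (exprn_ge0 2 (normr_ge0 (ip (g m) z)))).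
    rewrite ltcR => bnd s0.
    have r0 : 0 <= complex.Re (ip z z) by rewrite -ler0c -(ge0_complexE nz0).
    have [n hn] : exists n, (4 / 5 : R) ^+ n < complex.Re (`|ip (g m) z| ^+ 2) / (complex.Re (ip z z) + 1).
      by apply: expr_small; [lra|apply: divr_gt0 => //; lra].
    move: (bnd n); rewrite -rmorphM /= lecR; apply/negP; rewrite -ltNge.
    move: hn; rewrite ltr_pdivlMr; last by lra.
    apply: le_lt_trans; rewrite ler_wpM2l ?exprn_ge0 //; lra.
  by case=> [[]|n] z vz; [exact: (key z vz 0%N)|
    rewrite -(rot_snd (g n) (u (inr n)) (p01 n) (om1 n)) (hfZl hip) (hfDl hip) (hfNl hip)
      !(hfZl hip) -gS key // vz !mulr0 oppr0 addr0 mulr0].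
Qed.
End Sweep.

End Conversion.

(** * Orthonormal bases and diagonals in the Hilbert space *)

Section HilbertSpace.
Context {R : realType} {H : completeNormedModType R[i]}.
Local Notation C := R[i].
Variable (ip : {dot H for Num.conj}).
Hypothesis ip_norm : induces_norm ip.

Lemma dot_hform : hform ip.
Proof.
split=> [a x y z|x y]; first by rewrite linearPl.
by rewrite hermC expr0 mul1r.
Qed.

Let hip := dot_hform.

Lemma ip_ge0 z : 0 <= ip z z. Proof. by rewrite -ip_norm exprn_ge0. Qed.

Lemma ip_unit_le x z : ip x x = 1 -> `|ip z x| <= `|z|.
Proof.
move=> x1; rewrite -(@ler_pXn2r _ 2%N) ?nnegrE //.
by rewrite ip_norm (hfC hip) norm_conjC; exact: (hfCS hip).
Qed.

Lemma ip_sumZr (n m : nat) (c : nat -> C) (u : nat -> H) (x : H) :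
  ip (\sum_(n <= k < m) c k *: u k) x = \sum_(n <= k < m) c k * ip (u k) x.
Proof.
elim/big_ind2: _ => [|a b y z <- <-|k _]; first exact: (hf0l hip).
  exact: (hfDl hip).
exact: (hfZl hip).
Qed.

(** For nonzero [z], density puts a finite combination [x] of the basis closer to [z] than the norm
    of [z]; but [x] is orthogonal to [z], contrary to Pythagoras. *)
Lemma basis_total (e : nat -> H) z :
  orthonormal_basis ip e -> (forall i, ip (e i) z = 0) -> z = 0.
Proof.
move=> [_ de] ez; apply/eqP/negPn/negP => z0.
have nz : 0 < `|z| by rewrite normr_gt0.
have [||x [zx [n [c xE]]]] := de (ball z `|z|).
- by exists z; exact: ballxx.
- exact: ball_open.
have xz : ip x z = 0.
  by rewrite xE -(big_mkord xpredT (fun i => c i *: e i)) ip_sumZr big1 // => k _; rewrite ez mulr0.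
move: zx; rewrite -ball_normE /= => zx.
have : `|z - x| ^+ 2 < `|z| ^+ 2 by rewrite ltr_pXn2r // nnegrE.
rewrite !ip_norm (hfDl hip) !(hfDr hip) !(hfNl hip) !(hfNr hip) xz opprK.
rewrite (hf_eq0C hip xz) !oppr0 addr0 add0r -ltrBrDl subrr.
by move=> /lt_geF; rewrite ip_ge0.
Qed.

(** Bessel's inequality makes the Fourier series of [x] Cauchy. Its sum has the coefficients of [x],
    hence equals [x] by totality, and its partial sums enter every neighbourhood of [x]. *)
Lemma total_basis (v : nat -> H) : orthofam ip v ->
  (forall z, (forall i, ip (v i) z = 0) -> z = 0) -> orthonormal_basis ip v.
Proof.
move=> [ov1 ov0] tot; split=> [i j|].
  by case: eqP => [->|ij]; [exact: ov1|exact: ov0].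
move=> O [x Ox] Oo.
pose c k := ip x (v k).
have sqsum n m : (n <= m)%N -> `|\sum_(n <= k < m) c k *: v k| ^+ 2
    = \sum_(n <= k < m) `|c k| ^+ 2.
  move=> nm; rewrite ip_norm ip_sumZr; apply: eq_big_nat => k /andP[nk km].
  rewrite (hfC hip) ip_sumZr (bigD1_seq k) ?mem_index_iota ?nk ?iota_uniq //=.
  rewrite ov1 mulr1 big1 ?addr0 ?normCK // => j jk.
  by rewrite ov0 ?mulr0 //; exact/eqP.
have bessel n : \sum_(0 <= k < n) `|c k| ^+ 2 <= `|x| ^+ 2.
  have := ip_ge0 (x - \sum_(0 <= k < n) c k *: v k).
  rewrite (hfDl hip) !(hfDr hip) !(hfNl hip) !(hfNr hip) opprK.
  set s := \sum_(0 <= k < n) c k *: v k.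
  have sx : ip s x = \sum_(0 <= k < n) `|c k| ^+ 2.
    by rewrite ip_sumZr; apply: eq_bigr => k _; rewrite normCK (hfC hip x (v k)).
  have xs : ip x s = \sum_(0 <= k < n) `|c k| ^+ 2.
    by rewrite (hfC hip) sx rmorph_sum; apply: eq_bigr => k _; rewrite rmorphXn /= conj_normC.
  by rewrite sx xs -ip_norm -(ip_norm s) sqsum // addNr addr0 subr_ge0.
pose b k : R := complex.Re (`|c k| ^+ 2).
have bE k : `|c k| ^+ 2 = (b k)%:C by apply: ge0_complexE; rewrite exprn_ge0.
have b0 k : 0 <= b k by rewrite -ler0c -bE exprn_ge0.
have bs n m : \sum_(n <= k < m) `|c k| ^+ 2 = (\sum_(n <= k < m) b k)%:C.
  by rewrite rmorph_sum; apply: eq_bigr => k _; rewrite bE.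
have cvb : cvgn (series b).
  apply: nondecreasing_is_cvgn; first exact: nondecreasing_series.
  exists (complex.Re (`|x| ^+ 2)) => _ [n _ <-].
  by rewrite -lecR -ge0_complexE ?exprn_ge0 // -bs.
have cs : cvgn (series (fun k => c k *: v k)).
  apply/cauchy_cvgP/cauchy_seriesP => e e0.
  have E : e = (complex.Re e)%:C by apply: ge0_complexE; exact: ltW.
  have Re0 : 0 < complex.Re e by rewrite -ltcR -E.
  have /cauchy_cvgP/cauchy_seriesP /(_ _ (exprn_gt0 2 Re0)) := cvb.
  apply: filterS => -[n m] /=.
  case: (leqP n m) => nm; last by move=> _; rewrite (big_geq (ltnW nm)) normr0.
  move=> h; rewrite -(@ltr_pXn2r _ 2%N) ?nnegrE ?(ltW e0) //.
  rewrite sqsum // bs E -rmorphXn /= ltcR; apply: le_lt_trans h.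
  exact: ler_norm.
pose y := limn (series (fun k => c k *: v k)).
have Sy : series (fun k => c k *: v k) n @[n --> \oo] --> y by exact: cs.
have xy : x = y.
  apply/eqP; rewrite -subr_eq0; apply/eqP/tot => i.
  apply: (hf_eq0C hip); apply/eqP/negPn/negP; rewrite -normr_gt0 => p0.
  have /cvgrPdist_lt/(_ _ p0) [N _ hN] := Sy.
  have := hN (N + i.+1)%N (leq_addr _ _).
  set s := series _ _.
  have -> : ip (x - y) (v i) = ip (s - y) (v i).
    rewrite !(hfDl hip) !(hfNl hip); congr (_ - _).
    rewrite /s /series /= ip_sumZr (bigD1_seq i) ?mem_index_iota ?iota_uniq ?ltn_addl //=.
    rewrite ov1 mulr1 big1 ?addr0 // => j ji.
    by rewrite ov0 ?mulr0 //; exact/eqP.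
  by rewrite distrC => /lt_le_trans/(_ (ip_unit_le (s - y) (ov1 i))); rewrite ltxx.
have Oy : nbhs y O by rewrite -xy; exact: open_nbhs_nbhs.
have [N _ hN] := Sy _ Oy.
exists (series (fun k => c k *: v k) N); split; first exact: (hN N (leqnn N)).
by exists N, c; rewrite /series /= big_mkord.
Qed.

(** A vector orthogonal to the new family is orthogonal to the old one by equality of the spans, so
    totality is inherited. *)
Lemma diagonal_conv (E : {linear H -> H}) (l d : nat -> R) : self_adjoint ip E ->
  conv ip l d -> is_diagonal ip E l -> is_diagonal ip E d.
Proof.
move=> sa ld [e [be el]].
pose f x y := ip (E x) y.
have hf : hform f.
  split=> [a x y z|x y]; rewrite /f.
    by rewrite linearP /= (hfDl hip) (hfZl hip).
  by rewrite sa (hfC hip).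
have oe : orthofam ip e.
  split=> [i|i j ij]; rewrite be.1 ?eqxx //.
  by case: eqP.
have [v [ov fv ev ve]] := ld f e hf oe (fun i => esym (el i)).
exists v; split=> [|i]; last by rewrite -fv.
by apply: total_basis => // z vz; apply: (basis_total be) => i; exact: ve.
Qed.

End HilbertSpace.

Local Close Scope complex_scope.

(** * Finite majorization *)

Section FiniteMajorization.
Context {R : realType} {H : lmodType R[i]}.
Variable (ip : H -> H -> R[i]).
Hypothesis hip : hform ip.

Lemma sum_delta (j l : nat) : \sum_(0 <= i < l) (i == j)%:R = (j < l)%:R :> R.
Proof.
case: ltnP => jl; last first.
  rewrite big_nat big1 // => i /andP[_ il].
  by rewrite (ltn_eqF (leq_trans il jl)).
rewrite (bigD1_seq j) ?mem_index_iota ?iota_uniq //= eqxx big1 ?addr0 // => i /negPf ->.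
by [].
Qed.

(* Induction on the number of disagreements: let [k] be the first index with [s k < t k] and
   [j < k] any index with [t j < s j]; a transfer from [j] to [k] settles one of them. *)
Lemma conv_majorized (n : nat) (s t : nat -> R) :
  (forall i j, (i <= j)%N -> (j < n)%N -> t j <= t i) ->
  (forall k, (k <= n)%N -> \sum_(0 <= i < k) t i <= \sum_(0 <= i < k) s i) ->
  \sum_(0 <= i < n) s i = \sum_(0 <= i < n) t i ->
  conv ip (fun i : 'I_n => s i) (fun i : 'I_n => t i).
Proof.
move=> t_nincr.
have [m] := ubnP #|[pred i : 'I_n | s i != t i]|.
elim: m s => // m IH s sm dom eqsum.
have [st|nst] := pselect (forall i, (i < n)%N -> s i = t i).
  by apply: conv_refl => i; rewrite st.
have exk : exists k, (k < n)%N && (s k < t k).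
  apply: contrapT => nex; apply: nst.
  have ge i : (i < n)%N -> t i <= s i.
    by move=> il; rewrite leNgt; apply/negP => lt; apply: nex; exists i; rewrite il.
  have : \sum_(0 <= i < n) (s i - t i) == 0 by rewrite sumrB eqsum subrr.
  rewrite big_mkord psumr_eq0 => [/allP h i il|i _]; last by rewrite subr_ge0 ge.
  by have := h (Ordinal il) (mem_index_enum _); rewrite /= subr_eq0 => /eqP.
case: (ex_minnP exk) => k /andP[kn stk] kmin {exk}.
have ge i : (i < k)%N -> t i <= s i.
  move=> ik; rewrite leNgt; apply/negP => lt.
  by move: (kmin i); rewrite lt (ltn_trans ik kn) leqNgt ik => /(_ isT).
have exj : exists j, (j < k)%N && (t j < s j).
  apply: contrapT => nex.
  have := dom k.+1 kn; rewrite !big_nat_recr //= => h.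
  have e : \sum_(0 <= i < k) s i = \sum_(0 <= i < k) t i.
    apply: eq_big_nat => i /andP[_ ik]; apply/eqP; rewrite eq_le ge // andbT leNgt.
    by apply/negP => lt; apply: nex; exists i; rewrite ik.
  by move: h; rewrite e lerD2l leNgt stk.
have bnd j : (j < k)%N && (t j < s j) -> (j <= k)%N by case/andP => /ltnW.
case: exj => j /andP[jk tsj].
have jn := ltn_trans jk kn.
pose del := Num.min (s j - t j) (t k - s k).
have del0 : 0 < del by rewrite lt_min !subr_gt0 tsj stk.
have delj : del <= s j - t j by rewrite ge_min lexx.
have delk : del <= t k - s k by rewrite ge_min lexx orbT.
have tjk := t_nincr j k (ltnW jk) kn.
pose s' i := s i - del * (i == j)%:R + del * (i == k)%:R.
have jNk : j != k by rewrite neq_ltn jk.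
have s'j : s' j = s j - del by rewrite /s' eqxx (negPf jNk) mulr1 mulr0 addr0.
have s'k : s' k = s k + del by rewrite /s' eqxx eq_sym (negPf jNk) mulr1 mulr0 subr0.
have s'i i : i != j -> i != k -> s' i = s i.
  by move=> /negPf ij /negPf ik; rewrite /s' ij ik !mulr0 subr0 addr0.
have sum' l : \sum_(0 <= i < l) s' i = \sum_(0 <= i < l) s i - del * (j < l)%:R + del * (k < l)%:R.
  by rewrite /s' big_split sumrB /= -!mulr_sumr !sum_delta.
pose p := 1 - del / (s j - s k).
have sjk : 0 < s j - s k by lra.
have p01 : 0 <= p <= 1.
  rewrite /p subr_ge0 ler_pdivrMr // mul1r lerBlDr lerDl divr_ge0 ?(ltW del0) ?(ltW sjk) // andbT; lra.
apply: (@conv_trans _ _ _ _ 'I_n _ _ (fun i : 'I_n => s' i)).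
  have ordNk : Ordinal jn != Ordinal kn by [].
  have h := @conv_transfer _ _ _ hip _ (fun i : 'I_n => s i) _ _ _ ordNk p01.
  apply: (conv_trans h); apply: conv_refl => i.
  have sjk0 : s j - s k != 0 by rewrite lt0r_neq0.
  have pd : p * (s j - s k) = s j - s k - del by rewrite /p; field.
  rewrite -!val_eqE /=; case: eqP => [->|/eqP ij]; first by rewrite s'j; lra.
  by case: eqP => [->|/eqP ik]; [rewrite s'k; lra|rewrite s'i].
apply: IH.
- rewrite -ltnS; apply: leq_trans sm; rewrite ltnS; apply: proper_card.
  apply/properP; split.
    apply/fintype.subsetP => i; rewrite !inE; apply: contraNN => /eqP e.
    case: (eqVneq (i : nat) j) => ij; first by move: tsj; rewrite -ij e ltxx.
    case: (eqVneq (i : nat) k) => ik; first by move: stk; rewrite -ik e ltxx.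
    by rewrite s'i // e.
  case: (leP (s j - t j) (t k - s k)) => h.
    exists (Ordinal jn); rewrite inE /=; first by rewrite gt_eqF.
    by rewrite negbK s'j /del min_l // opprB addrC subrK.
  exists (Ordinal kn); rewrite inE /=; first by rewrite lt_eqF.
  by rewrite negbK s'k /del min_r ?(ltW h) // addrC subrK.
- move=> l ln; rewrite sum'; case: (ltnP k l) => kl.
    by rewrite (ltn_trans jk kl) subrK dom.
  rewrite mulr0 addr0; case: (ltnP j l) => jl; last by rewrite mulr0 subr0 dom.
  rewrite mulr1 lerBrDr -lerBrDl -sumrB.
  rewrite (bigD1_seq j) ?mem_index_iota ?jl ?iota_uniq //=.
  apply: (le_trans delj); rewrite lerDl big_nat_cond; apply: sumr_ge0 => i.
  by move=> /andP[/andP[_ il] _]; rewrite subr_ge0 ge // (leq_trans il).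
- by rewrite sum' kn jn subrK.
Qed.

Definition hinge (al x : R) := Num.max (x - al) 0.

(** Majorization tested on convex functions. Reordering is itself a conversion, so both families may
    be sorted. *)
Lemma conv_hinge (n : nat) (s t : nat -> R) :
  \sum_(0 <= i < n) s i = \sum_(0 <= i < n) t i ->
  (forall al, \sum_(0 <= i < n) hinge al (t i) <= \sum_(0 <= i < n) hinge al (s i)) ->
  conv ip (fun i : 'I_n => s i) (fun i : 'I_n => t i).
Proof.
move=> eqsum hin.
pose srt (f : nat -> R) := sort >=%O [seq f i | i <- iota 0 n].
have szs f : size (srt f) = n by rewrite size_sort size_map size_iota.
have ps f : perm_eq (srt f) [seq f i | i <- iota 0 n] by rewrite perm_sort.
have nthE (f : nat -> R) (i : 'I_n) : f i = nth 0 [seq f i | i <- iota 0 n] i.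
  by rewrite (nth_map 0%N) ?size_iota // nth_iota.
have sume (f : nat -> R) (g : R -> R) : \sum_(0 <= i < n) g (nth 0 (srt f) i) = \sum_(0 <= i < n) g (f i).
  transitivity (\sum_(x <- srt f) g x).
    by rewrite [RHS](big_nth 0) szs.
  by rewrite (perm_big _ (ps f)) /= big_map /index_iota subn0.
have cs (f : nat -> R) : conv ip (fun i : 'I_n => f i) (fun i : 'I_n => nth 0 (srt f) i) /\
            conv ip (fun i : 'I_n => nth 0 (srt f) i) (fun i : 'I_n => f i).
  have sz1 : size (srt f) == n by rewrite szs.
  have sz2 : size [seq f i | i <- iota 0 n] == n by rewrite size_map size_iota.
  have /tuple_permP[p hp] : perm_eq (Tuple sz1) (Tuple sz2) by exact: ps.
  have e (i : 'I_n) : nth 0 (srt f) i = f (p i).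
    have -> : srt f = Tuple sz1 by [].
    by rewrite hp -tnth_nth tnth_mktuple (tnth_nth 0) /= -nthE.
  split; first apply: (@conv_reindex _ _ _ _ _ p) => //; first exact: perm_inj.
    by move=> i; exists ((p^-1)%g i); rewrite permKV.
  apply: (@conv_reindex _ _ _ _ _ (p^-1)%g); first exact: perm_inj.
    by move=> i; exists (p i); rewrite permK.
  by move=> i; rewrite e permKV.
apply: conv_trans (cs s).1 _; apply: conv_trans _ (cs t).2.
have srtd (f : nat -> R) i j : (i <= j)%N -> (j < n)%N -> nth 0 (srt f) j <= nth 0 (srt f) i.
  move=> ij jn; have st : sorted >=%O (srt f) by apply: sort_sorted; exact: ge_total.
  by apply: (sorted_leq_nth ge_trans ge_refl 0 st) => //; rewrite inE szs // (leq_ltn_trans ij).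
apply: conv_majorized; first exact: srtd.
  case=> [|k] kn; first by rewrite !big_geq.
  (* At this level the hinge sum of [s] is the sum of its [k.+1] largest entries minus [k.+1] times
     [al]; for [t] it is at least the analogous expression. *)
  pose al := nth 0 (srt s) k.
  have h := hin al; rewrite -(sume s (hinge al)) -(sume t (hinge al)) in h.
  have e : \sum_(0 <= i < n) hinge al (nth 0 (srt s) i) = \sum_(0 <= i < k.+1) (nth 0 (srt s) i - al).
    have z : \sum_(k.+1 <= i < n) hinge al (nth 0 (srt s) i) = 0.
      rewrite big_nat big1 // => i /andP[ik il]; rewrite /hinge max_r // subr_le0 srtd //.
      exact: ltnW.
    rewrite (@big_cat_nat _ _ _ k.+1) //= z addr0.
    apply: eq_big_nat => i /andP[_ ik]; rewrite /hinge max_l // subr_ge0.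
    exact: srtd.
  rewrite e in h.
  have : \sum_(0 <= i < k.+1) (nth 0 (srt t) i - al) <= \sum_(0 <= i < k.+1) (nth 0 (srt s) i - al).
    apply: le_trans h; rewrite [X in _ <= X](@big_cat_nat _ _ _ k.+1) //=.
    apply: (@le_trans _ _ (\sum_(0 <= i < k.+1) hinge al (nth 0 (srt t) i))).
      by apply: ler_sum => i _; rewrite /hinge le_max lexx.
    rewrite lerDl; apply: sumr_ge0 => i _; rewrite /hinge le_max lexx orbT //.
  by rewrite !sumrB lerD2r.
by rewrite (sume s id) (sume t id).
Qed.

(** * Conversion in consecutive finite blocks *)

Section CutPoints.
Variables (N : nat -> nat).
Hypotheses (N0 : N 0 = 0%N) (NS : forall k, (N k < N k.+1)%N).

Let N_mono k l : (k <= l)%N -> (N k <= N l)%N.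
Proof.
move=> /subnK <-; elim: (l - k)%N => [//|m IH]; rewrite addSn.
exact: leq_trans IH (ltnW (NS _)).
Qed.

Let N_ge k : (k <= N k)%N.
Proof. by elim: k => [//|k IH]; apply: leq_ltn_trans IH (NS k). Qed.

Lemma cut_exists i : exists k, (N k <= i < N k.+1)%N.
Proof.
have ex : exists k, (i < N k.+1)%N by exists i; apply: leq_trans (N_ge i.+1).
case: (ex_minnP ex) => k ik kmin; exists k; rewrite ik andbT.
case: k ik kmin => [_ _|k _ kmin]; first by rewrite N0.
by rewrite leqNgt; apply/negP => /kmin; rewrite ltnn.
Qed.

Lemma cut_unique i k l : (N k <= i < N k.+1)%N -> (N l <= i < N l.+1)%N -> k = l.
Proof.
move=> /andP[ki ik] /andP[li il]; apply/eqP; rewrite eqn_leq.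
apply/andP; split; rewrite leqNgt; apply/negP => /N_mono h.
  by move: (leq_trans il (leq_trans h ki)); rewrite ltnn.
by move: (leq_trans ik (leq_trans h li)); rewrite ltnn.
Qed.

Definition cut_index i : nat := sval (cid (cut_exists i)).

Lemma cut_indexP i : (N (cut_index i) <= i < N (cut_index i).+1)%N.
Proof. exact: svalP (cid (cut_exists i)). Qed.

Lemma cut_indexE i k : (N k <= i < N k.+1)%N -> cut_index i = k.
Proof. by move=> h; apply: cut_unique (cut_indexP i) h. Qed.

Lemma conv_cut (l d : nat -> R) :
  (forall k, conv ip (fun i : 'I_(N k.+1 - N k) => l (N k + i)%N)
                     (fun i : 'I_(N k.+1 - N k) => d (N k + i)%N)) ->
  conv ip l d.
Proof.
move=> ld; apply: (conv_blocks hip (b := cut_index)) => k.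
have bndl (i : {i | cut_index i = k}) : (sval i - N k < N k.+1 - N k)%N.
  case: i => i /= e; have := cut_indexP i; rewrite e => /andP[ki ik].
  by rewrite ltn_sub2r // (leq_ltn_trans ki).
have bndr (i : 'I_(N k.+1 - N k)) : cut_index (N k + i) = k.
  by apply: cut_indexE; rewrite leq_addr /= -ltn_subRL.
have inN (i : {i | cut_index i = k}) : (N k + (sval i - N k))%N = sval i.
  by case: i => i /= e; have := cut_indexP i; rewrite e => /andP[ki ik]; rewrite subnKC.
apply: conv_trans; last apply: conv_trans (ld k) _.
  apply: (@conv_reindex _ _ _ _ _ (fun i : 'I_(N k.+1 - N k) => exist _ (N k + i)%N (bndr i))).
  - by move=> i j [] /addnI h; exact: ord_inj.
  - move=> i; exists (Ordinal (bndl i)); case: i => i e /=.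
    by apply: eq_exist; exact: (inN (exist _ i e)).
  - by [].
apply: (@conv_reindex _ _ _ _ _ (fun i : {i | cut_index i = k} => Ordinal (bndl i))).
- move=> i j [] h; have : sval i = sval j by rewrite -(inN i) -(inN j) h.
  by case: i j {h} => [i ei] [j ej] /= e; apply: eq_exist.
- move=> i; exists (exist _ (N k + i)%N (bndr i)); apply: ord_inj => /=.
  by rewrite addKn.
- by move=> i /=; rewrite inN.
Qed.

End CutPoints.
End FiniteMajorization.

(** * Non-summable sequences *)

Section NonSummable.
Context {R : realType} {H : lmodType R[i]}.
Variable (ip : H -> H -> R[i]).
Hypothesis hip : hform ip.
Hypothesis ip_ge0 : forall z, 0 <= ip z z.

Definition gap (mu nu : nat -> R) n := \sum_(0 <= i < n) (mu i - nu i).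

Lemma gap0 mu nu : gap mu nu 0 = 0. Proof. by rewrite /gap big_geq. Qed.

Lemma gapS mu nu n : gap mu nu n.+1 = gap mu nu n + (mu n - nu n).
Proof. by rewrite /gap big_nat_recr. Qed.

Definition vanishing (mu : nat -> R) :=
  forall eps : R, 0 < eps -> exists N, forall n, (N <= n)%N -> mu n <= eps.
Definition divergent (mu : nat -> R) :=
  forall B : R, exists n, B <= \sum_(0 <= i < n) mu i.
(** The limit inferior of [f] at infinity is at least [x]. *)
Definition eventually_ge (x : R) (f : nat -> R) :=
  forall eta : R, 0 < eta -> exists N, forall n, (N <= n)%N -> x - eta <= f n.

Section Absorb.
Variables (mu nu : nat -> R) (sigma x : R).
Hypotheses (mu_gt0 : forall n, 0 < mu n) (mu_van : vanishing mu) (mu_div : divergent mu).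
Hypotheses (gap_ge0 : forall n, 0 <= gap mu nu n) (sigma_gt0 : 0 < sigma) (x_ge0 : 0 <= x).
Hypothesis gap_ev : eventually_ge (sigma + x) (gap mu nu).

(** The infimum of present and future gaps. It never decreases, so an amount absorbed within it
    never has to be given back. *)
Let g n := inf [set gap mu nu m | m in [set m | (n <= m)%N]].

Let g_inf n : has_inf [set gap mu nu m | m in [set m | (n <= m)%N]].
Proof.
split; first by exists (gap mu nu n), n => /=.
by exists 0 => _ [m _ <-].
Qed.

Let g_le n m : (n <= m)%N -> g n <= gap mu nu m.
Proof. by move=> nm; apply: ge_inf; [exact: (g_inf n).2|exists m]. Qed.

Let g_ge (y : R) n : (forall m, (n <= m)%N -> y <= gap mu nu m) -> y <= g n.
Proof. by move=> h; apply: lb_le_inf => [|_ [m nm <-]]; [exact: (g_inf n).1|exact: h]. Qed.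

Let gS n : g n <= g n.+1.
Proof. by apply: g_ge => m nm; apply: g_le; exact: ltnW. Qed.

(* The pivot [sigma] is swept along [- mu], shrinking [mu n] by as much as [mu n / 2] and the
   future gaps allow. *)
Fixpoint absorbed n : R :=
  if n is m.+1 then
    absorbed m + (if mu m <= sigma - absorbed m
                  then Num.min (mu m / 2) (g m.+1 - absorbed m) else 0)
  else 0.

Let e n := if mu n <= sigma - absorbed n
           then Num.min (mu n / 2) (g n.+1 - absorbed n) else 0.

Let AS n : absorbed n.+1 = absorbed n + e n. Proof. by []. Qed.

Let A_le_g n : absorbed n <= g n.
Proof.
elim: n => [|n IH]; first by apply: g_ge.
rewrite AS /e; case: ifP => _; last by rewrite addr0 (le_trans IH).
by rewrite -lerBrDl ge_min lexx orbT.
Qed.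

Let e_ge0 n : 0 <= e n.
Proof.
rewrite /e; case: ifP => // _; rewrite le_min subr_ge0 (le_trans (A_le_g n)) // andbT.
by rewrite divr_ge0 // ltW.
Qed.

Let e_le n : e n <= mu n / 2.
Proof.
rewrite /e; case: ifP => _; first by rewrite ge_min lexx.
by rewrite divr_ge0 // ltW.
Qed.

Let t n := sigma - absorbed n.

Let t_gt0 n : 0 < t n.
Proof.
rewrite /t; elim: n => [|n IH]; first by rewrite subr0.
rewrite AS; have := e_le n; rewrite /e; case: ifP => [h|_]; last by rewrite addr0.
lra.
Qed.

(** If the remainder stayed above [eps], then eventually neither the test against the remainder nor
    the future gaps would restrict the step, and [mu n / 2] would be absorbed every time; since [mu]
    diverges, this would exceed [sigma]. *)
Let t_to0 m (eps : R) : 0 < eps -> exists2 n, (m <= n)%N & t n <= eps.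
Proof.
move=> eps0; apply: contrapT => nex.
have big n : (m <= n)%N -> eps < t n.
  by move=> mn; rewrite ltNge; apply/negP => h; apply: nex; exists n.
have [N1 h1] := mu_van eps0.
have [N2 h2] := gap_ev (divr_gt0 eps0 (ltr0n _ 2)).
pose N := maxn m (maxn N1 N2).
have eE n : (N <= n)%N -> e n = mu n / 2.
  rewrite !geq_max => /and3P[mn n1 n2].
  have tn := big n mn; have mun := h1 n n1.
  have : sigma - eps / 2 <= g n.+1.
    by apply: g_ge => k nk; have := h2 k (leq_trans n2 (ltnW nk)); have := x_ge0; lra.
  rewrite /t in tn => gn; rewrite /e ifT ?min_l //; lra.
have AE k : absorbed (N + k)%N = absorbed N + (\sum_(0 <= i < N + k) mu i - \sum_(0 <= i < N) mu i) / 2.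
  elim: k => [|k IH]; first by rewrite addn0 subrr mul0r addr0.
  rewrite addnS AS IH eE ?leq_addr // big_nat_recr //=; lra.
have [n hn] := mu_div (\sum_(0 <= i < N) mu i + 2 * sigma - 2 * absorbed N).
have := t_gt0 (N + n)%N; rewrite /t AE.
have : \sum_(0 <= i < n) mu i <= \sum_(0 <= i < N + n) mu i.
  rewrite (@big_cat_nat _ _ _ n 0%N (N + n)%N) ?leq_addl //= lerDl.
  by apply: sumr_ge0 => i _; exact: ltW.
lra.
Qed.

(** The bound [mu n / 2 <= mu' n] preserves divergence and the gap loses at most [sigma], so that
    the result can be applied again to [mu']. *)
Lemma conv_absorb : exists mu' : nat -> R,
  [/\ forall n, mu n / 2 <= mu' n <= mu n, forall n, 0 <= gap mu' nu n,
      eventually_ge x (gap mu' nu) &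
      conv ip (sumf (fun _ : unit => sigma) (fun n => - mu n)) (fun n => - mu' n)].
Proof.
pose mu' n := mu n - e n.
have gE n : gap mu' nu n = gap mu nu n - absorbed n.
  elim: n => [|n IH]; first by rewrite !gap0 subr0.
  by rewrite !gapS IH AS /mu'; lra.
exists mu'; split.
- by move=> n; rewrite /mu'; have := e_le n; have := e_ge0 n; lra.
- by move=> n; rewrite gE subr_ge0 (le_trans (A_le_g n)) // g_le.
- move=> eta eta0; have [N hN] := gap_ev eta0; exists N => n Nn.
  by have := hN n Nn; rewrite gE; have := t_gt0 n; rewrite /t; lra.
have h := @conv_sweep _ _ _ hip mu mu' t t_gt0 t_to0.
have {}h : conv ip (sumf (fun _ : unit => - t 0%N) mu) mu'.
  apply: h => // n.
  - by rewrite /t AS /mu'; lra.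
  - by rewrite /mu'; have := e_ge0 n; lra.
  - by have := t_gt0 n; have := e_le n; have := mu_gt0 n; rewrite /mu'; lra.
  - rewrite /mu' /t /e; case: ifP => hn; first by right.
    by left; rewrite subr0.
have m1 : -1 != 0 :> R by rewrite oppr_eq0 oner_eq0.
apply: conv_trans (conv_trans (@conv_affine _ _ _ hip _ _ (-1) 0 _ _ m1 h) _);
  apply: conv_refl; last by move=> n; lra.
by case=> [[]|n] /=; rewrite ?/t /=; lra.
Qed.

End Absorb.

Lemma range_min (F : nat -> R) N n : (N < n)%N ->
  exists i0, (N < i0 <= n)%N /\ forall i, (N < i <= n)%N -> F i0 <= F i.
Proof.
elim: n => // n IH; rewrite ltnS leq_eqVlt => /predU1P[->|/IH [i0 [/andP[Ni0 i0n] h]]].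
  exists n.+1; rewrite ltnSn; split => // i /andP[ni i_n].
  by have /eqP -> : i == n.+1 by rewrite eqn_leq i_n ni.
case: (leP (F i0) (F n.+1)) => c.
  exists i0; rewrite Ni0 (leq_trans i0n) //; split=> // i /andP[Ni].
  by rewrite leq_eqVlt => /predU1P[->//|i_n]; apply: h; rewrite Ni.
exists n.+1; rewrite leqnn (leq_trans Ni0) ?(leq_trans i0n) //; split=> // i /andP[Ni].
rewrite leq_eqVlt => /predU1P[->//|i_n]; apply: le_trans (ltW c) (h _ _).
by rewrite Ni.
Qed.

Lemma max0_step (a r : R) : 0 <= r ->
  Num.max 0 a - r <= Num.max 0 (a - r) <= Num.max 0 a.
Proof.
by move=> r0; apply/andP; case: (lerP 0 a) => h3; case: (lerP 0 (a - r)) => h4;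
  split; lra.
Qed.

Section Stages.
Variables (mu nu : nat -> R).
Hypotheses (mu_gt0 : forall n, 0 < mu n) (mu_van : vanishing mu) (mu_div : divergent mu).
Hypotheses (gap_ge0 : forall n, 0 <= gap mu nu n).
Hypothesis gap_bnd : exists B : R, forall N, exists2 n, (N <= n)%N & gap mu nu n <= B.

Lemma liminf_exists : exists x : R, [/\ 0 <= x, eventually_ge x (gap mu nu) &
  forall (eta : R) N, 0 < eta -> exists2 n, (N <= n)%N & gap mu nu n <= x + eta].
Proof.
pose S := [set B : R | forall N, exists2 n, (N <= n)%N & gap mu nu n <= B].
have hS : has_inf S.
  split; first by have [B hB] := gap_bnd; exists B.
  by exists 0 => B /(_ 0%N) [n _]; exact: le_trans.
exists (inf S); split.
- by apply: lb_le_inf; [exact: hS.1|move=> B /(_ 0%N) [n _]; exact: le_trans].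
- move=> eta eta0; apply: contrapT => nex.
  have : S (inf S - eta).
    move=> N; apply: contrapT => nn; apply: nex; exists N => n Nn.
    by rewrite leNgt; apply/negP => lt; apply: nn; exists n => //; exact: ltW.
  by move=> /(ge_inf hS.2) h; lra.
- move=> eta N eta0; have [B SB lt] := inf_adherent eta0 hS.
  have [n Nn hn] := SB N; exists n => //; exact: le_trans hn (ltW lt).
Qed.

(* [Out i] is the amount carried across position [i] by the stage: it is proportional to the
   partial sums of [mu] up to [K], constant up to [n], and then returned in small portions.
   Since [n1] minimizes the ratio of the gap to the carried amount, the gap at [n1] closes. *)
Lemma stage N : exists M (Out : nat -> R) n1, [/\ (N < n1 < M)%N,
   forall i, 0 <= Out i <= gap mu nu i,
   forall i, (i <= N)%N || (M <= i)%N -> Out i = 0,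
   Out n1 = gap mu nu n1 &
   conv ip (fun i : 'I_(M - N) => mu (N + i)%N)
           (fun i : 'I_(M - N) => mu (N + i)%N + Out (N + i)%N - Out (N + i).+1)].
Proof.
have [x [x0 x_ev x_freq]] := liminf_exists.
pose S i := \sum_(N <= j < i) mu j.
have SS i : (N <= i)%N -> S i.+1 = S i + mu i by move=> Ni; rewrite /S big_nat_recr.
have Sle i j : (i <= j)%N -> S i <= S j.
  move=> ij; case: (leqP i N) => iN; rewrite /S.
    by rewrite (big_geq iN) sumr_ge0 // => k _; exact: ltW.
  rewrite [X in _ <= X](@big_cat_nat _ _ _ i) ?(ltnW iN) //= lerDl.
  by apply: sumr_ge0 => k _; exact: ltW.
have Spos i : (N < i)%N -> 0 < S i.
  move=> Ni; apply: lt_le_trans (Sle _ _ Ni).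
  by rewrite SS // /S big_geq // add0r.
have [K NK SK] : exists2 K, (N < K)%N & 2 * (x + 1) <= S K.
  have [n hn] := mu_div (\sum_(0 <= i < N) mu i + 2 * (x + 1)).
  exists (maxn N.+1 n); first by rewrite leq_max leqnn.
  apply: le_trans (Sle n _ (leq_maxr _ _)).
  have Nn : (N <= n)%N.
    rewrite leqNgt; apply/negP => nN; move: hn; apply/negP; rewrite -ltNge.
    apply: (@le_lt_trans _ _ (\sum_(0 <= i < N) mu i)); last by lra.
    rewrite [X in _ <= X](@big_cat_nat _ _ _ n) ?(ltnW nN) //= lerDl.
    by apply: sumr_ge0 => k _; exact: ltW.
  by move: hn; rewrite (@big_cat_nat _ _ _ N 0%N n) //= /S; lra.
have [c c0 cmu] : exists2 c : R, 0 < c & forall i, (N <= i < K)%N -> 2 * c <= mu i.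
  have [i0 [_ h]] := range_min (fun i => mu i.-1) NK.
  exists (mu i0.-1 / 2) => [|i /andP[Ni iK]]; first by rewrite divr_gt0.
  by have := h i.+1; rewrite ltnS Ni iK /= => /(_ isT); lra.
pose r := c / 2.
have r0 : 0 < r by rewrite divr_gt0.
(* Gaps beyond [n] will be at least [x - eta], and [X] at most [x + eta]. As [2 * eta <= r],
   returning a single portion [r] brings the carried amount down to at most every later gap. *)
pose eta := Num.min 1 (r / 2).
have eta0 : 0 < eta by rewrite lt_min ltr01 divr_gt0.
have eta1 : eta <= 1 by rewrite ge_min lexx.
have eta2 : 2 * eta <= r.
  have : eta <= r / 2 by rewrite ge_min lexx orbT.
  lra.
have [N1 h1] := mu_van r0.
have [N2 h2] := x_ev _ eta0.
have [n nN gn] := x_freq _ (maxn K (maxn N1 N2)) eta0.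
move: nN; rewrite !geq_max => /and3P[Kn N1n N2n].
have Nn := leq_trans NK Kn : (N < n)%N.

pose m i := minn i K.
have mS i : (i < K)%N -> m i.+1 = i.+1 by move=> iK; apply/minn_idPl.
have mS' i : (i < K)%N -> m i = i by move=> iK; apply/minn_idPl; exact: ltnW.
have mK i : (K <= i)%N -> m i = K by move=> Ki; apply/minn_idPr.
have [n1 [/andP[Nn1 n1n] n1min]] := range_min (fun i => gap mu nu i / S (m i)) Nn.
pose s := gap mu nu n1 / S (m n1).
have mpos i : (N < i)%N -> 0 < S (m i) by move=> Ni; apply: Spos; rewrite leq_min Ni NK.
have s0 : 0 <= s by rewrite divr_ge0 ?gap_ge0 // ltW // mpos.
have sle i : (N < i <= n)%N -> s * S (m i) <= gap mu nu i.
  move=> Nin; rewrite -ler_pdivlMr; first exact: n1min.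
  by apply: mpos; case/andP: Nin.
pose X := s * S K.
have Xn : X <= x + eta.
  by apply: le_trans gn; have := sle n; rewrite Nn leqnn mK // => /(_ isT).
have X0 : 0 <= X by rewrite mulr_ge0 // ltW // Spos.
(* [S K] was taken at least [2 * (x + 1)] for this purpose: no entry before [K] gives up more than
   half of itself, so all of them stay at or above [c]. *)
have s12 : s <= 1 / 2.
  have : s * (2 * (x + 1)) <= x + 1.
    by apply: le_trans (ler_wpM2l s0 SK) _; rewrite -/X; lra.
  move=> hs; have x1 : 0 < 2 * (x + 1) by lra.
  by rewrite -(ler_pM2r x1); lra.
pose q := Num.bound (X / r).
have hq : X < q%:R * r.
  by rewrite -ltr_pdivrMr //; apply: archi_boundP; rewrite divr_ge0 // ltW.
pose P j : R := Num.max 0 (X - j%:R * r).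
pose Out i := if (i <= N)%N then 0 else if (i <= n)%N then s * S (m i) else P (i - n)%N.
have ON i : (i <= N)%N -> Out i = 0 by rewrite /Out => ->.
have On i : (N <= i <= n)%N -> Out i = s * S (m i).
  rewrite /Out => /andP[Ni i_n]; case: leqP => iN; last by rewrite i_n.
  have -> : i = N by apply/eqP; rewrite eqn_leq iN Ni.
  by rewrite mS' // /S big_geq // mulr0.
have OP j : Out (n + j)%N = P j.
  case: j => [|j].
    rewrite addn0 On ?leqnn ?(ltnW Nn) // mK // /P mul0r subr0 max_r //.
  rewrite /Out leqNgt (leq_trans Nn) ?leq_addr //= addnS leqNgt ltnS leq_addr /=.
  by rewrite subSn ?leq_addr // addKn.
have PS j : P j - r <= P j.+1 <= P j.
  by rewrite /P -natr1 mulrDl mul1r opprD addrA; apply: max0_step; exact: ltW.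
have big_0 i : (n + q <= i)%N -> Out i = 0.
  move=> h; rewrite -(subnKC (leq_trans (leq_addr q n) h)) OP /P max_l //.
  have : (q%:R : R) <= (i - n)%:R by rewrite ler_nat leq_subRL // (leq_trans _ h) // leq_addr.
  by move=> h'; have := ler_wpM2r (ltW r0) h'; lra.
have q0 : (0 < q)%N.
  rewrite lt0n; apply/negP => /eqP q0; move: hq; rewrite q0 mul0r; lra.
have OX i : 0 <= Out i <= gap mu nu i.
  rewrite /Out; case: leqP => iN; first by rewrite lexx gap_ge0.
  case: leqP => i_n.
    by rewrite sle ?iN // mulr_ge0 // ltW // mpos.
  rewrite /P le_max lexx ge_max gap_ge0 /=.
  have := h2 i (leq_trans N2n (ltnW i_n)).
  have : (1 : R) <= (i - n)%:R by rewrite ler1n subn_gt0.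
  move=> h'; have := ler_wpM2r (ltW r0) h'; lra.
exists (n + q)%N, Out, n1; split.
- by rewrite Nn1 (leq_ltn_trans n1n) // -[X in (X < _)%N]addn0 ltn_add2l.
- exact: OX.
- by move=> i /orP[/ON|/big_0].
- by rewrite On ?(ltnW Nn1) // /s divfK // lt0r_neq0 // mpos.
have NM : (N <= n + q)%N by rewrite (leq_trans (ltnW Nn)) ?leq_addr.
pose mu' i := mu i + Out i - Out i.+1.
(* Entries that decrease stay at or above [c], entries that increase stay at or below [c]. With the
   total unchanged, such a flattening towards [c] lowers every hinge sum; levels above and below [c]
   are treated separately. *)
have key i : (N <= i)%N -> [\/ c <= mu' i <= mu i, mu' i = mu i | mu i <= mu' i <= c].
  move=> Ni; rewrite /mu'; case: (ltnP i K) => iK.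
    have i_n : (i < n)%N := leq_trans iK Kn.
    apply: Or31; rewrite !On ?Ni ?(ltnW i_n) ?(leq_trans Ni (leqnSn i)) //.
    rewrite mS // mS' // SS //; have := cmu i; rewrite Ni iK => /(_ isT) cm.
    have h3 : s * mu i <= mu i / 2 by have := ler_wpM2r (ltW (mu_gt0 i)) s12; lra.
    have h4 : 0 <= s * mu i by rewrite mulr_ge0 // ltW.
    by apply/andP; split; lra.
  case: (ltnP i n) => i_n.
    apply: Or32; rewrite !On ?Ni ?(ltnW i_n) ?(leq_trans Ni (leqnSn i)) //.
    by rewrite !mK ?(leq_trans iK) //; lra.
  apply: Or33; rewrite -(subnKC i_n) -addnS !OP; have /andP[p1 p2] := PS (i - n)%N.
  rewrite subnKC //; have := h1 i (leq_trans N1n i_n); rewrite /r in p1 *.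
  by move=> h; apply/andP; split; lra.
have tel : \sum_(0 <= i < n + q - N) mu' (N + i)%N = \sum_(0 <= i < n + q - N) mu (N + i)%N.
  have tel k : \sum_(0 <= i < k) mu' (N + i)%N = \sum_(0 <= i < k) mu (N + i)%N - Out (N + k)%N.
    elim: k => [|k IH]; first by rewrite !big_geq // addn0 ON // subr0.
    by rewrite !big_nat_recr //= IH /mu' addnS; lra.
  by rewrite tel subnKC // big_0 // subr0.
apply: (@conv_hinge _ _ _ hip (n + q - N) (fun i => mu (N + i)%N) (fun i => mu' (N + i)%N)) => // al.
move: key tel; clearbody mu' => key tel.
case: (leP c al) => cal.
  apply: ler_sum => i _; rewrite /hinge.
  case: (key (N + i)%N (leq_addr _ _)) => [/andP[a1 a2]|->//|/andP[a1 a2]].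
    by rewrite ge_max !le_max lexx orbT andbT; apply/orP; left; lra.
  by rewrite ge_max !le_max lexx orbT andbT; apply/orP; right; lra.
suff : \sum_(0 <= i < n + q - N) (hinge al (mu' (N + i)%N) - mu' (N + i)%N)
    <= \sum_(0 <= i < n + q - N) (hinge al (mu (N + i)%N) - mu (N + i)%N).
  by rewrite !sumrB tel lerD2r.
apply: ler_sum => i _; rewrite /hinge.
case: (key (N + i)%N (leq_addr _ _)) => [/andP[a1 a2]|->//|/andP[a1 a2]].
  by rewrite !max_l; lra.
rewrite lerBlDr ge_max; apply/andP; split.
  have : mu (N + i)%N - al <= Num.max (mu (N + i)%N - al) 0 by rewrite le_max lexx.
  lra.
have : 0 <= Num.max (mu (N + i)%N - al) 0 by rewrite le_max lexx orbT.
lra.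
Qed.

End Stages.

(** Consecutive stages produce [mu'] with nonnegative gaps, one of which vanishes inside every
    stage. Cutting at these zeros leaves finite blocks of equal sums in which the partial sums of
    [mu'] dominate those of the sorted [nu]. *)
Lemma conv_nonsummable (mu nu : nat -> R) :
  (forall n, 0 < mu n) -> vanishing mu -> divergent mu ->
  (forall i j, (i <= j)%N -> nu j <= nu i) ->
  (forall n, 0 <= gap mu nu n) ->
  (exists B : R, forall N, exists2 n, (N <= n)%N & gap mu nu n <= B) ->
  conv ip mu nu.
Proof.
move=> mu_gt0 mu_van mu_div nu_nincr gap_ge0 gap_bnd.
have [F hF] := choice (stage mu_gt0 mu_van mu_div gap_ge0 gap_bnd).
have [Out hO] := choice hF.
have [n1 hn1] := choice hO.
pose N := fix N k := if k is j.+1 then F (N j) else 0%N.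
have NS k : (N k < N k.+1)%N.
  by have [/andP[a b] _ _ _ _] := hn1 (N k); exact: ltn_trans b.
have N0 : N 0 = 0%N by [].
pose ci := cut_index N0 NS.
have ciE i k : (N k <= i < N k.+1)%N -> ci i = k by exact: cut_indexE.
have ciP i : (N (ci i) <= i < N (ci i).+1)%N by exact: cut_indexP.
pose mu' i := mu i + Out (N (ci i)) i - Out (N (ci i)) i.+1.
apply: (@conv_trans _ _ _ _ _ _ _ mu').
  apply: (conv_cut hip N0 NS) => k; have [_ _ _ _ h] := hn1 (N k).
  apply: (conv_trans h); apply: conv_refl => i.
  by rewrite /mu' (ciE _ k) // leq_addr /= -ltn_subRL.
have gE i : gap mu' nu i = gap mu nu i - Out (N (ci i)) i.
  elim: i => [|i IH].
    rewrite !gap0; have [_ _ h _ _] := hn1 (N (ci 0%N)).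
    by rewrite h ?leq0n // subr0.
  rewrite !gapS IH /mu'.
  have [e|e] : ci i.+1 = ci i \/ i.+1 = N (ci i).+1.
  - case/andP: (ciP i) => a; rewrite leq_eqVlt => /predU1P[->|b]; first by right.
    by left; apply: ciE; rewrite b (leq_trans a).
  - by rewrite e; lra.
  have -> : ci i.+1 = (ci i).+1 by apply: ciE; rewrite -e leqnn e NS.
  have [_ _ h _ _] := hn1 (N (ci i)); have [_ _ h' _ _] := hn1 (N (ci i).+1).
  rewrite (h i.+1) ?(h' i.+1) ?e ?leqnn ?orbT //; lra.
have g0 i : 0 <= gap mu' nu i.
  by rewrite gE subr_ge0; have [_ /(_ i)/andP[]] := hn1 (N (ci i)).
pose c k := if k is j.+1 then n1 (N j) else 0%N.
have cN k : (N k < c k.+1 < N k.+1)%N by have [] := hn1 (N k).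
have gc k : gap mu' nu (c k) = 0.
  case: k => [|k]; first by rewrite gap0.
  rewrite gE (ciE _ k); first by have [_ _ _ -> _] := hn1 (N k); rewrite subrr.
  by case/andP: (cN k) => a ->; rewrite ltnW.
have c0 : c 0 = 0%N by [].
have cS k : (c k < c k.+1)%N.
  case: k => [|k]; first by case/andP: (cN 0%N).
  by case/andP: (cN k) => _ h; case/andP: (cN k.+1) => h' _; exact: ltn_trans h'.
apply: (conv_cut hip c0 cS) => k.
have psum j : \sum_(0 <= i < j) (mu' (c k + i)%N - nu (c k + i)%N) = gap mu' nu (c k + j).
  elim: j => [|j IH]; first by rewrite big_geq // addn0 gc.
  by rewrite big_nat_recr //= IH addnS gapS.
apply: (@conv_majorized _ _ _ hip _ (fun i => mu' (c k + i)%N) (fun i => nu (c k + i)%N)).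
- by move=> i j ij _; apply: nu_nincr; rewrite leq_add2l.
- by move=> j _; rewrite -subr_ge0 -sumrB psum.
- by apply/eqP; rewrite -subr_eq0 -sumrB psum subnKC ?gc // ltnW.
Qed.

End NonSummable.

(** * Absolutely convergent series *)

Section AbsoluteSums.
Context {R : realType}.
Implicit Types f g : nat -> R.

Definition asum f := cvgn (series (fun n => `|f n|)).
Definition Sum f : R := limn (series f).

Lemma seriesE f n : series f n = \sum_(0 <= i < n) f i. Proof. by []. Qed.

Lemma asum_bound f (B : R) : (forall n, \sum_(0 <= i < n) `|f i| <= B) -> asum f.
Proof.
move=> h; apply: nondecreasing_is_cvgn; first exact: nondecreasing_series.
by exists B => _ [n _ <-]; exact: h.
Qed.

Lemma asum_le f g : (forall n, `|f n| <= g n) -> asum g -> asum f.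
Proof.
move=> fg ag; apply: (@asum_bound f (limn (series (fun n => `|g n|)))) => n.
apply: (@le_trans _ _ (series (fun n => `|g n|) n)).
  apply: ler_sum => i _; apply: le_trans (fg i) (ler_norm _).
by apply: nondecreasing_cvgn_le => //; exact: nondecreasing_series.
Qed.

Lemma asum_cvg f : asum f -> cvgn (series f).
Proof. exact: normed_cvg. Qed.

Lemma asumD f g : asum f -> asum g -> asum (fun n => f n + g n).
Proof.
move=> af ag; apply: (@asum_le _ (fun n => `|f n| + `|g n|)).
  by move=> n; exact: ler_normD.
rewrite /asum; under eq_fun do rewrite ger0_norm ?addr_ge0 //.
exact: is_cvg_seriesD.
Qed.

Lemma asumZ (c : R) f : asum f -> asum (fun n => c * f n).
Proof.
move=> af; apply: (@asum_le _ (fun n => `|c| * `|f n|)).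
  by move=> n; rewrite normrM.
rewrite /asum; under eq_fun do rewrite ger0_norm ?mulr_ge0 //.
exact: is_cvg_seriesZ.
Qed.

Lemma asumN f : asum f -> asum (fun n => - f n).
Proof. by rewrite /asum; under [X in _ -> cvgn (series X)]eq_fun do rewrite normrN. Qed.

Lemma asumB f g : asum f -> asum g -> asum (fun n => f n - g n).
Proof. by move=> af ag; apply: asumD => //; exact: asumN. Qed.

Lemma asum_norm f : asum f -> asum (fun n => `|f n|).
Proof. by move=> af; apply: (@asum_le _ (fun n => `|f n|)) => [n|]; rewrite ?normr_id // /asum; under eq_fun do rewrite normr_id. Qed.

Lemma asum0 : asum (fun=> 0).
Proof. by apply: (@asum_bound _ 0) => n; rewrite big1 // normr0. Qed.

Lemma SumD f g : asum f -> asum g -> Sum (fun n => f n + g n) = Sum f + Sum g.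
Proof. by move=> /asum_cvg af /asum_cvg ag; rewrite /Sum -lim_seriesD. Qed.

Lemma SumZ (c : R) f : asum f -> Sum (fun n => c * f n) = c * Sum f.
Proof. by move=> /asum_cvg af; exact: (lim_seriesZ c af). Qed.

Lemma SumN f : asum f -> Sum (fun n => - f n) = - Sum f.
Proof. by move=> /asum_cvg af; rewrite /Sum -lim_seriesN. Qed.

Lemma SumB f g : asum f -> asum g -> Sum (fun n => f n - g n) = Sum f - Sum g.
Proof. by move=> af ag; rewrite SumD ?SumN //; exact: asumN. Qed.

Lemma Sum_le f g : asum f -> asum g -> (forall n, f n <= g n) -> Sum f <= Sum g.
Proof. by move=> /asum_cvg af /asum_cvg ag fg; exact: lim_series_le. Qed.

Lemma Sum0 : Sum (fun=> 0) = 0.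
Proof.
rewrite /Sum; have -> : series (fun=> 0 : R) = (fun=> 0).
  by apply/funext => n; rewrite seriesE big1.
exact: lim_cst.
Qed.

Lemma Sum_ge0 f : asum f -> (forall n, 0 <= f n) -> 0 <= Sum f.
Proof. by move=> af f0; rewrite -Sum0; apply: Sum_le => //; exact: asum0. Qed.

Lemma Sum_norm f : asum f -> `|Sum f| <= Sum (fun n => `|f n|).
Proof. exact: lim_series_norm. Qed.

Lemma asum_shift f m : asum f -> asum (fun n => f (m + n)%N).
Proof.
move=> af; apply: (@asum_bound _ (limn (series (fun n => `|f n|)))) => n.
apply: (@le_trans _ _ (series (fun n => `|f n|) (m + n)%N)).
  rewrite seriesE [X in _ <= X](@big_cat_nat _ _ _ m) ?leq_addr //=.
  rewrite -[X in \sum_(X <= _ < (m + n)%N) _]add0n big_addn addKn.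
  rewrite [X in _ <= _ + X](eq_bigr (fun i => `|f (m + i)%N|)) => [|i _]; last by rewrite addnC.
  by rewrite lerDr sumr_ge0.
by apply: nondecreasing_cvgn_le => //; exact: nondecreasing_series.
Qed.

Local Arguments asum_shift {f} m.

Lemma Sum_shift f m : asum f ->
  Sum f = \sum_(0 <= i < m) f i + Sum (fun n => f (m + n)%N).
Proof.
move=> af; have c1 := asum_cvg af; have c2 := asum_cvg (asum_shift m af).
apply: (cvg_unique _ c1) => //.
rewrite /= -(cvg_shiftn m).
have -> : (fun n => series f (n + m)%N) =
    (fun n => \sum_(0 <= i < m) f i + series (fun n => f (m + n)%N) n).
  apply/funext => n; rewrite !seriesE addnC (@big_cat_nat _ _ _ m) ?leq_addr //=.
  congr (_ + _); rewrite -[X in \sum_(X <= _ < (m + n)%N) _]add0n big_addn addKn.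
  by apply: eq_bigr => i _; rewrite addnC.
by apply: cvgD; [exact: cvg_cst|exact: c2].
Qed.

Arguments Sum_shift {f} m.

Lemma Sum_tail f (eps : R) : asum f -> 0 < eps ->
  exists N, forall n, (N <= n)%N -> Sum (fun k => `|f (n + k)%N|) <= eps.
Proof.
move=> af e0; have an := asum_norm af.
have /cvgrPdist_le/(_ _ e0) [N _ hN] := asum_cvg an.
exists N => n Nn; have := hN n Nn.
by rewrite -/(Sum _) (Sum_shift n an) seriesE addrAC subrr add0r; apply: le_trans (ler_norm _).
Qed.

Lemma eq_Sum f g : (forall n, f n = g n) -> Sum f = Sum g.
Proof. by move=> e; congr Sum; apply/funext. Qed.

Lemma eq_asum f g : (forall n, f n = g n) -> asum f -> asum g.
Proof. by move=> e; rewrite (_ : g = f) //; apply/funext => n; rewrite e. Qed.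

Lemma Sum_part f n : asum f -> (forall n, 0 <= f n) -> \sum_(0 <= i < n) f i <= Sum f.
Proof.
move=> af f0; rewrite (Sum_shift n af) lerDl; apply: Sum_ge0 => //.
exact: asum_shift.
Qed.

Lemma asum_fin f N : (forall n, (N <= n)%N -> f n = 0) -> asum f.
Proof.
move=> f0; apply: (@asum_bound _ (\sum_(0 <= i < N) `|f i|)) => n.
apply: (@le_trans _ _ (\sum_(0 <= i < maxn n N) `|f i|)).
  rewrite [X in _ <= X](@big_cat_nat _ _ _ n) ?leq_maxl //= lerDl.
  by apply: sumr_ge0.
have z : \sum_(N <= i < maxn n N) `|f i| = 0.
  by rewrite big_nat big1 // => i /andP[Ni _]; rewrite f0 ?normr0.
by rewrite (@big_cat_nat _ _ _ N) ?leq_maxr //= z addr0.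
Qed.

Lemma Sum_fin f N : (forall n, (N <= n)%N -> f n = 0) -> Sum f = \sum_(0 <= i < N) f i.
Proof.
move=> f0; rewrite (Sum_shift N (asum_fin f0)) (@eq_Sum _ (fun=> 0)) ?Sum0 ?addr0 //.
by move=> n; rewrite f0 // leq_addr.
Qed.

Lemma esum_Sum f : (forall n, 0 <= f n) -> asum f ->
  \esum_(i in [set: nat]) (f i)%:E = (Sum f)%:E.
Proof.
move=> f0 af; rewrite -nneseries_esumT => [|n]; last by rewrite lee_fin.
rewrite /Sum -(EFin_lim (asum_cvg af)).
have -> : EFin \o series f = (fun n => (\sum_(0 <= i < n) (f i)%:E)%E) by apply/funext => n /=; rewrite sumEFin.
by [].
Qed.

Lemma asum_esum f : (forall n, 0 <= f n) ->
  (\esum_(i in [set: nat]) (f i)%:E < +oo)%E -> asum f.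
Proof.
move=> f0; rewrite -nneseries_esumT => [lt|n]; last by rewrite lee_fin.
have h n : ((\sum_(0 <= i < n) f i)%:E <= \sum_(0 <= i <oo) (f i)%:E)%E.
  rewrite -sumEFin; apply: nneseries_lim_ge => i _ _; by rewrite lee_fin.
have fin : (\sum_(0 <= i <oo) (f i)%:E)%E \is a fin_num.
  by rewrite ge0_fin_numE // nneseries_ge0 // => i _ _; rewrite lee_fin.
apply: (@asum_bound _ (fine (\sum_(0 <= i <oo) (f i)%:E)%E)) => n.
rewrite -lee_fin fineK //; under eq_bigr do rewrite ger0_norm //.
exact: h.
Qed.

Section Reindex.
Variables (q : nat -> nat).
Hypothesis q_inj : injective q.

Let esum_q f : (forall i, (forall k, q k <> i) -> f i = 0) ->
  \esum_(i in [set: nat]) (f i)%:E = \esum_(i in [set: nat]) (f (q i))%:E.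
Proof.
move=> fq; rewrite -(@esum_image R nat nat setT q (fun i => (f i)%:E)); last first.
  by move=> i j _ _; exact: q_inj.
rewrite [RHS]esum_mkcond; apply: eq_esum => i _; case: ifPn => // /negP qi.
by rewrite fq // => k e; apply: qi; rewrite inE; exists k.
Qed.

Let pos_reindex f : (forall n, 0 <= f n) -> (forall i, (forall k, q k <> i) -> f i = 0) ->
  asum f -> asum (fun k => f (q k)) /\ Sum (fun k => f (q k)) = Sum f.
Proof.
move=> f0 fq af; have e := esum_q fq; rewrite esum_Sum // in e.
have aq : asum (fun k => f (q k)).
  by apply: asum_esum => [n|]; [exact: f0|rewrite -e ltry].
by split=> //; move: e; rewrite esum_Sum // => -[].
Qed.

Lemma asum_reindex_inv f : (forall i, (forall k, q k <> i) -> f i = 0) ->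
  asum (fun k => f (q k)) -> asum f.
Proof.
move=> fq aq; apply: (@asum_le _ (fun n => `|f n|)) => //.
have h : forall i, (forall k, q k <> i) -> `|f i| = 0 by move=> i /fq ->; rewrite normr0.
apply: asum_esum => [//|]; rewrite (esum_q h) esum_Sum ?ltry //.
exact: asum_norm.
Qed.

Lemma asum_reindex f : (forall i, (forall k, q k <> i) -> f i = 0) ->
  asum f -> asum (fun k => f (q k)).
Proof.
move=> fq af.
have [//|||a _] := @pos_reindex (fun n => `|f n|).
- by move=> i /fq ->; rewrite normr0.
- exact: asum_norm.
by apply: (asum_le _ a).
Qed.

Lemma Sum_reindex f : (forall i, (forall k, q k <> i) -> f i = 0) ->
  asum f -> Sum (fun k => f (q k)) = Sum f.
Proof.
move=> fq af.
(* A signed sequence is the difference of the nonnegative sequences [fp] and its absolute value, to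
   which the rearrangement of unordered sums applies. *)
pose fp n : R := `|f n| + f n.
have fp0 n : 0 <= fp n by rewrite /fp; have := ler_norm (- f n); rewrite normrN; lra.
have fpq i : (forall k, q k <> i) -> fp i = 0 by move=> /fq e; rewrite /fp e normr0 addr0.
have nq i : (forall k, q k <> i) -> `|f i| = 0 by move=> /fq ->; rewrite normr0.
have an := asum_norm af.
have ap : asum fp by exact: asumD.
have [ap' ep] := pos_reindex fp0 fpq ap.
have [an' en] := pos_reindex (fun n => normr_ge0 (f n)) nq an.
rewrite (@eq_Sum _ (fun k => fp (q k) - `|f (q k)|)); last by move=> k; rewrite /fp addrAC subrr add0r.
rewrite SumB // ep en -SumB //; apply: eq_Sum => k; rewrite /fp addrAC subrr add0r //.
Qed.

End Reindex.

Section Split.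
Variables (e1 e2 : nat -> nat).
Hypotheses (inj1 : injective e1) (inj2 : injective e2).
Hypothesis disj : forall i j, e1 i <> e2 j.
Hypothesis cover : forall n, (exists i, e1 i = n) \/ (exists j, e2 j = n).

Let in1 n : bool := `[< exists i, e1 i = n >].
Let f1 f n := if in1 n then f n else 0.
Let f2 f n := if in1 n then 0 else f n.

Let f1E f k : f1 f (e1 k) = f (e1 k).
Proof. by rewrite /f1 ifT //; apply/asboolP; exists k. Qed.

Let f2E f k : f2 f (e2 k) = f (e2 k).
Proof. by rewrite /f2 ifF //; apply/asboolP => -[j]; exact: disj. Qed.

Let s1 f i : (forall k, e1 k <> i) -> f1 f i = 0.
Proof. by move=> h; rewrite /f1 ifF //; apply/asboolP => -[k]; exact: h. Qed.

Let s2 f i : (forall k, e2 k <> i) -> f2 f i = 0.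
Proof.
move=> h; rewrite /f2 ifT //; apply/asboolP.
by case: (cover i) => // -[k /h].
Qed.

Let f12 f n : f1 f n + f2 f n = f n.
Proof. by rewrite /f1 /f2; case: ifP; rewrite ?addr0 ?add0r. Qed.

Let a1 f : asum f -> asum (f1 f).
Proof.
by move=> /asum_norm; apply: asum_le => n; rewrite /f1; case: ifP => // _; rewrite normr0.
Qed.

Let a2 f : asum f -> asum (f2 f).
Proof.
by move=> /asum_norm; apply: asum_le => n; rewrite /f2; case: ifP => // _; rewrite normr0.
Qed.

Lemma asum_split f : asum f -> asum (fun k => f (e1 k)) /\ asum (fun k => f (e2 k)).
Proof.
move=> af; split.
  by apply: eq_asum (asum_reindex inj1 (@s1 f) (a1 af)) => k; exact: f1E.
by apply: eq_asum (asum_reindex inj2 (@s2 f) (a2 af)) => k; exact: f2E.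
Qed.

Lemma asum_unsplit f : asum (fun k => f (e1 k)) -> asum (fun k => f (e2 k)) -> asum f.
Proof.
move=> b1 b2; apply: (eq_asum (f12 f)); apply: asumD.
  apply: (asum_reindex_inv inj1 (@s1 f)); by apply: eq_asum b1 => k; rewrite f1E.
apply: (asum_reindex_inv inj2 (@s2 f)); by apply: eq_asum b2 => k; rewrite f2E.
Qed.

Lemma Sum_split f : asum f -> Sum f = Sum (fun k => f (e1 k)) + Sum (fun k => f (e2 k)).
Proof.
move=> af; rewrite -(eq_Sum (f12 f)) SumD; [|exact: a1|exact: a2].
rewrite -(Sum_reindex inj1 (@s1 f) (a1 af)) -(Sum_reindex inj2 (@s2 f) (a2 af)).
by congr (_ + _); apply: eq_Sum => k; rewrite ?f1E ?f2E.
Qed.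

End Split.
End AbsoluteSums.
Arguments asum_shift {R f} m _.
Arguments Sum_shift {R f} m _.
Arguments Sum_part {R f} n _ _.

(** * Summable sequences near 0 and 1 *)

Section Psi.
Context {R : realType}.
Implicit Types (al be x : R) (f : nat -> R).

(* [psi al] is the hinge [max (x - al) 0] minus an affine function, chosen so that it vanishes at
   0 and at 1 and can be summed over sequences converging to 0 or 1. For [al] outside (0,1) its
   sum is [majf]; for [al] in (0,1) a term in [[0,1]] contributes the opposite of what it
   contributes to [majf]. *)
Definition clamp al : R := Num.max 0 (Num.min al 1).
Definition psi al x := hinge al x - (1 - clamp al) * x + Num.min al 0.

Lemma psi_le0 al x : al <= 0 -> psi al x = Num.max (al - x) 0.
Proof.
move=> a0; rewrite /psi /clamp /hinge (@min_l _ _ al 1); last by lra.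
rewrite (@max_l _ _ 0 al) // (@min_l _ _ al 0) //.
case: (lerP (x - al) 0) => h1; case: (lerP (al - x) 0) => h2; lra.
Qed.

Lemma psi_mid al x : 0 <= al <= 1 ->
  psi al x = Num.max (- ((1 - al) * x)) (- (al * (1 - x))).
Proof.
move=> /andP[a0 a1]; rewrite /psi /clamp /hinge (@min_l _ _ al 1) //.
rewrite (@max_r _ _ 0 al) // (@min_r _ _ al 0) //.
case: (lerP (x - al) 0) => h1; case: (lerP (- ((1 - al) * x)) (- (al * (1 - x)))) => h2; nra.
Qed.

Lemma psi_ge1 al x : 1 <= al -> psi al x = Num.max (x - al) 0.
Proof.
move=> a1; rewrite /psi /clamp /hinge (@min_r _ _ al 1) //.
by rewrite (@max_r _ _ 0 1) // (@min_r _ _ al 0); lra.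
Qed.

(** The bound does not depend on [al]; this is what makes tails of [psum] uniformly small. *)
Lemma psi_bound al x : `|psi al x| <= `|x|.
Proof.
have [a0|a0] := leP al 0; first rewrite psi_le0 //.
  case: (lerP (al - x) 0) => h1; first by rewrite normr0.
  rewrite ger0_norm ?(ltW h1) //; have := ler_norm (- x); rewrite normrN; lra.
have [a1|a1] := leP al 1; last first.
  rewrite psi_ge1 ?(ltW a1) //.
  case: (lerP (x - al) 0) => h1; first by rewrite normr0.
  rewrite ger0_norm ?(ltW h1) //; have := ler_norm x; lra.
rewrite psi_mid ?(ltW a0) //.
case: (lerP 0 x) => h2; [rewrite (ger0_norm h2)|rewrite (ltr0_norm h2)]; rewrite ler_norml.
  have p1 : 0 <= al * x by rewrite mulr_ge0 // ltW.
  have p2 : 0 <= (1 - al) * x by rewrite mulr_ge0 // subr_ge0.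
  by apply/andP; case: (lerP (- ((1 - al) * x)) (- (al * (1 - x)))) => h3; split; lra.
have p1 : 0 <= al * - x by rewrite mulr_ge0 // ?ltW // oppr_gt0.
have p2 : 0 <= (1 - al) * - x by rewrite mulr_ge0 ?subr_ge0 // ltW // oppr_gt0.
by apply/andP; case: (lerP (- ((1 - al) * x)) (- (al * (1 - x)))) => h3; split; lra.
Qed.

(** Reflection exchanges the ends 0 and 1, so that only the end 0 needs a study of its own. *)
Lemma psi_sym al x : psi (1 - al) (1 - x) = psi al x.
Proof.
have [a0|a0] := leP al 0.
  rewrite (psi_le0 x a0) psi_ge1; last by lra.
  by congr (Num.max _ _); lra.
have [a1|a1] := leP al 1; last first.
  rewrite (psi_ge1 x (ltW a1)) psi_le0; last by lra.
  by congr (Num.max _ _); lra.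
rewrite !psi_mid; [|lra|lra].
by rewrite maxC; congr (Num.max _ _); lra.
Qed.

Lemma psi_bound1 al x : `|psi al (1 + x)| <= `|x|.
Proof.
rewrite -psi_sym; have -> : 1 - (1 + x) = - x by lra.
by rewrite -(normrN x); exact: psi_bound.
Qed.

Lemma psi_out al eps x : 0 <= eps -> eps <= 1 -> al < - eps \/ 1 + eps < al ->
  `|x| <= eps -> psi al x = 0.
Proof.
move=> e0 e1 ha; rewrite ler_norml => /andP[x1 x2].
by case: ha => ha; [rewrite psi_le0|rewrite psi_ge1]; rewrite ?max_r; lra.
Qed.

Lemma psi_out1 al eps x : 0 <= eps -> eps <= 1 -> al < - eps \/ 1 + eps < al ->
  `|x| <= eps -> psi al (1 + x) = 0.
Proof.
move=> e0 e1 ha; rewrite ler_norml => /andP[x1 x2].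
by case: ha => ha; [rewrite psi_le0|rewrite psi_ge1]; rewrite ?max_r; lra.
Qed.

Lemma max_lip (a b c : R) : `|Num.max a c - Num.max b c| <= `|a - b|.
Proof.
have h1 := ler_norm (a - b); have h2 := ler_norm (- (a - b)); rewrite normrN in h2.
rewrite ler_norml; apply/andP.
by case: (lerP a c) => h3; case: (lerP b c) => h4; split; lra.
Qed.

Lemma min_lip (a b c : R) : `|Num.min a c - Num.min b c| <= `|a - b|.
Proof.
have h1 := ler_norm (a - b); have h2 := ler_norm (- (a - b)); rewrite normrN in h2.
rewrite ler_norml; apply/andP.
by case: (lerP a c) => h3; case: (lerP b c) => h4; split; lra.
Qed.

Lemma psi_lip al be x : `|psi al x - psi be x| <= (2 + `|x|) * `|al - be|.
Proof.
have -> : psi al x - psi be x = (hinge al x - hinge be x)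
   + (clamp al - clamp be) * x + (Num.min al 0 - Num.min be 0) by rewrite /psi; lra.
apply: le_trans (ler_normD _ _) _.
have -> : (2 + `|x|) * `|al - be| = `|al - be| + `|al - be| * `|x| + `|al - be| by lra.
apply: lerD (min_lip _ _ _); apply: le_trans (ler_normD _ _) _; apply: lerD.
  apply: le_trans (max_lip _ _ _) _; have -> : x - al - (x - be) = - (al - be) by lra.
  by rewrite normrN.
rewrite normrM ler_wpM2r // /clamp !(maxC 0).
exact: le_trans (max_lip _ _ _) (min_lip _ _ _).
Qed.

Definition psum (c : R) f al := Sum (fun n => psi al (c + f n)).

Lemma asum_psi0 f al : asum f -> asum (fun n => psi al (0 + f n)).
Proof. by move=> /asum_norm; apply: asum_le => n; rewrite add0r; exact: psi_bound. Qed.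

Lemma asum_psi1 f al : asum f -> asum (fun n => psi al (1 + f n)).
Proof. by move=> /asum_norm; apply: asum_le => n; exact: psi_bound1. Qed.

Lemma psi_dist c al x : c = 0 \/ c = 1 -> `|psi al (c + x)| <= `|x|.
Proof. by case=> ->; [rewrite add0r; exact: psi_bound|exact: psi_bound1]. Qed.

Lemma asum_psi c f al : c = 0 \/ c = 1 -> asum f -> asum (fun n => psi al (c + f n)).
Proof. by case=> ->; [exact: asum_psi0|exact: asum_psi1]. Qed.

Lemma psum_tail c f al N : c = 0 \/ c = 1 -> asum f ->
  `|psum c f al - \sum_(0 <= i < N) psi al (c + f i)| <= Sum (fun k => `|f (N + k)%N|).
Proof.
move=> hc af; have ap := @asum_psi c f al hc af.
rewrite /psum (Sum_shift N ap) addrAC subrr add0r.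
have a1 := asum_shift N ap.
apply: le_trans (Sum_norm a1) _; apply: Sum_le.
- exact: asum_norm.
- by apply: asum_norm; exact: (asum_shift N af).
- by move=> k; exact: psi_dist.
Qed.

(** A partial sum is Lipschitz in [al], and the remainder is at most a tail of [f], for all [al] at
    once. *)
Lemma psum_continuous c f : c = 0 \/ c = 1 -> asum f -> continuous (psum c f).
Proof.
move=> hc af al; apply/cvgrPdist_le => e e0.
have [N hN] := Sum_tail af (divr_gt0 e0 (ltr0n R 4)).
pose C := \sum_(0 <= i < N) (2 + `|c + f i|) + 1.
have C0 : 0 < C.
  by apply: ltr_wpDl => //; apply: sumr_ge0 => i _; have := normr_ge0 (c + f i); lra.
near=> be.
have h1 := @psum_tail c f al N hc af; have h2 := @psum_tail c f be N hc af.
have h3 := hN N (leqnn N).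
have h4 : `|\sum_(0 <= i < N) psi al (c + f i) - \sum_(0 <= i < N) psi be (c + f i)|
    <= C * `|al - be|.
  rewrite -sumrB; apply: le_trans (ler_norm_sum _ _ _) _.
  rewrite /C mulrDl mul1r mulr_suml; apply: ler_wpDr => //.
  by apply: ler_sum => i _; exact: psi_lip.
have h5 : C * `|al - be| <= e / 2.
  rewrite mulrC -ler_pdivlMr //; near: be.
  by apply: cvgr_dist_le => //; rewrite !divr_gt0.
move: h1 h2 h4; rewrite !ler_norml => /andP[p1 p2] /andP[q1 q2] /andP[r1 r2].
apply/andP; split; lra.
Unshelve. all: by end_near.
Qed.
End Psi.

(** * Exchanging summable tails by sweeps *)

Section Tails.
Context {R : realType} {H : lmodType R[i]}.
Variable (ip : H -> H -> R[i]).
Hypothesis hip : hform ip.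
Hypothesis ip_ge0 : forall z, 0 <= ip z z.

(** The pivot is minus the sum of the remaining differences, so it tends to 0 by itself. That sum is
    at least the next two differences, whence the form of the last two hypotheses. *)
Lemma conv_sweep_sum (x y : nat -> R) : asum (fun n => x n - y n) ->
  (forall n, 0 < x n - y n) ->
  (forall n, - y n <= (x n - y n) + (x n.+1 - y n.+1)) ->
  (forall n, x n <= (x n - y n) + (x n.+1 - y n.+1)) ->
  conv ip (sumf (fun _ : unit => - Sum (fun n => x n - y n)) x) y.
Proof.
move=> adel del0 hy hx.
pose t n := Sum (fun k => x (n + k)%N - y (n + k)%N).
have at_ n : asum (fun k => x (n + k)%N - y (n + k)%N) by exact: (asum_shift n adel).
have tS n : t n = (x n - y n) + t n.+1.
  rewrite /t (Sum_shift 1 (at_ n)) big_nat1 addn0; congr (_ + _).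
  by apply: eq_Sum => k; rewrite addnA addn1.
have t0 n : 0 <= t n by apply: Sum_ge0 => // k; exact: ltW.
have t2 n : (x n - y n) + (x n.+1 - y n.+1) <= t n.
  by have := tS n; have := tS n.+1; have := t0 n.+2; lra.
have tE : t 0%N = Sum (fun n => x n - y n) by apply: eq_Sum.
rewrite -tE; apply: (conv_sweep hip) => //.
- by move=> n; rewrite tS; have := t0 n.+1; have := del0 n; lra.
- move=> m eps e0; have [N hN] := Sum_tail adel e0.
  exists (maxn m N); first exact: leq_maxl.
  apply: le_trans (hN _ (leq_maxr m N)); apply: le_trans (ler_norm _) _.
  exact: Sum_norm.
- by move=> n; rewrite (tS n); lra.
- by move=> n; have := del0 n; lra.
- by move=> n; have := t2 n; have := hy n; lra.
- by move=> n; right; have := t2 n; have := hx n; lra.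
Qed.

(* [w] decreases at most by half at each step and dominates both [x] and [y]; sweeping from [x] to
   [3 * w] and from there to [y] is then possible, at the cost of two pivots. *)
Lemma conv_tail (x y : nat -> R) (kap : R) : asum x -> asum y -> 0 < kap ->
  Sum (fun n => `|x n|) <= kap -> Sum (fun n => `|y n|) <= kap ->
  exists p1 p2 : R, [/\ `|p1| <= 20 * kap, `|p2| <= 20 * kap, p1 + p2 = Sum y - Sum x &
    conv ip (sumf (fun _ : unit => p2) (sumf (fun _ : unit => p1) x)) y].
Proof.
move=> ax ay k0 xk yk.
(* The geometric term makes [a] positive, with sum at most [3 * kap]; then [w] has sum at most
   [6 * kap]. A pivot, the sum of [3 * w] corrected by at most [kap], is bounded by [19 * kap]. *)
pose a n : R := `|x n| + `|y n| + kap * 2^-1 ^+ n.+1.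
pose w := fix w n : R := if n is m.+1 then a m.+1 + w m / 2 else a 0%N.
have a_gt0 n : 0 < a n.
  rewrite /a ltr_wpDl ?addr_ge0 // mulr_gt0 // exprn_gt0 // invr_gt0 //.
have w_gt0 n : 0 < w n by elim: n => [|n IH] //=; rewrite addr_gt0 // divr_gt0.
have aw n : a n <= w n by case: n => [|n] //=; rewrite lerDl divr_ge0 // ltW.
have ww n : w n / 2 <= w n.+1 by rewrite /= lerDr ltW.
have xw n : `|x n| <= w n.
  by apply: le_trans (aw n); rewrite /a -addrA lerDl addr_ge0 // mulr_ge0 // ltW.
have yw n : `|y n| <= w n.
  by apply: le_trans (aw n); rewrite /a addrAC lerDr addr_ge0 // mulr_ge0 // ltW.
have sa n : \sum_(0 <= i < n) a i <= 3 * kap.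
  rewrite /a !big_split /= -mulr_sumr.
  have s1 := Sum_part n (asum_norm ax) (fun k => normr_ge0 (x k)).
  have s2 := Sum_part n (asum_norm ay) (fun k => normr_ge0 (y k)).
  have s3 : \sum_(0 <= i < n) 2^-1 ^+ i.+1 = 1 - 2^-1 ^+ n :> R.
    elim: n {s1 s2} => [|n IH]; first by rewrite big_geq // expr0 subrr.
    by rewrite big_nat_recr //= IH exprSr; lra.
  have s4 : (0 : R) <= 2^-1 ^+ n by rewrite exprn_ge0 // invr_ge0.
  rewrite s3; have : kap * (1 - 2^-1 ^+ n) <= kap * 1 by rewrite ler_pM2l //; lra.
  lra.
have sw n : \sum_(0 <= i < n.+1) w i + w n <= 2 * \sum_(0 <= i < n.+1) a i.
  elim: n => [|n IH]; first by rewrite !big_nat1 /=; lra.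
  rewrite big_nat_recr //= [X in _ <= 2 * X]big_nat_recr //=; lra.
have sw6 n : \sum_(0 <= i < n) `|w i| <= 6 * kap.
  case: n => [|n]; first by rewrite big_geq // mulr_ge0 // ltW.
  rewrite (eq_bigr w) => [|i _]; last by rewrite ger0_norm // ltW.
  by have := sw n; have := sa n.+1; have := w_gt0 n; lra.
have aW : asum w := asum_bound sw6.
have a3w : asum (fun n => 3 * w n) by exact: asumZ.
have Sw : Sum (fun n => `|w n|) <= 6 * kap.
  apply: limr_le; first exact: (asum_cvg (asum_norm aW)).
  by apply: nearW => n; exact: sw6.
have Sw' : `|Sum w| <= 6 * kap by exact: le_trans (Sum_norm aW) Sw.
have Sx : `|Sum x| <= kap by exact: le_trans (Sum_norm ax) xk.
have Sy : `|Sum y| <= kap by exact: le_trans (Sum_norm ay) yk.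
(* The factor 3 makes each difference at least [2 * w]; as [w] at most halves, the next difference
   is at least [w n], which is the look-ahead needed. *)
have up : conv ip (sumf (fun _ : unit => Sum (fun n => 3 * w n - x n)) x) (fun n => 3 * w n).
  have h : conv ip (sumf (fun _ : unit => - Sum (fun n => - x n - - (3 * w n))) (fun n => - x n))
              (fun n => - (3 * w n)).
    apply: conv_sweep_sum.
    - by apply: asumB; exact: asumN.
    - by move=> n; have := w_gt0 n; have := xw n; rewrite ler_norml => /andP[]; lra.
    - move=> n; have := ww n; have := w_gt0 n; have := xw n; have := xw n.+1.
      rewrite !ler_norml => /andP[u1 u2] /andP[u3 u4]; lra.
    - move=> n; have := ww n; have := w_gt0 n; have := xw n; have := xw n.+1.
      rewrite !ler_norml => /andP[u1 u2] /andP[u3 u4]; lra.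
  have m1 : -1 != 0 :> R by rewrite oppr_eq0 oner_eq0.
  apply: conv_trans (conv_trans (@conv_affine _ _ _ hip _ _ (-1) 0 _ _ m1 h) _);
    apply: conv_refl; last by move=> n; lra.
  case=> [[]|n] /=; last by lra.
  rewrite (@eq_Sum _ _ (fun n => 3 * w n - x n)); first by lra.
  by move=> n; lra.
have down : conv ip (sumf (fun _ : unit => - Sum (fun n => 3 * w n - y n)) (fun n => 3 * w n)) y.
  apply: conv_sweep_sum.
  - exact: asumB.
  - by move=> n; have := w_gt0 n; have := yw n; rewrite ler_norml => /andP[]; lra.
  - move=> n; have := ww n; have := w_gt0 n; have := yw n; have := yw n.+1.
    rewrite !ler_norml => /andP[u1 u2] /andP[u3 u4]; lra.
  - move=> n; have := ww n; have := w_gt0 n; have := yw n; have := yw n.+1.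
    rewrite !ler_norml => /andP[u1 u2] /andP[u3 u4]; lra.
exists (Sum (fun n => 3 * w n - x n)), (- Sum (fun n => 3 * w n - y n)); split.
- rewrite SumB // SumZ //; move: Sw' Sx; rewrite !ler_norml => /andP[u1 u2] /andP[u3 u4].
  apply/andP; split; lra.
- rewrite SumB // SumZ //; move: Sw' Sy; rewrite !ler_norml => /andP[u1 u2] /andP[u3 u4].
  apply/andP; split; lra.
- by rewrite !SumB //; lra.
- apply: conv_trans down; apply: (conv_sum hip) => //; exact: conv_refl.
Qed.

End Tails.

(** * Finite lists as families of diagonal entries *)

Section FiniteLists.
Context {R : realType} {H : lmodType R[i]}.
Variable (ip : H -> H -> R[i]).
Hypothesis hip : hform ip.

Definition ofs (s : seq R) (i : 'I_(size s)) : R := nth 0 s i.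
Arguments ofs : clear implicits.

Lemma conv_hinge_seq (s t : seq R) : size s = size t ->
  \sum_(x <- s) x = \sum_(x <- t) x ->
  (forall al, \sum_(x <- t) hinge al x <= \sum_(x <- s) hinge al x) ->
  conv ip (ofs s) (ofs t).
Proof.
move=> st eqsum hin.
have h : conv ip (fun i : 'I_(size s) => nth 0 s i) (fun i : 'I_(size s) => nth 0 t i).
  have bn (u : seq R) (F : R -> R) : \sum_(0 <= i < size u) F (nth 0 u i) = \sum_(x <- u) F x.
    by rewrite [RHS](big_nth 0).
  apply: (conv_hinge hip); first by rewrite (bn s id) st (bn t id).
  by move=> al; rewrite (bn s (hinge al)) st (bn t (hinge al)).
apply: conv_trans h _.
apply: (@conv_reindex _ _ _ _ _ (cast_ord (esym st))) => //.
by move=> i; exists (cast_ord st i); rewrite cast_ordK.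
Qed.

Lemma conv_ofs_cat (s t : seq R) :
  conv ip (ofs (s ++ t)) (sumf (ofs s) (ofs t)) /\
  conv ip (sumf (ofs s) (ofs t)) (ofs (s ++ t)).
Proof.
pose c := cast_ord (esym (size_cat s t)).
pose c' := cast_ord (size_cat s t).
have cK i : c' (c i) = i by rewrite /c /c' cast_ordKV.
have cK' i : c (c' i) = i by rewrite /c /c' cast_ordK.
have un z : sumf (ofs s) (ofs t) z = ofs (s ++ t) (c (unsplit z)).
  case: z => i; rewrite /ofs /= nth_cat; first by rewrite ltn_ord.
  by rewrite ltnNge leq_addr /= addKn.
split.
  apply: (@conv_reindex _ _ _ _ _ (fun z => c (unsplit z))) => //.
    move=> x y /(congr1 (fun z => fintype.split (c' z))); by rewrite !cK !unsplitK.
  by move=> i; exists (fintype.split (c' i)); rewrite splitK cK'.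
apply: (@conv_reindex _ _ _ _ _ (fun i => fintype.split (c' i))).
- move=> x y /(congr1 (fun z => c (unsplit z))); by rewrite !splitK !cK'.
- by move=> z; exists (c (unsplit z)); rewrite cK unsplitK.
- by move=> i; rewrite un splitK cK'.
Qed.

Lemma conv_ofs1 (a : R) : conv ip (ofs [:: a]) (fun _ : unit => a).
Proof.
apply: (@conv_reindex _ _ _ _ _ (fun _ => ord0)) => //; first by move=> [] [].
by move=> i; exists tt; rewrite (ord1 i).
Qed.

Lemma conv_take (l : nat -> R) n :
  conv ip l (sumf (ofs (mkseq l n)) (fun k => l (n + k)%N)) /\
  conv ip (sumf (ofs (mkseq l n)) (fun k => l (n + k)%N)) l.
Proof.
have sz := size_mkseq l n.
pose g (z : 'I_(size (mkseq l n)) + nat) : nat :=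
  match z with inl i => i | inr k => (n + k)%N end.
have lt_n (i : 'I_(size (mkseq l n))) : (i < n)%N := leq_trans (ltn_ord i) (eq_leq sz).
have g_inj : injective g.
  move=> [i|i] [j|j] //=.
  - by move/ord_inj => ->.
  - by move=> e; have := lt_n i; rewrite e ltnNge leq_addr.
  - by move=> e; have := lt_n j; rewrite -e ltnNge leq_addr.
  - by move/addnI => ->.
have gl z : sumf (ofs (mkseq l n)) (fun k => l (n + k)%N) z = l (g z).
  by case: z => // i; rewrite /= /ofs nth_mkseq // lt_n.
have g_surj k : exists z, g z = k.
  case: (ltnP k n) => kn; last by exists (inr (k - n)%N); rewrite /= subnKC.
  by rewrite -sz in kn; exists (inl (Ordinal kn)).
split; first exact: (@conv_reindex _ _ _ _ _ g).
have [h hg] := choice g_surj.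
apply: (@conv_reindex _ _ _ _ _ h).
- by move=> x y /(congr1 g); rewrite !hg.
- by move=> z; exists (g z); apply: g_inj; rewrite hg.
- by move=> k; rewrite gl hg.
Qed.

Lemma conv_assoc (I J K : Type) (a : I -> R) (b : J -> R) (c : K -> R) :
  conv ip (sumf (sumf a b) c) (sumf a (sumf b c)) /\
  conv ip (sumf a (sumf b c)) (sumf (sumf a b) c).
Proof.
split.
  apply: (@conv_reindex _ _ _ _ _ (fun z : I + (J + K) => match z with
    inl i => inl (inl i) | inr (inl j) => inl (inr j) | inr (inr k) => inr k end)).
  - by move=> [i|[i|i]] [j|[j|j]] //= [->].
  - by move=> [[i|i]|i]; [exists (inl i)|exists (inr (inl i))|exists (inr (inr i))].
  - by move=> [i|[i|i]].
apply: (@conv_reindex _ _ _ _ _ (fun z : (I + J) + K => match z with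
    inl (inl i) => inl i | inl (inr j) => inr (inl j) | inr k => inr (inr k) end)).
- by move=> [[i|i]|i] [[j|j]|j] //= [->].
- by move=> [i|[i|i]]; [exists (inl (inl i))|exists (inl (inr i))|exists (inr i)].
- by move=> [[i|i]|i].
Qed.

Lemma conv_interchange (I J K L : Type) (a : I -> R) (b : J -> R) (c : K -> R) (d : L -> R) :
  conv ip (sumf (sumf a b) (sumf c d)) (sumf (sumf a c) (sumf b d)).
Proof.
apply: (@conv_reindex _ _ _ _ _ (fun z : (I + K) + (J + L) => match z with
    inl (inl i) => inl (inl i) | inl (inr k) => inr (inl k)
  | inr (inl j) => inl (inr j) | inr (inr l) => inr (inr l) end)).
- by move=> [[i|i]|[i|i]] [[j|j]|[j|j]] //= [->].
- by move=> [[i|i]|[i|i]]; [exists (inl (inl i))|exists (inr (inl i))|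
    exists (inl (inr i))|exists (inr (inr i))].
- by move=> [[i|i]|[i|i]].
Qed.

End FiniteLists.
Arguments ofs {R} s i.

(** * Summable deviations at both ends *)

Section SummableCase.
Context {R : realType} {H : lmodType R[i]}.
Variable (ip : H -> H -> R[i]).
Hypothesis hip : hform ip.
Hypothesis ip_ge0 : forall z, 0 <= ip z z.

Lemma sum_mkseq (F : R -> R) (l : nat -> R) n :
  \sum_(x <- mkseq l n) F x = \sum_(0 <= i < n) F (l i).
Proof. by rewrite big_map /index_iota subn0. Qed.

(** The minimum over [0,1] is positive, and continuity at 0 and 1 extends the bound a little. The
    margin is needed because pivots and tails close to 0 or 1 also count at levels slightly outside
    the interval. *)
Lemma uniform_gap (h : R -> R) : continuous h -> (forall al : R, 0 <= al <= 1 -> 0 < h al) ->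
  exists eps eta : R, [/\ 0 < eps <= 1, 0 < eta &
    forall al : R, - eps <= al <= 1 + eps -> eta <= h al].
Proof.
move=> ch h0.
have [c cin cmin] : exists2 c : R, c \in `[0, 1] & forall t : R, t \in `[0, 1] -> h c <= h t.
  by apply: EVT_min => //; apply: continuous_subspaceT => x; exact: ch.
have hc : 0 < h c by apply: h0; rewrite in_itv /= in cin.
have half x : 0 < h x -> exists2 e : R, 0 < e & forall y, `|x - y| < e -> h x / 2 <= h y.
  move=> hx; have /cvgrPdist_le/(_ _ (divr_gt0 hx (ltr0n _ 2))) := ch x.
  move=> /nbhs_ballP[e e0 he]; exists e => // y xy.
  have := he y xy; rewrite ler_norml => /andP[_]; lra.
have p0 : 0 < h 0 by apply: h0; rewrite lexx ler01.
have p1 : 0 < h 1 by apply: h0; rewrite lexx ler01.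
have [e1 e10 h1] := half 0 p0.
have [e2 e20 h2] := half 1 p1.
pose eps := Num.min 1 (Num.min (e1 / 2) (e2 / 2)).
have eps0 : 0 < eps by rewrite !lt_min ltr01 !divr_gt0.
have epsa : eps <= e1 / 2 by rewrite !ge_min lexx ?orbT.
have epsb : eps <= e2 / 2 by rewrite !ge_min lexx ?orbT.
exists eps, (Num.min (h c) (Num.min (h 0 / 2) (h 1 / 2))); split.
- by rewrite eps0 ge_min lexx.
- by rewrite !lt_min hc !divr_gt0.
move=> al /andP[a1 a2]; rewrite !ge_min.
have [al0|al0] := ltP al 0.
  rewrite h1 ?orbT // sub0r normrN ltr0_norm //; lra.
have [al1|al1] := leP al 1.
  by rewrite cmin // in_itv /= al0.
by rewrite h2 ?orbT // distrC gtr0_norm; lra.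
Qed.

Lemma balance N a b :
  (N + a + a + 2 + (N + b + b + 2) = N + a + b + 1 + 1 + (N + a + b + 1 + 1))%N.
Proof. lia. Qed.

Definition hsum (l0 l1 : nat -> R) al := psum 0 l0 al + psum 1 l1 al.

(* Moving [a] terms from 1 to 0 and [b] terms back is encoded by truncating the four sequences at
   different lengths, so that the two finite lists have the same size and the same sum. *)
Lemma conv_summable (l0 l1 d0 d1 : nat -> R) (a b : nat) :
  asum l0 -> asum l1 -> asum d0 -> asum d1 ->
  (forall al, hsum d0 d1 al <= hsum l0 l1 al) ->
  (forall al : R, 0 <= al <= 1 -> hsum d0 d1 al < hsum l0 l1 al) ->
  Sum l0 + Sum l1 + b%:R = Sum d0 + Sum d1 + a%:R ->
  conv ip (sumf l0 (fun n => 1 + l1 n)) (sumf d0 (fun n => 1 + d1 n)).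
Proof.
move=> al0 al1 ad0 ad1 hle hlt trace.
have c0 : (0 : R) = 0 \/ (0 : R) = 1 by left.
have c1 : (1 : R) = 0 \/ (1 : R) = 1 by right.
pose h al := hsum l0 l1 al - hsum d0 d1 al.
have ch : continuous h.
  move=> x; apply: cvgB; apply: cvgD; exact: psum_continuous.
have [al /hlt|eps [eta [/andP[eps0 eps1] eta0 gap]]] := uniform_gap ch.
  by rewrite /h subr_gt0.
(* Four pivots of size at most [20 * kap] and four tails of at most [kap] disturb the inequality by
   at most [84 * kap], less than [eta]. Pivots of size at most [eps] contribute nothing at levels
   outside [-eps, 1 + eps]. *)
pose kap := Num.min (eta / 200) (eps / 20).
have kap0 : 0 < kap by rewrite lt_min !divr_gt0.
have kap_eta : 200 * kap <= eta.
  have : kap <= eta / 200 by rewrite ge_min lexx.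
  lra.
have kap_eps : 20 * kap <= eps.
  have : kap <= eps / 20 by rewrite ge_min lexx orbT.
  lra.
have [N1 t1] := Sum_tail al0 kap0; have [N2 t2] := Sum_tail al1 kap0.
have [N3 t3] := Sum_tail ad0 kap0; have [N4 t4] := Sum_tail ad1 kap0.
pose N := maxn (maxn N1 N2) (maxn N3 N4).
have NN1 : (N1 <= N)%N by rewrite !leq_max leqnn.
have NN2 : (N2 <= N)%N by rewrite !leq_max leqnn orbT.
have NN3 : (N3 <= N)%N by rewrite !leq_max leqnn !orbT.
have NN4 : (N4 <= N)%N by rewrite !leq_max leqnn !orbT.
(* With its two pivots each target list has [n + 2] entries, and [p + q = 2 * (n + 2)]. The surplus
   [q - (n + 2) = b - a] of source entries near 1 is the one prescribed by the trace relation. *)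
pose p := (N + a + a + 2)%N; pose q := (N + b + b + 2)%N; pose n := (N + a + b)%N.
have pN : (N <= p)%N by rewrite /p -!addnA leq_addr.
have qN : (N <= q)%N by rewrite /q -!addnA leq_addr.
have nN : (N <= n)%N by rewrite /n -!addnA leq_addr.
have {}t1 := t1 p (leq_trans NN1 pN); have {}t2 := t2 q (leq_trans NN2 qN).
have {}t3 := t3 n (leq_trans NN3 nN); have {}t4 := t4 n (leq_trans NN4 nN).
have [p1 [p2 [p1b p2b p12 conv0]]] :=
  conv_tail hip ip_ge0 (asum_shift p al0) (asum_shift n ad0) kap0 t1 t3.
have [p3 [p4 [p3b p4b p34 conv1]]] :=
  conv_tail hip ip_ge0 (asum_shift q al1) (asum_shift n ad1) kap0 t2 t4.
pose one_ (d : nat -> R) k := 1 + d k.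
pose src := mkseq l0 p ++ mkseq (one_ l1) q.
pose tgt0 := (mkseq d0 n ++ [:: p2]) ++ [:: p1].
pose tgt1 := (mkseq (one_ d1) n ++ [:: 1 + p4]) ++ [:: 1 + p3].
pose tgt := tgt0 ++ tgt1.
have srcE (F : R -> R) : \sum_(x <- src) F x =
    \sum_(0 <= i < p) F (0 + l0 i) + \sum_(0 <= i < q) F (1 + l1 i).
  rewrite big_cat !sum_mkseq /=; congr (_ + _).
  by apply: eq_bigr => i _; rewrite add0r.
have tgtE (F : R -> R) : \sum_(x <- tgt) F x =
    \sum_(0 <= i < n) F (0 + d0 i) + \sum_(0 <= i < n) F (1 + d1 i)
    + (F p1 + F p2 + F (1 + p3) + F (1 + p4)).
  rewrite !big_cat !sum_mkseq !big_seq1 /=.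
  under [in RHS]eq_bigr do rewrite add0r.
  by rewrite /one_; lra.
have szeq : size src = size tgt.
  by rewrite !size_cat !size_mkseq /= /p /q /n balance.
have sumeq : \sum_(x <- src) x = \sum_(x <- tgt) x.
  rewrite (srcE id) (tgtE id) /= !big_split /= !big1_eq !sumr_const_nat !subn0.
  have := Sum_shift p al0; have := Sum_shift q al1.
  have := Sum_shift n ad0; have := Sum_shift n ad1.
  have : q%:R = N%:R + b%:R + b%:R + 2 :> R by rewrite /q !natrD.
  have : n%:R = N%:R + a%:R + b%:R :> R by rewrite /n !natrD.
  lra.
have hin al : \sum_(x <- tgt) hinge al x <= \sum_(x <- src) hinge al x.
  (* [hinge] and [psi] differ by an affine function, so for lists of equal length and equal sum the
     two comparisons are equivalent. *)
  have hE (s : seq R) : \sum_(x <- s) hinge al x =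
      \sum_(x <- s) psi al x + (1 - clamp al) * (\sum_(x <- s) x) - (size s)%:R * Num.min al 0.
    elim: s => [|x s IH]; first by rewrite !big_nil /=; lra.
    by rewrite !big_cons IH /= -natr1 /psi; lra.
  rewrite !hE sumeq szeq !lerD2r (srcE (psi al)) (tgtE (psi al)).
  have b1 := @psum_tail _ 0 l0 al p c0 al0; have b2 := @psum_tail _ 1 l1 al q c1 al1.
  have b3 := @psum_tail _ 0 d0 al n c0 ad0; have b4 := @psum_tail _ 1 d1 al n c1 ad1.
  case: (boolP (- eps <= al <= 1 + eps)) => [/gap|out].
    rewrite /h /hsum => hgap.
    have e1 := le_trans (psi_bound al p1) p1b; have e2 := le_trans (psi_bound al p2) p2b.
    have e3 := le_trans (psi_bound1 al p3) p3b; have e4 := le_trans (psi_bound1 al p4) p4b.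
    move: b1 b2 b3 b4 e1 e2 e3 e4; rewrite !ler_norml.
    move=> /andP[u1 v1] /andP[u2 v2] /andP[u3 v3] /andP[u4 v4].
    move=> /andP[u5 v5] /andP[u6 v6] /andP[u7 v7] /andP[u8 v8].
    lra.
  (* Here pivots and truncated tails are killed by [psi], so the finite sums are the full sums
     compared in [hle]. *)
  have {}out : al < - eps \/ 1 + eps < al.
    by move: out; rewrite negb_and -!ltNge => /orP.
  have sm (x : R) : `|x| <= 20 * kap -> `|x| <= eps by move=> /le_trans; apply.
  rewrite (psi_out (ltW eps0) eps1 out (sm _ p1b)) (psi_out (ltW eps0) eps1 out (sm _ p2b)).
  rewrite (psi_out1 (ltW eps0) eps1 out (sm _ p3b)) (psi_out1 (ltW eps0) eps1 out (sm _ p4b)) !addr0.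
  have small (f : nat -> R) m k : asum f -> Sum (fun k => `|f (m + k)%N|) <= kap -> `|f (m + k)%N| <= eps.
    move=> af hk; have := Sum_part k.+1 (asum_norm (asum_shift m af)) (fun j => normr_ge0 _).
    rewrite big_nat_recr //= => hk'; apply: le_trans _ (le_trans hk _); last by lra.
    by apply: le_trans _ hk'; rewrite lerDr; apply: sumr_ge0.
  have z0 (f : nat -> R) m : asum f -> Sum (fun k => `|f (m + k)%N|) <= kap ->
      psum 0 f al = \sum_(0 <= i < m) psi al (0 + f i).
    move=> af hk; rewrite /psum (Sum_shift m (@asum_psi0 _ f al af)).
    rewrite (@eq_Sum _ _ (fun=> 0)) ?Sum0 ?addr0 // => k.
    by rewrite add0r (psi_out (ltW eps0) eps1 out) // small.
  have z1 (f : nat -> R) m : asum f -> Sum (fun k => `|f (m + k)%N|) <= kap ->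
      psum 1 f al = \sum_(0 <= i < m) psi al (1 + f i).
    move=> af hk; rewrite /psum (Sum_shift m (@asum_psi1 _ f al af)).
    rewrite (@eq_Sum _ _ (fun=> 0)) ?Sum0 ?addr0 // => k.
    by rewrite (psi_out1 (ltW eps0) eps1 out) // small.
  by rewrite -(z0 _ _ al0 t1) -(z1 _ _ al1 t2) -(z0 _ _ ad0 t3) -(z1 _ _ ad1 t4); exact: hle.
have convF := conv_hinge_seq hip szeq sumeq hin.
have idc (I : Type) (f : I -> R) : conv ip f f by exact: conv_refl.
have conv1' : conv ip (sumf (fun _ : unit => 1 + p4) (sumf (fun _ : unit => 1 + p3) (fun k => 1 + l1 (q + k)%N)))
      (fun k => 1 + d1 (n + k)%N).
  have n1 : 1 != 0 :> R by rewrite oner_eq0.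
  apply: conv_trans (conv_trans (@conv_affine _ _ _ hip _ _ 1 1 _ _ n1 conv1) _);
    apply: conv_refl; last by move=> k; lra.
  by case=> [[]|[[]|k]] /=; lra.
have fin0 : conv ip (sumf (ofs tgt0) (fun k => l0 (p + k)%N)) d0.
  apply: conv_trans (conv_trans _ (conv_sum hip (idc _ _) conv0)) (conv_take ip d0 n).2.
  apply: conv_trans (conv_sum hip (conv_ofs_cat ip _ _).1 (idc _ _)) _.
  apply: conv_trans (conv_assoc ip _ _ _).1 _.
  apply: conv_trans (conv_sum hip (conv_ofs_cat ip _ _).1 (idc _ _)) _.
  apply: conv_trans (conv_assoc ip _ _ _).1 _.
  exact: (conv_sum hip (idc _ _) (conv_sum hip (@conv_ofs1 _ _ ip p2) (conv_sum hip (@conv_ofs1 _ _ ip p1) (idc _ _)))).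
have fin1 : conv ip (sumf (ofs tgt1) (fun k => 1 + l1 (q + k)%N)) (fun k => 1 + d1 k).
  apply: conv_trans (conv_trans _ (conv_sum hip (idc _ _) conv1')) (conv_take ip (one_ d1) n).2.
  apply: conv_trans (conv_sum hip (conv_ofs_cat ip _ _).1 (idc _ _)) _.
  apply: conv_trans (conv_assoc ip _ _ _).1 _.
  apply: conv_trans (conv_sum hip (conv_ofs_cat ip _ _).1 (idc _ _)) _.
  apply: conv_trans (conv_assoc ip _ _ _).1 _.
  exact: (conv_sum hip (idc _ _) (conv_sum hip (@conv_ofs1 _ _ ip (1 + p4)) (conv_sum hip (@conv_ofs1 _ _ ip (1 + p3)) (idc _ _)))).
apply: conv_trans (conv_sum hip (conv_take ip l0 p).1 (conv_take ip (one_ l1) q).1) _.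
apply: conv_trans; first exact: conv_interchange.
apply: conv_trans (conv_sum hip (conv_trans (conv_ofs_cat ip _ _).2 (conv_trans convF (conv_ofs_cat ip _ _).1)) (idc _ _)) _.
apply: conv_trans; first exact: conv_interchange.
exact: (conv_sum hip fin0 fin1).
Qed.

End SummableCase.

(** * One end of the spectrum *)

Section Enumerations.
Context {R : realType}.

Definition unbounded (P : set nat) := forall N, exists2 n, (N <= n)%N & P n.

Lemma inj_large (m : nat -> nat) : injective m ->
  forall N, exists K, forall k, (K <= k)%N -> (N <= m k)%N.
Proof.
move=> minj; elim=> [|N [K hK]]; first by exists 0%N.
have [[k0 e]|ne] := pselect (exists k0, m k0 = N).
  exists (maxn K k0.+1) => k; rewrite geq_max => /andP[/hK Nk kk].
  rewrite ltn_neqAle Nk andbT -e; apply/eqP => /minj kk0.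
  by rewrite kk0 ltnn in kk.
exists K => k /hK Nk; rewrite ltn_neqAle Nk andbT.
by apply/eqP => e; apply: ne; exists k.
Qed.

Lemma vanishing_inj (f : nat -> R) (m : nat -> nat) :
  vanishing f -> injective m -> vanishing (fun k => f (m k)).
Proof.
move=> vf minj eps e0; have [N hN] := vf eps e0.
by have [K hK] := inj_large minj N; exists K => k /hK /hN.
Qed.

Lemma sorted_enumeration (P : set nat) (f : nat -> R) :
  unbounded P -> (forall n, P n -> 0 < f n) -> vanishing f ->
  exists m : nat -> nat, [/\ injective m, forall n, P n <-> exists k, m k = n &
    forall i j, (i <= j)%N -> f (m j) <= f (m i)].
Proof.
move=> Pinf f0 vf.
have step (l : seq nat) : exists x, [/\ P x, x \notin l &
    forall y, P y -> y \notin l -> f y <= f x].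
  have [i0 hi0 Pi0] := Pinf (\sum_(x <- l) x).+1.
  have i0l : i0 \notin l.
    apply/negP => i0l; move: hi0; rewrite (big_rem i0) //= ltnNge leq_addr //.
  have [N hN] := vf (f i0 / 2) (divr_gt0 (f0 _ Pi0) (ltr0n _ 2)).
  pose ok n := `[< P n >] && (n \notin l).
  pose F n := - (if ok n.-1 then f n.-1 else 0).
  have iN : (i0 < N)%N.
    rewrite ltnNge; apply/negP => /hN; have := f0 _ Pi0; lra.
  have [n [_ hn]] := @range_min R F 0%N N (leq_ltn_trans (leq0n _) iN).
  have oki0 : ok i0 by rewrite /ok i0l andbT; apply/asboolP.
  have hi : f i0 <= - F n.
    by have := hn i0.+1; rewrite ltnS leq0n iN => /(_ isT); rewrite /F /= oki0; lra.
  move: hi hn; rewrite /F opprK; case: ifP => [/andP[/asboolP Pn nl] hi hn|_ hi _]; last first.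
    by have := f0 _ Pi0; lra.
  exists n.-1; split=> // y Py yl.
  have oky : ok y by rewrite /ok yl andbT; apply/asboolP.
  case: (leqP N y) => yN; first by have := hN y yN; have := f0 _ Pi0; lra.
  by have := hn y.+1; rewrite ltnS leq0n yN => /(_ isT) /=; rewrite oky; lra.
have [g hg] := choice step.
pose L := fix L k := if k is j.+1 then g (L j) :: L j else [::].
pose m k := g (L k).
have LE k x : x \in L k -> exists2 j, (j < k)%N & m j = x.
  elim: k => //= k IH; rewrite inE => /predU1P[->|/IH[j jk e]]; first by exists k.
  by exists j => //; exact: ltnW.
have mL j k : (j < k)%N -> m j \in L k.
  elim: k => //= k IH; rewrite ltnS leq_eqVlt inE => /predU1P[->|/IH ->]; first by rewrite eqxx.
  by rewrite orbT.
have mm j k : (j < k)%N -> m j != m k.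
  move=> /mL jk; apply/eqP => e; have [_ + _] := hg (L k).
  by rewrite -/(m k) -e jk.
have minj : injective m.
  by move=> j k e; case: (ltngtP j k) => // /mm; rewrite e eqxx.
exists m; split=> //.
- move=> n; split=> [Pn|[k <-]]; last by have [] := hg (L k).
  apply: contrapT => nk.
  have nL k : n \notin L k.
    by apply/negP => /LE[j _ e]; apply: nk; exists j.
  have big k : f n <= f (m k) by have [_ _] := hg (L k); apply.
  have := vanishing_inj vf minj (divr_gt0 (f0 _ Pn) (ltr0n _ 2)).
  by move=> [N /(_ N (leqnn N))]; have := big N; have := f0 _ Pn; lra.
- move=> i j; rewrite leq_eqVlt => /predU1P[->//|ij].
  have [Pj njl _] := hg (L j); have [_ _] := hg (L i); apply=> //.
  apply/negP => /LE[k ki e]; have := mm k j (ltn_trans ki ij).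
  by rewrite e eqxx.
Qed.

Lemma vanishing_harmonic : vanishing (fun n => n.+1%:R^-1 : R).
Proof.
move=> eps e0; exists (Num.bound eps^-1) => n hn.
rewrite invf_ple ?posrE //; apply: ltW; apply: lt_le_trans (archi_boundP _) _.
  by rewrite invr_ge0 ltW.
by rewrite ler_nat ltnW.
Qed.

Lemma enumeration (P : set nat) : unbounded P ->
  exists m : nat -> nat, injective m /\ forall n, P n <-> exists k, m k = n.
Proof.
move=> Pinf; have [|m [minj mP _]] := sorted_enumeration Pinf _ vanishing_harmonic.
  by move=> n _; rewrite invr_gt0.
by exists m.
Qed.

Lemma sparse (P : set nat) (f c : nat -> R) : unbounded P -> vanishing f ->
  (forall k, 0 < c k) ->
  exists q : nat -> nat, injective q /\ forall k, P (q k) /\ f (q k) <= c k.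
Proof.
move=> Pinf vf c0.
have step (kx : nat * nat) : exists y, [/\ (kx.2 < y)%N, P y & f y <= c kx.1].
  have [N hN] := vf _ (c0 kx.1).
  have [y] := Pinf (maxn kx.2.+1 N); rewrite geq_max => /andP[h1 h2] Py.
  by exists y; split=> //; exact: hN.
have [g hg] := choice step.
pose q := fix q k := g (k, if k is j.+1 then q j else 0%N).
have qS k : (q k < q k.+1)%N by have [] := hg (k.+1, q k).
have qlt j k : (j < k)%N -> (q j < q k)%N.
  elim: k => // k IH; rewrite ltnS leq_eqVlt => /predU1P[->//|/IH h].
  exact: ltn_trans (qS k).
exists q; split=> [j k e|k].
  by case: (ltngtP j k) => // /qlt; rewrite e ltnn.
by case: k => [|k]; [have [] := hg (0%N, 0%N)|have [] := hg (k.+1, q k)].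
Qed.

End Enumerations.

Section PosNeg.
Context {R : realType}.
Implicit Types (al x : R) (a f : nat -> R).

Definition pos x : R := Num.max x 0.
Definition neg x : R := Num.max (- x) 0.
(** For [al] in [0,1] this is the tent min((1 - al) x, al (1 - x)) on [0,1], and 0 elsewhere: what a
    term [x] contributes to [majf] at levels inside (0,1). *)
Definition phi al x : R := Num.max (- psi al x) 0.

Lemma pos_ge0 x : 0 <= pos x. Proof. by rewrite le_max lexx orbT. Qed.
Lemma neg_ge0 x : 0 <= neg x. Proof. by rewrite le_max lexx orbT. Qed.
Lemma phi_ge0 al x : 0 <= phi al x. Proof. by rewrite le_max lexx orbT. Qed.

Lemma posBneg x : pos x - neg x = x.
Proof. rewrite /pos /neg; case: (lerP x 0) => h; case: (lerP (- x) 0) => h'; lra. Qed.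

Lemma psi0E x : psi 0 x = neg x.
Proof. by rewrite psi_le0 // sub0r. Qed.

Lemma psi_neg_le al x : al <= 0 -> 0 <= psi al x <= neg x.
Proof.
move=> a0; rewrite psi_le0 // /neg; apply/andP.
by case: (lerP (al - x) 0) => h1; case: (lerP (- x) 0) => h2; split; lra.
Qed.

Lemma psi_neg_mono al be x : al <= be -> be <= 0 -> psi al x <= psi be x.
Proof.
move=> ab b0; rewrite !psi_le0 //; last by lra.
by case: (lerP (al - x) 0) => h1; case: (lerP (be - x) 0) => h2; lra.
Qed.

Lemma psi_neg0 al x : al <= 0 -> al <= x -> psi al x = 0.
Proof. by move=> a0 ax; rewrite psi_le0 // max_r // subr_le0. Qed.

Lemma psi_neg_lt al x : al <= 0 -> x <= al -> psi al x = al - x.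
Proof. by move=> a0 ax; rewrite psi_le0 // max_l // subr_ge0. Qed.

Lemma phi_le_pos al x : 0 <= al <= 1 -> phi al x <= pos x.
Proof.
move=> /[dup] /andP[a0 a1] a01; rewrite /phi psi_mid // /pos.
have [x0|x0] := leP x 0.
  have p1 : 0 <= al * - x by rewrite mulr_ge0 // oppr_ge0.
  have p2 : 0 <= (1 - al) * - x by rewrite mulr_ge0 ?subr_ge0 // oppr_ge0.
  case: (lerP (- ((1 - al) * x)) (- (al * (1 - x)))) => h3; rewrite ge_max; apply/andP; split; lra.
have p1 : 0 <= al * x by rewrite mulr_ge0 // ltW.
have p2 : 0 <= (1 - al) * x by rewrite mulr_ge0 ?subr_ge0 // ltW.
case: (lerP (- ((1 - al) * x)) (- (al * (1 - x)))) => h3; rewrite ge_max; apply/andP; split; lra.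
Qed.

Lemma phi_le_al al x : 0 <= al <= 1 -> phi al x <= al.
Proof.
move=> /[dup] /andP[a0 a1] a01; rewrite /phi psi_mid //.
have [x0|x0] := leP x 0.
  have p2 : 0 <= (1 - al) * - x by rewrite mulr_ge0 ?subr_ge0 // oppr_ge0.
  case: (lerP (- ((1 - al) * x)) (- (al * (1 - x)))) => h3; rewrite ge_max; apply/andP; split; lra.
have p1 : 0 <= al * x by rewrite mulr_ge0 // ltW.
case: (lerP (- ((1 - al) * x)) (- (al * (1 - x)))) => h3; rewrite ge_max; apply/andP; split; lra.
Qed.

Lemma phi_sym al x : phi (1 - al) (1 - x) = phi al x.
Proof. by rewrite /phi psi_sym. Qed.

Lemma phi_le1 al x : 0 <= al <= 1 -> phi al (1 - x) <= al * pos x.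
Proof.
move=> /[dup] /andP[a0 a1] a01; rewrite /phi psi_mid // /pos.
have p : 0 <= al * Num.max x 0 by rewrite mulr_ge0 // le_max lexx orbT.
have p' : al * x <= al * Num.max x 0 by rewrite ler_wpM2l // le_max lexx.
rewrite ge_max p andbT; apply: le_trans p'; rewrite lerNl le_max; apply/orP; right.
by rewrite opprB addrC subrK.
Qed.

Lemma phi_nonpos al x : 0 <= al <= 1 -> x <= 0 -> phi al x = 0.
Proof.
move=> a01 x0; apply/eqP; rewrite eq_le phi_ge0 andbT.
by apply: le_trans (phi_le_pos x a01) _; rewrite /pos ge_max x0 lexx.
Qed.

Lemma psi_phi al x : 0 <= al <= 1 -> x <= 1 -> psi al x = - phi al x + (1 - al) * neg x.
Proof.
move=> /[dup] /andP[a0 a1] a01 x1; rewrite /phi psi_mid // /neg.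
have [x0|x0] := leP (- x) 0.
  rewrite mulr0 addr0.
  have p2 : 0 <= (1 - al) * x by rewrite mulr_ge0 ?subr_ge0 // -oppr_le0.
  have p1 : 0 <= al * (1 - x) by rewrite mulr_ge0 ?subr_ge0.
  set M := Num.max _ _; have M0 : M <= 0 by rewrite /M ge_max; apply/andP; split; lra.
  by rewrite max_l ?opprK // oppr_ge0.
have p2 : 0 <= (1 - al) * - x by rewrite mulr_ge0 ?subr_ge0 // ltW.
have p1 : 0 <= al * (1 - x) by rewrite mulr_ge0 // subr_ge0.
have p3 : 0 <= al * - x by rewrite mulr_ge0 // ltW.
set M := Num.max _ _; have ME : M = - ((1 - al) * x) by rewrite /M max_l; lra.
by rewrite max_r ME; lra.
Qed.

Lemma psi_small al x : 0 <= al <= 1 -> 0 <= x <= 1 -> psi al x <= 0.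
Proof.
move=> /andP[a0 a1] /andP[x0 x1]; rewrite psi_mid ?a0 // ge_max !oppr_le0.
by rewrite !mulr_ge0 // subr_ge0.
Qed.

Lemma psi_small_eq al x : 0 <= x -> x <= al -> al <= 1 -> psi al x = - ((1 - al) * x).
Proof.
move=> x0 xa a1; rewrite psi_mid ?(le_trans x0 xa) // max_l //; lra.
Qed.

Lemma asum_unshift f m : asum (fun k => f (m + k)%N) -> asum f.
Proof.
move=> af; apply: (@eq_asum _ (fun n => (if (n < m)%N then f n else 0)
   + (if (n < m)%N then 0 else f n))).
  by move=> n; case: ifP; rewrite ?addr0 ?add0r.
apply: asumD; first by apply: (@asum_fin _ _ m) => n mn; rewrite ltnNge mn.
apply: (@asum_reindex_inv _ (addn m)); first exact: addnI.
  move=> i h; case: ltnP => // mi; case: (h (i - m)%N); exact: subnKC.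
by apply: eq_asum af => k; rewrite ltnNge leq_addr.
Qed.

End PosNeg.

(** * Sparse reserves and repeated absorption *)

Section Peeling.
Context {R : realType} {H : lmodType R[i]}.
Variable (ip : H -> H -> R[i]).
Hypothesis hip : hform ip.
Hypothesis ip_ge0 : forall z, 0 <= ip z z.

Lemma conv_bij (I J : Type) (g : J -> I) (l : I -> R) (d : J -> R) :
  injective g -> (forall i, exists j, g j = i) -> (forall j, d j = l (g j)) ->
  conv ip l d /\ conv ip d l.
Proof.
move=> ginj gsurj dl; split; first exact: (conv_reindex ginj gsurj).
have [h hg] := choice gsurj.
apply: (@conv_reindex _ _ _ _ _ h).
- by move=> x y /(congr1 g); rewrite !hg.
- by move=> j; exists (g j); apply: ginj; rewrite hg.
- by move=> i; rewrite dl hg.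
Qed.

Definition complementary (m e : nat -> nat) :=
  [/\ injective m, injective e, forall i j, m i <> e j &
      forall n, (exists i, m i = n) \/ (exists j, e j = n)].

Lemma conv_complementary (m e : nat -> nat) (a : nat -> R) : complementary m e ->
  conv ip a (sumf (fun k => a (m k)) (fun k => a (e k))) /\
  conv ip (sumf (fun k => a (m k)) (fun k => a (e k))) a.
Proof.
move=> [minj einj disj cov].
apply: (@conv_bij _ _ (fun z : nat + nat => match z with inl k => m k | inr k => e k end)).
- move=> [i|i] [j|j] // => [/minj ->//|/disj//|/esym/disj//|/einj ->//].
- by move=> n; case: (cov n) => -[k <-]; [exists (inl k)|exists (inr k)].
- by case.
Qed.

Lemma not_asum_unbounded (f : nat -> R) : ~ asum f -> unbounded (fun n => f n != 0).
Proof.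
move=> nf N; apply: contrapT => nex; apply: nf; apply: (@asum_fin _ _ N) => n Nn.
by apply/eqP/negPn/negP => fn; apply: nex; exists n.
Qed.

Lemma neg_neq0 (x : R) : (neg x != 0) = (x < 0).
Proof.
rewrite /neg; case: (leP (- x) 0) => h.
  by rewrite eqxx; apply/esym/negbTE; rewrite -leNgt -oppr_le0.
by rewrite lt0r_neq0 // -oppr_gt0 h.
Qed.

Lemma neg_lt0 (x : R) : x < 0 -> neg x = - x.
Proof. by move=> x0; rewrite /neg max_l // oppr_ge0 ltW. Qed.

(* [s] enumerates the negative terms of [a] that were left out of [m]. *)
Lemma peel (a c : nat -> R) : vanishing (fun n => `|a n|) ->
  asum (fun n => pos (a n)) -> ~ asum (fun n => neg (a n)) ->
  (forall k, 0 < c k) -> asum c ->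
  exists (m e : nat -> nat) (s : nat -> R), complementary m e /\
  [/\ [/\ forall k, a (m k) < 0, vanishing (fun k => - a (m k)), divergent (fun k => - a (m k)) &
     forall i j, (i <= j)%N -> - a (m j) <= - a (m i)],
     forall k, s k < 0 /\ - s k <= c k, asum (fun k => a (e k)) &
     forall h : R -> R, (forall x : R, 0 <= x -> h x = 0) -> asum (fun k => h (s k)) ->
       asum (fun k => h (a (e k))) /\ Sum (fun k => h (a (e k))) = Sum (fun k => h (s k))].
Proof.
move=> va apos nneg c0 ac.
have vneg : vanishing (fun n => neg (a n)).
  move=> eps eps0; have [N hN] := va eps eps0; exists N => n /hN; apply: le_trans.
  by rewrite /neg ge_max normr_ge0 andbT -normrN ler_norm.
have negu : unbounded (fun n => a n < 0).
  by move=> N; have [n Nn] := not_asum_unbounded nneg N; rewrite neg_neq0 => an; exists n.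
have [q [qinj hq]] := sparse negu vneg c0.
pose s k := a (q k).
have sc k : s k < 0 /\ - s k <= c k.
  by have [p1 p2] := hq k; rewrite /s; split=> //; rewrite -neg_lt0.
pose P n := a n < 0 /\ forall k, q k <> n.
have asq : asum (fun k => neg (s k)).
  apply: asum_le ac => k; have [s0 sk] := sc k.
  by rewrite ger0_norm ?neg_ge0 // neg_lt0.
pose nq n := if `[< exists k, q k = n >] then neg (a n) else 0.
have nqS i : (forall k, q k <> i) -> nq i = 0.
  by move=> h; rewrite /nq ifF //; apply/asboolP => -[k /h].
have nqE k : nq (q k) = neg (s k) by rewrite /nq ifT //; apply/asboolP; exists k.
have anq : asum nq.
  by apply: (asum_reindex_inv qinj nqS); apply: eq_asum asq => k; rewrite nqE.
(* Otherwise the summable reserve and finitely many further terms would make up the whole negative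
   part. *)
have Pu : unbounded P.
  move=> N; apply: contrapT => nex; apply: nneg.
  apply: (@eq_asum _ (fun n => nq n + (neg (a n) - nq n))).
    by move=> n; rewrite addrC subrK.
  apply: asumD => //; apply: (@asum_fin _ _ N) => n Nn.
  rewrite /nq; case: asboolP => [_|nk]; first by rewrite subrr.
  rewrite subr0; apply/eqP/negPn/negP; rewrite neg_neq0 => an; apply: nex.
  by exists n => //; split=> // k e; apply: nk; exists k.
have Cu : unbounded (fun n => ~ P n).
  move=> N; have [K hK] := inj_large qinj N; exists (q K); first exact: hK.
  by move=> [_ /(_ K)].
have [|m [minj mP msort]] := sorted_enumeration Pu _ vneg.
  by move=> n [an _]; rewrite neg_lt0 // oppr_gt0.
have [e [einj eP]] := @enumeration R _ Cu.
have am k : a (m k) < 0 by have [] : P (m k) by apply/mP; exists k.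
have negm k : neg (a (m k)) = - a (m k) by rewrite neg_lt0.
have me : complementary m e.
  split=> // [i j eij|n].
    have h1 : P (m i) by apply/mP; exists i.
    have h2 : ~ P (e j) by apply/eP; exists j.
    by apply: h2; rewrite -eij.
  by have [Pn|Pn] := pselect (P n); [left; apply/mP|right; apply/eP].
(* Since [h] ignores nonnegative terms, the sums along [e] and along [q] rearrange one sequence [g]
   supported on the reserve. *)
have key (h : R -> R) : (forall x : R, 0 <= x -> h x = 0) -> asum (fun k => h (s k)) ->
    asum (fun k => h (a (e k))) /\ Sum (fun k => h (a (e k))) = Sum (fun k => h (s k)).
  move=> h0 ah; pose g n := if `[< P n >] then 0 else h (a n).
  have gq i : (forall k, q k <> i) -> g i = 0.
    move=> hi; rewrite /g; case: asboolP => // nP; apply: h0.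
    by rewrite leNgt; apply/negP => ai; apply: nP.
  have ge_ i : (forall k, e k <> i) -> g i = 0.
    move=> hi; rewrite /g; case: asboolP => // /eP[k ek].
    by case: (hi k).
  have gqE k : g (q k) = h (s k).
    by rewrite /g; case: asboolP => // -[_ /(_ k)].
  have geE k : g (e k) = h (a (e k)).
    rewrite /g; case: asboolP => // hP.
    by have : ~ P (e k) by apply/eP; exists k.
  have ag : asum g.
    by apply: (asum_reindex_inv qinj gq); apply: eq_asum ah => k; rewrite gqE.
  split; first by apply: eq_asum (asum_reindex einj ge_ ag).
  rewrite -(eq_Sum geE) (Sum_reindex einj ge_ ag) -(Sum_reindex qinj gq ag).
  exact: eq_Sum.
have [minj' einj' disj cov] := me.
have ane : asum (fun k => neg (a (e k))).
  by apply: (key neg _ asq).1 => x x0; rewrite /neg max_r // oppr_le0.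
exists m, e, s; split=> //; split=> //.
- split=> //.
  + by move=> eps /(vanishing_inj vneg minj)[N hN]; exists N => k /hN; rewrite negm.
  + move=> B; apply: contrapT => nex; apply: nneg.
    apply: (asum_unsplit minj einj disj cov) => //.
    apply: (@asum_bound _ _ B) => n.
    rewrite leNgt; apply/negP => lt; apply: nex; exists n; apply: ltW.
    apply: (lt_le_trans lt); apply: ler_sum => i _.
    by rewrite ger0_norm ?neg_ge0 // negm.
  + by move=> i j /msort; rewrite !negm.
- apply: (@eq_asum _ (fun k => pos (a (e k)) - neg (a (e k)))).
    by move=> k; rewrite posBneg.
  apply: asumB => //; exact: (asum_split minj einj disj cov apos).2.
Qed.

(** Each absorption lowers the limit inferior of the gaps by at most [sigma], so there is room for
    [m] of them before [conv_nonsummable] finishes. *)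
Lemma conv_absorb_iter (m : nat) (sigma : R) (mu nu : nat -> R) : 0 < sigma ->
  (forall n, 0 < mu n) -> vanishing mu -> divergent mu ->
  (forall i j, (i <= j)%N -> nu j <= nu i) ->
  (forall n, 0 <= gap mu nu n) -> eventually_ge (m%:R * sigma) (gap mu nu) ->
  (exists B : R, forall N, exists2 n, (N <= n)%N & gap mu nu n <= B) ->
  conv ip (sumf (ofs (nseq m sigma)) (fun n => - mu n)) (fun n => - nu n).
Proof.
move=> sigma0; elim: m mu => [|m IH] mu mu0 vmu dmu nuS g0 gev gb.
  have h := conv_nonsummable hip mu0 vmu dmu nuS g0 gb.
  have m1 : -1 != 0 :> R by rewrite oppr_eq0 oner_eq0.
  apply: conv_trans; last apply: conv_trans (@conv_affine _ _ _ hip _ _ (-1) 0 _ _ m1 h) _.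
    apply: (@conv_reindex _ _ _ _ _ inr); first by move=> i j [].
      by move=> [[]//|k]; exists k.
    by move=> k /=; lra.
  by apply: conv_refl => k; lra.
have gev' : eventually_ge (sigma + m%:R * sigma) (gap mu nu).
  by move: gev; rewrite -natr1 mulrDl mul1r addrC.
have x0 : 0 <= m%:R * sigma by rewrite mulr_ge0 // ltW.
have [mu' [hmu' g0' gev'' cv]] := conv_absorb hip ip_ge0 mu0 vmu dmu g0 sigma0 x0 gev'.
have mu'0 n : 0 < mu' n by have /andP[h _] := hmu' n; have := mu0 n; lra.
have cv' : conv ip (sumf (ofs (nseq m sigma)) (fun n => - mu' n)) (fun n => - nu n).
  apply: IH => //.
  - move=> eps eps0; have [N hN] := vmu eps eps0; exists N => n /hN.
    by apply: le_trans; case/andP: (hmu' n).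
  - move=> B; have [n hn] := dmu (2 * B); exists n.
    have : \sum_(0 <= i < n) mu i / 2 <= \sum_(0 <= i < n) mu' i.
      by apply: ler_sum => i _; case/andP: (hmu' i).
    by rewrite -mulr_suml; lra.
  - have [B hB] := gb; exists B => N; have [n Nn hn] := hB N; exists n => //.
    apply: le_trans hn; apply: ler_sum => i _; rewrite lerD2r.
    by case/andP: (hmu' i).
apply: conv_trans cv'.
have nsE : nseq m.+1 sigma = nseq m sigma ++ [:: sigma].
  by rewrite -(addn1 m) nseqD.
rewrite nsE.
have idc (I : Type) (f : I -> R) : conv ip f f by exact: conv_refl.
apply: conv_trans (conv_sum hip (conv_ofs_cat ip _ _).1 (idc _ _)) _.
apply: conv_trans (conv_assoc ip _ _ _).1 _.
apply: conv_trans (conv_sum hip (idc _ _) (conv_sum hip (@conv_ofs1 _ _ ip sigma) (idc _ _))) _.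
exact: (conv_sum hip (idc _ _) cv).
Qed.

End Peeling.

(** * Comparing the negative parts of two sequences *)

Section Low.
Context {R : realType}.
Implicit Types (a f : nat -> R) (al be x y : R).

(** For [be < 0] and [a] tending to 0 this is a finite sum, the value of [majf] at [be]; at [be = 0]
    it is the total of the negative parts. *)
Definition low a be := Sum (fun n => psi be (a n)).

Lemma psum0E f al : psum 0 f al = low f al.
Proof. by apply: eq_Sum => n; rewrite add0r. Qed.

Lemma low0 f : low f 0 = Sum (fun n => neg (f n)).
Proof. by apply: eq_Sum => n; rewrite psi0E. Qed.

Lemma asum_posneg f : asum (fun n => pos (f n)) -> asum (fun n => neg (f n)) -> asum f.
Proof. by move=> fp fn; apply: eq_asum (asumB fp fn) => n; rewrite posBneg. Qed.

Lemma Sum_posneg f : asum (fun n => pos (f n)) -> asum (fun n => neg (f n)) ->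
  Sum f = Sum (fun n => pos (f n)) - Sum (fun n => neg (f n)).
Proof. by move=> fp fn; rewrite -SumB //; apply: eq_Sum => n; rewrite posBneg. Qed.

Lemma asum_phi f al : 0 <= al <= 1 -> asum (fun n => pos (f n)) ->
  asum (fun n => phi al (f n)).
Proof.
by move=> al01; apply: asum_le => n; rewrite ger0_norm ?phi_ge0 // phi_le_pos.
Qed.

Lemma low_phi f al : 0 <= al <= 1 -> asum (fun n => pos (f n)) ->
  asum (fun n => neg (f n)) -> (forall n, f n <= 1) ->
  low f al = - Sum (fun n => phi al (f n)) + (1 - al) * Sum (fun n => neg (f n)).
Proof.
move=> al01 fp fn f1; rewrite -SumZ // -SumN; last exact: asum_phi.
rewrite -SumD; [|by apply: asumN; exact: asum_phi|exact: asumZ].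
by apply: eq_Sum => n; rewrite psi_phi.
Qed.

Lemma neg_eq0 x : 0 <= x -> neg x = 0.
Proof. by move=> x0; rewrite /neg max_r // oppr_le0. Qed.

Lemma psi_neg_eq0 be x : be <= 0 -> 0 <= x -> psi be x = 0.
Proof. by move=> b0 x0; rewrite psi_neg0 // (le_trans b0). Qed.

Lemma psi_neg_anti be x y : be <= 0 -> x <= y -> psi be y <= psi be x.
Proof.
move=> b0 xy; rewrite !psi_le0 // ge_max !le_max lexx orbT andbT.
by rewrite lerD2l lerN2 xy.
Qed.

Lemma asum_neg a : asum a -> asum (fun n => neg (a n)).
Proof.
move=> /asum_norm; apply: asum_le => n; rewrite ger0_norm ?neg_ge0 //.
by rewrite /neg ge_max normr_ge0 andbT -normrN ler_norm.
Qed.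

Lemma asum_psi_le0 a be : be <= 0 -> asum (fun n => neg (a n)) -> asum (fun n => psi be (a n)).
Proof.
by move=> b0; apply: asum_le => n; have /andP[h1 h2] := psi_neg_le (a n) b0; rewrite ger0_norm.
Qed.

Lemma low_le_neg a be : be <= 0 -> asum (fun n => neg (a n)) ->
  0 <= low a be <= Sum (fun n => neg (a n)).
Proof.
move=> b0 an; have ap := asum_psi_le0 b0 an; apply/andP; split.
  by apply: Sum_ge0 => // n; case/andP: (psi_neg_le (a n) b0).
by apply: Sum_le => // n; case/andP: (psi_neg_le (a n) b0).
Qed.

Lemma asum_psi_neg a be : vanishing (fun n => `|a n|) -> be < 0 ->
  asum (fun n => psi be (a n)).
Proof.
move=> va be0; have nbe : 0 < - be by rewrite oppr_gt0.
have [N hN] := va _ nbe.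
apply: (@asum_fin _ _ N) => n /hN; rewrite ler_norml opprK => /andP[h _].
by rewrite psi_neg0 // ltW.
Qed.

Lemma low_mono a (be be' : R) : vanishing (fun n => `|a n|) ->
  be <= be' -> be' < 0 -> low a be <= low a be'.
Proof.
move=> va bb b0; apply: Sum_le; [exact: asum_psi_neg (le_lt_trans bb b0)|exact: asum_psi_neg|].
by move=> n; apply: psi_neg_mono => //; exact: ltW.
Qed.

Lemma low_bounded_asum a (B : R) : vanishing (fun n => `|a n|) ->
  (forall be, be < 0 -> low a be <= B) -> asum (fun n => neg (a n)).
Proof.
move=> va hB; apply: (@asum_bound _ _ B) => n.
under eq_bigr do rewrite ger0_norm ?neg_ge0 //.
apply/ler_addgt0Pr => eps eps0.
(* A negative part exceeds [psi be] by at most [- be], so this level loses at most [eps] over [n]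
   terms. *)
pose be := - (eps / n.+1%:R).
have be0 : be < 0 by rewrite oppr_lt0 divr_gt0.
have h1 : \sum_(0 <= i < n) psi be (a i) <= low a be.
  apply: (Sum_part n (asum_psi_neg va be0)) => i.
  by case/andP: (psi_neg_le (a i) (ltW be0)).
have h2 : \sum_(0 <= i < n) neg (a i) <= \sum_(0 <= i < n) (psi be (a i) - be).
  apply: ler_sum => i _; rewrite psi_le0 ?(ltW be0) // /neg.
  by case: (lerP (- a i) 0) => u1; case: (lerP (be - a i) 0) => u2; lra.
have h3 : n%:R * - be <= eps.
  rewrite /be opprK mulrA ler_pdivrMr // mulrC ler_pM2l // ler_nat //.
move: h2; rewrite sumrB sumr_const_nat subn0 -[be *+ n]mulr_natl.
have := hB be be0; lra.
Qed.

Lemma low_top a be n : vanishing (fun n => `|a n|) -> be < 0 ->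
  \sum_(0 <= i < n) (be - a i) <= low a be.
Proof.
move=> va be0; apply: (@le_trans _ _ (\sum_(0 <= i < n) psi be (a i))).
  by apply: ler_sum => i _; rewrite psi_le0 ?(ltW be0) // le_max lexx.
apply: (Sum_part n (asum_psi_neg va be0)) => i.
by case/andP: (psi_neg_le (a i) (ltW be0)).
Qed.

Lemma low_top_eq a be n : be < 0 ->
  (forall i, (i < n)%N -> a i <= be) -> (forall i, (n <= i)%N -> be <= a i) ->
  low a be = \sum_(0 <= i < n) (be - a i).
Proof.
move=> be0 h1 h2; rewrite /low (@Sum_fin _ _ n).
  by apply: eq_big_nat => i /andP[_ /h1 h]; rewrite psi_neg_lt ?(ltW be0).
by move=> i /h2 h; rewrite psi_neg0 ?(ltW be0).
Qed.

Lemma low_split a (m e : nat -> nat) be : complementary m e -> vanishing (fun n => `|a n|) ->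
  be < 0 -> low a be = low (fun k => a (m k)) be + low (fun k => a (e k)) be.
Proof. by move=> [mi ei dj cv] va b0; exact: (Sum_split mi ei dj cv (asum_psi_neg va b0)). Qed.

Lemma geometric_weights (kap : R) : 0 < kap -> exists c : nat -> R,
  [/\ forall k, 0 < c k, forall k, c k <= kap, asum c & Sum c <= kap].
Proof.
move=> kap0; pose c k := kap * 2^-1 ^+ k.+1.
have half0 k : 0 < 2^-1 ^+ k :> R by rewrite exprn_gt0 // invr_gt0.
have c0 k : 0 < c k by rewrite mulr_gt0.
have cpart n : \sum_(0 <= i < n) `|c i| <= kap.
  under eq_bigr do rewrite gtr0_norm //.
  rewrite -mulr_sumr -[X in _ <= X]mulr1 ler_pM2l //.
  have -> : \sum_(0 <= i < n) 2^-1 ^+ i.+1 = 1 - 2^-1 ^+ n :> R.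
    elim: n => [|n IH]; first by rewrite big_geq // expr0 subrr.
    by rewrite big_nat_recr //= IH exprSr; lra.
  by rewrite gerBl ltW.
have ac : asum c := asum_bound cpart.
exists c; split=> // [k|].
  have := cpart k.+1; rewrite big_nat_recr //= (gtr0_norm (c0 k)).
  have : 0 <= \sum_(0 <= i < k) `|c i| by apply: sumr_ge0.
  lra.
apply: limr_le; first exact: asum_cvg.
apply: nearW => n; apply: le_trans (cpart n).
by rewrite seriesE; apply: ler_sum => i _; exact: ler_norm.
Qed.

(** The hypotheses at one end, with [del] already shifted. [dom_excess] and [dom_frequent] say that
    the limit inferior of the excess is at least [del] and finite; [dom_summable] records that a
    summable end loses exactly [del]. *)
Record dominates (a b : nat -> R) (del : R) : Prop := Dominates {
  dom_le1 : forall n, a n <= 1;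
  dom_le1' : forall n, b n <= 1;
  dom_vanishing : vanishing (fun n => `|a n|);
  dom_vanishing' : vanishing (fun n => `|b n|);
  dom_pos : asum (fun n => pos (a n));
  dom_pos' : asum (fun n => pos (b n));
  dom_low : forall be, be < 0 -> low b be <= low a be;
  dom_gt0 : 0 < del;
  dom_excess : forall eta : R, 0 < eta -> exists2 be0, be0 < 0 &
     forall be, be0 < be < 0 -> del - eta <= low a be - low b be;
  dom_frequent : exists B : R, forall be0, be0 < 0 ->
     exists2 be, be0 < be < 0 & low a be - low b be <= B;
  dom_summable : asum (fun n => neg (a n)) -> asum (fun n => neg (b n)) /\
     Sum (fun n => neg (a n)) - Sum (fun n => neg (b n)) = del
}.

(** Otherwise [low a] would be bounded at levels arbitrarily close to 0, hence at all negative
    levels by monotonicity. *)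
Lemma dominates_nonsummable a (b : nat -> R) (del : R) : dominates a b del ->
  ~ asum (fun n => neg (a n)) -> ~ asum (fun n => neg (b n)).
Proof.
move=> dom na nb; apply: na; have [B hB] := dom_frequent dom.
apply: (@low_bounded_asum _ (B + Sum (fun n => neg (b n)))); first exact: dom_vanishing dom.
move=> be be0; have [be' /andP[h1 h2] h3] := hB be be0.
have /andP[_ h4] := low_le_neg (ltW h2) nb.
by have := low_mono (dom_vanishing dom) (ltW h1) h2; lra.
Qed.

(* [m] and [m'] list the main parts of the negative terms in decreasing absolute value; [e] and
   [e'] list everything else, whose negative parts are sparse enough to be summable, those of
   [a] being the larger. *)
Record trimmed (a b : nat -> R) (del : R) (m e m' e' : nat -> nat) : Prop := Trimmed {
  trim_compl : complementary m e;
  trim_compl' : complementary m' e';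
  trim_neg : forall k, a (m k) < 0;
  trim_neg' : forall k, b (m' k) < 0;
  trim_vanishing : vanishing (fun k => - a (m k));
  trim_vanishing' : vanishing (fun k => - b (m' k));
  trim_divergent : divergent (fun k => - a (m k));
  trim_sorted : forall i j, (i <= j)%N -> - a (m j) <= - a (m i);
  trim_sorted' : forall i j, (i <= j)%N -> - b (m' j) <= - b (m' i);
  trim_asum : asum (fun k => a (e k));
  trim_asum' : asum (fun k => b (e' k));
  trim_rest : forall be, be <= 0 -> low (fun k => b (e' k)) be <= low (fun k => a (e k)) be;
  trim_rest0 : low (fun k => b (e' k)) 0 < low (fun k => a (e k)) 0 < del;
  trim_low : forall be, be < 0 -> low (fun k => b (m' k)) be <= low (fun k => a (m k)) be
}.

Lemma exists_trimmed (a b : nat -> R) (del : R) : dominates a b del ->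
  ~ asum (fun n => neg (a n)) -> exists m e m' e', trimmed a b del m e m' e'.
Proof.
move=> dom nna; have nnb := dominates_nonsummable dom nna.
have del0 := dom_gt0 dom; have va := dom_vanishing dom; have vb := dom_vanishing' dom.
have [be0 be00 hbe0] := dom_excess dom (divr_gt0 del0 (ltr0n _ 2)).
(* Reserve terms of size at most [- be0] are invisible at levels up to [be0]. Between [be0] and 0
   the excess is at least [del / 2], of which the reserve takes at most [del / 4]. *)
pose kap := Num.min (- be0) (del / 4).
have kap0 : 0 < kap by rewrite lt_min oppr_gt0 be00 divr_gt0.
have kap_be : kap <= - be0 by rewrite ge_min lexx.
have kap_del : kap <= del / 4 by rewrite ge_min lexx orbT.
have [c [c0 ck ac Sc]] := geometric_weights kap0.
have [m [e [s [me [[am vm dm sm] hs aa0 hS]]]]] := peel va (dom_pos dom) nna c0 ac.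
(* The reserve of [b] is termwise at most half that of [a], which makes the inequality at level 0
   strict. *)
pose c' k := - s k / 2.
have c'0 k : 0 < c' k by rewrite divr_gt0 // oppr_gt0; case: (hs k).
have negs k : neg (s k) = - s k by apply: neg_lt0; case: (hs k).
have ans : asum (fun k => neg (s k)).
  by apply: asum_le ac => k; rewrite negs ger0_norm; case: (hs k) => // /ltW; rewrite oppr_ge0.
have ac' : asum c'.
  by apply: eq_asum (@asumZ _ 2^-1 _ ans) => k; rewrite negs /c' mulrC.
have [m' [e' [s' [me' [[am' vm' dm' sm'] hs' ab0 hS']]]]] := peel vb (dom_pos' dom) nnb c'0 ac'.
have negs' k : neg (s' k) = - s' k by apply: neg_lt0; case: (hs' k).
have ans' : asum (fun k => neg (s' k)).
  by apply: asum_le ac' => k; rewrite negs' ger0_norm; case: (hs' k) => // /ltW; rewrite oppr_ge0.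
have s's k : s k <= s' k.
  by have [h1 h2] := hs k; have [h3 h4] := hs' k; rewrite /c' in h4; lra.
have laE be : be <= 0 -> low (fun k => a (e k)) be = low s be.
  by move=> b0; apply: (hS _ _ (asum_psi_le0 b0 ans)).2 => x; exact: psi_neg_eq0.
have lbE be : be <= 0 -> low (fun k => b (e' k)) be = low s' be.
  by move=> b0; apply: (hS' _ _ (asum_psi_le0 b0 ans')).2 => x; exact: psi_neg_eq0.
have lba be : be <= 0 -> low s' be <= low s be.
  move=> b0; apply: Sum_le; [exact: asum_psi_le0|exact: asum_psi_le0|].
  by move=> k; apply: psi_neg_anti.
have s_gt0 : 0 < low s 0.
  rewrite low0 (Sum_shift 1 ans) big_nat1 ltr_pwDl //.
    by rewrite negs oppr_gt0; case: (hs 0%N).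
  by apply: Sum_ge0 => [|n]; [exact: (asum_shift 1 ans)|exact: neg_ge0].
have s_kap : low s 0 <= kap.
  by apply: le_trans Sc; rewrite low0; apply: Sum_le => // k; rewrite negs; case: (hs k).
have s'_half : low s' 0 <= 2^-1 * low s 0.
  rewrite !low0 -SumZ //; apply: Sum_le => //; first exact: asumZ.
  by move=> k; rewrite negs negs'; case: (hs' k) => _; rewrite /c' mulrC.
have s_out be : be <= be0 -> low s be = 0.
  move=> b0; rewrite /low (@eq_Sum _ _ (fun=> 0)) ?Sum0 // => k.
  by rewrite psi_neg0 ?(le_trans b0 (ltW be00)) //; have [_] := hs k; have := ck k; lra.
have dom_m be : be < 0 -> low (fun k => b (m' k)) be <= low (fun k => a (m k)) be.
  move=> b0; have lb := low_le_neg (ltW b0) ans'; have la := low_le_neg (ltW b0) ans.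
  have := low_split me va b0; have := low_split me' vb b0; rewrite laE ?lbE ?(ltW b0) //.
  have [bb|bb] := leP be be0.
    by rewrite (s_out be bb); have := dom_low dom b0; move: lb => /andP[]; lra.
  have := hbe0 be; rewrite bb b0 => /(_ isT).
  by move: la lb; rewrite -!low0 => /andP[_ h1] /andP[h2 _]; lra.
exists m, e, m', e'; split=> //.
- by move=> be b0; rewrite laE // lbE // lba.
- by rewrite laE // lbE //; lra.
Qed.

Section Trimmed.
Variables (a b : nat -> R) (del : R) (m e m' e' : nat -> nat).
Hypothesis dom : dominates a b del.
Hypothesis tr : trimmed a b del m e m' e'.

Let am k := a (m k).
Let bm k := b (m' k).
Let g n := gap (fun k => - am k) (fun k => - bm k) n.
Let x := del - (low (fun k => a (e k)) 0 - low (fun k => b (e' k)) 0).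

Let vam : vanishing (fun k => `|am k|).
Proof.
by move=> eps /(trim_vanishing tr)[N hN]; exists N => k /hN; rewrite ltr0_norm // (trim_neg tr).
Qed.

Let vbm : vanishing (fun k => `|bm k|).
Proof.
by move=> eps /(trim_vanishing' tr)[N hN]; exists N => k /hN; rewrite ltr0_norm // (trim_neg' tr).
Qed.

Let gapE n be : \sum_(0 <= i < n) (be - am i) - \sum_(0 <= i < n) (be - bm i) = g n.
Proof. by rewrite -sumrB; apply: eq_bigr => i _; lra. Qed.

Let sorted_le i j : (i <= j)%N -> am i <= am j.
Proof. by move=> /(trim_sorted tr); rewrite lerN2. Qed.

Let sorted_le' i j : (i <= j)%N -> bm i <= bm j.
Proof. by move=> /(trim_sorted' tr); rewrite lerN2. Qed.

(** At level [am n] the first [n.+1] terms give [low am] exactly, whereas for [bm] the truncated sum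
    is only a lower bound. *)
Let gap_low n : low am (am n) - low bm (am n) <= g n.+1.
Proof.
have bn : am n < 0 := trim_neg tr n.
rewrite -(gapE _ (am n)); apply: lerB; last exact: low_top vbm bn.
rewrite (@low_top_eq am _ n.+1) // => i ni; apply: sorted_le => //; exact: ltnW.
Qed.

Lemma trimmed_gap_ge0 n : 0 <= g n.
Proof.
case: n => [|n]; first by rewrite /g gap0.
apply: le_trans (gap_low n); rewrite subr_ge0; exact: (trim_low tr (trim_neg tr n)).
Qed.

Let lowa be : be < 0 -> low a be = low am be + low (fun k => a (e k)) be.
Proof. exact: low_split (trim_compl tr) (dom_vanishing dom). Qed.

Let lowb be : be < 0 -> low b be = low bm be + low (fun k => b (e' k)) be.
Proof. exact: low_split (trim_compl' tr) (dom_vanishing' dom). Qed.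

Lemma trimmed_gap_ev : eventually_ge x g.
Proof.
move=> eta eta0; have eta2 : 0 < eta / 2 by rewrite divr_gt0.
have [be1 be10 hbe1] := dom_excess dom eta2.
(* The rest of [b] at level [am n] is replaced by its value at 0 through continuity; for the rest of
   [a] the value at 0 is an upper bound already. *)
have hcont := @psum_continuous R 0 _ (or_introl erefl) (trim_asum' tr) (0 : R).
have /cvgrPdist_le/(_ _ eta2)/nbhs_ballP[r r0 hr] := hcont.
have q0 : 0 < Num.min (- be1) r by rewrite lt_min oppr_gt0 be10.
have [N hN] := vam (divr_gt0 q0 (ltr0n R 2)); exists N.+1 => -[//|n] Nn.
have q1 : Num.min (- be1) r <= - be1 by rewrite ge_min lexx.
have q2 : Num.min (- be1) r <= r by rewrite ge_min lexx orbT.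
have bn : am n < 0 := trim_neg tr n.
have := hN n Nn; rewrite ltr0_norm // => mun.
apply: le_trans (gap_low n).
have p1 : be1 < am n < 0 by rewrite bn andbT; lra.
have : `|psum 0 (fun k => b (e' k)) 0 - psum 0 (fun k => b (e' k)) (am n)| <= eta / 2.
  by apply: hr; rewrite /ball /= sub0r normrN ltr0_norm //; lra.
rewrite !psum0E ler_norml => /andP[_ h1].
have /andP[_] := low_le_neg (ltW bn) (asum_neg (trim_asum tr)); rewrite -low0.
by have := hbe1 _ p1; rewrite (lowa bn) (lowb bn) /x; move: h1 {hr hbe1}; lra.
Qed.

(** Here the level comes first and [n] counts the terms of [bm] up to it, so the exact truncation is
    on the side of [b]. *)
Lemma trimmed_gap_bounded : exists B : R, forall N, exists2 n, (N <= n)%N & g n <= B.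
Proof.
have [B hB] := dom_frequent dom; exists (B + low (fun k => b (e' k)) 0) => N.
have [be /andP[b1 b2] hbe] := hB _ (trim_neg' tr N).
have exn : exists n, be < bm n.
  have nb : 0 < - be / 2 by rewrite divr_gt0 // oppr_gt0.
  have [n hn] := vbm nb; exists n; have := hn n (leqnn n).
  by rewrite ltr0_norm ?(trim_neg' tr) //; move: b2; lra.
case: (ex_minnP exn) => n hn nmin; exists n.
  rewrite leqNgt; apply/negP => nN; have := sorted_le' (ltnW nN).
  by rewrite leNgt (lt_trans b1 hn).
have e1 : low bm be = \sum_(0 <= i < n) (be - bm i).
  apply: low_top_eq => // i ni.
    by rewrite leNgt; apply/negP => /nmin; rewrite leqNgt ni.
  exact: le_trans (ltW hn) (sorted_le' ni).
have e2 := low_top n vam b2.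
have /andP[_] := low_le_neg (ltW b2) (asum_neg (trim_asum' tr)); rewrite -low0.
move: (trim_rest tr (ltW b2)) hbe; rewrite (lowa b2) (lowb b2) -(gapE n be) -e1.
have /andP[h0 _] := low_le_neg (ltW b2) (asum_neg (trim_asum' tr)).
by move: e2 h0; lra.
Qed.

Lemma trimmed_phi al : 0 <= al <= 1 ->
  Sum (fun k => phi al (a (e k))) = Sum (fun n => phi al (a n)) /\
  Sum (fun k => phi al (b (e' k))) = Sum (fun n => phi al (b n)).
Proof.
move=> al01; have [mi ei dj cv] := trim_compl tr; have [mi' ei' dj' cv'] := trim_compl' tr.
rewrite (Sum_split mi ei dj cv (asum_phi al01 (dom_pos dom))).
rewrite (Sum_split mi' ei' dj' cv' (asum_phi al01 (dom_pos' dom))).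
rewrite (@eq_Sum _ (fun k => phi al (a (m k))) (fun=> 0)) => [|k]; last first.
  by rewrite phi_nonpos // ltW // (trim_neg tr).
rewrite (@eq_Sum _ (fun k => phi al (b (m' k))) (fun=> 0)) => [|k]; last first.
  by rewrite phi_nonpos // ltW // (trim_neg' tr).
by rewrite Sum0 !add0r.
Qed.

Lemma trimmed_pos :
  Sum (fun k => pos (a (e k))) = Sum (fun n => pos (a n)) /\
  Sum (fun k => pos (b (e' k))) = Sum (fun n => pos (b n)).
Proof.
have [mi ei dj cv] := trim_compl tr; have [mi' ei' dj' cv'] := trim_compl' tr.
have posm (y : R) : y < 0 -> pos y = 0 by move=> y0; rewrite /pos max_r // ltW.
rewrite (Sum_split mi ei dj cv (dom_pos dom)) (Sum_split mi' ei' dj' cv' (dom_pos' dom)).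
rewrite (@eq_Sum _ (fun k => pos (a (m k))) (fun=> 0)) => [|k]; last first.
  exact: posm (trim_neg tr k).
rewrite (@eq_Sum _ (fun k => pos (b (m' k))) (fun=> 0)) => [|k]; last first.
  exact: posm (trim_neg' tr k).
by rewrite Sum0 !add0r.
Qed.

End Trimmed.
End Low.

Section ZeroSide.
Context {R : realType} {H : lmodType R[i]}.
Variable (ip : H -> H -> R[i]).
Hypothesis hip : hform ip.
Hypothesis ip_ge0 : forall z, 0 <= ip z z.

(* The inequality on (0,1) holds with the full [del] only from [s0] on; the smaller [rho] below
   [s0] is harmless because the positive terms contribute little there. *)
Definition summable_model (a b : nat -> R) (del rho s0 : R) :=
  exists (K : Type) (X : K -> R) (a0 b0 : nat -> R),
    [/\ [/\ asum a0, asum b0, forall n, a0 n <= 1 & forall n, b0 n <= 1],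
      conv ip a (sumf X a0) /\ conv ip (sumf X b0) b,
      forall al : R, al <= 0 -> psum 0 b0 al <= psum 0 a0 al,
      psum 0 b0 0 < psum 0 a0 0 /\
      forall al : R, 0 < al < 1 -> psum 0 b0 al - psum 0 a0 al <=
         Sum (fun n => phi al (a n)) - Sum (fun n => phi al (b n))
         - (1 - al) * (if s0 <= al then del else rho) &
      Sum a0 - Sum b0 = Sum (fun n => pos (a n)) - Sum (fun n => pos (b n)) - del].

Lemma conv_swap3 (I J K : Type) (f : I -> R) (g : J -> R) (h : K -> R) :
  conv ip (sumf f (sumf g h)) (sumf (sumf g f) h).
Proof.
apply: (@conv_reindex _ _ _ _ _ (fun z : (J + I) + K =>
  match z with inl (inl j) => inr (inl j) | inl (inr i) => inl i | inr k => inr (inr k) end)).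
- by move=> [[i|i]|i] [[j|j]|j] //= [->].
- by move=> [i|[i|i]]; [exists (inl (inr i))|exists (inl (inl i))|exists (inr i)].
- by move=> [[i|i]|i].
Qed.

Lemma conv_void (f : nat -> R) :
  conv ip f (sumf (False_rect R) f) /\
  conv ip (sumf (False_rect R) f) f.
Proof.
apply: (@conv_bij _ _ ip nat (False + nat)%type
  (fun z => match z with inr k => k | inl f => match f with end end)).
- by move=> [[]|i] [[]|j] /= ->.
- by move=> i; exists (inr i).
- by case=> [[]|].
Qed.

Lemma summable_model_refl (a b : nat -> R) (del s0 : R) : dominates a b del ->
  asum (fun n => neg (a n)) -> summable_model a b del del s0.
Proof.
move=> dom na; have [nb nab] := dom_summable dom na; have del0 := dom_gt0 dom.
have pa := dom_pos dom; have pb := dom_pos' dom.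
exists False, (False_rect R), a, b; split.
- by split; [exact: asum_posneg|exact: asum_posneg|exact: dom_le1 dom|exact: dom_le1' dom].
- by split; [exact: (conv_void a).1|exact: (conv_void b).2].
- move=> al; rewrite !psum0E le_eqVlt => /predU1P[->|/(dom_low dom)//].
  by rewrite !low0; move: nab del0; lra.
- split; first by rewrite !psum0E !low0; move: nab del0; lra.
  move=> al /andP[/ltW al0 /ltW al1]; have al01 : 0 <= al <= 1 by rewrite al0.
  rewrite !psum0E (low_phi al01 pa na (dom_le1 dom)) (low_phi al01 pb nb (dom_le1' dom)).
  by rewrite if_same -nab; lra.
- by rewrite (Sum_posneg pa na) (Sum_posneg pb nb); move: nab; lra.
Qed.

(* The surplus of the main part of [a] over that of [b] is absorbed by [M] equal positive
   pivots, which are handed over to [b0]; their size is at most [s0]. *)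
Lemma trimmed_model (a b : nat -> R) (del s0 : R) (m e m' e' : nat -> nat) :
  dominates a b del -> trimmed a b del m e m' e' -> 0 < s0 <= 1 ->
  summable_model a b del (low (fun k => a (e k)) 0 - low (fun k => b (e' k)) 0) s0.
Proof.
move=> dom tr /andP[s00 s01].
set rho := _ - _; pose x := del - rho.
have [rho0 x0] : 0 < rho /\ 0 < x.
  have an := asum_neg (trim_asum' tr); have := low_le_neg (lexx 0) an.
  by have := trim_rest0 tr; rewrite /x /rho; move=> /andP[h1 h2] /andP[h3 _]; split; lra.
pose M := (Num.bound (x / s0)).+1.
pose sig := x / M%:R.
have M0 : 0 < M%:R :> R by rewrite ltr0n.
have sig0 : 0 < sig by rewrite divr_gt0.
have Msig : M%:R * sig = x by rewrite mulrC divfK // lt0r_neq0.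
have sigs : sig <= s0.
  rewrite ler_pdivrMr // mulrC -ler_pdivrMr //; apply: ltW.
  apply: lt_le_trans (archi_boundP _) _; first by rewrite divr_ge0 // ltW.
  by rewrite ler_nat.
pose b0 k := if (k < M)%N then sig else b (e' (k - M)%N).
have b0M k : b0 (M + k)%N = b (e' k) by rewrite /b0 ltnNge leq_addr /= addKn.
have asb0 : asum b0.
  by apply: (@asum_unshift _ _ M); apply: eq_asum (trim_asum' tr) => k; rewrite b0M.
have Sumb0 (h : R -> R) : asum (fun k => h (b0 k)) ->
    Sum (fun k => h (b0 k)) = M%:R * h sig + Sum (fun k => h (b (e' k))).
  move=> ah; rewrite (Sum_shift M ah); congr (_ + _).
    rewrite (eq_big_nat _ _ (F2 := fun=> h sig)) => [|i /andP[_ iM]]; last by rewrite /b0 iM.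
    by rewrite sumr_const_nat subn0 mulr_natl.
  by apply: eq_Sum => k; rewrite b0M.
have lowb0 al : low b0 al = M%:R * psi al sig + low (fun k => b (e' k)) al.
  apply: (Sumb0 (psi al)); apply: asum_le (asum_norm asb0) => k; exact: psi_bound.
have [mi ei dj cv] := trim_compl tr; have [mi' ei' dj' cv'] := trim_compl' tr.
have [_ pae] := asum_split mi ei dj cv (dom_pos dom).
have [_ pbe] := asum_split mi' ei' dj' cv' (dom_pos' dom).
have nae := asum_neg (trim_asum tr); have nbe := asum_neg (trim_asum' tr).
exists nat, (fun k => a (m k)), (fun k => a (e k)), b0; split.
- split; [exact: trim_asum tr|exact: asb0|by move=> n; exact: dom_le1 dom _|move=> n].
  rewrite /b0; case: ifP => _; [exact: le_trans s01|exact: dom_le1' dom _].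
- split; first exact: (conv_complementary ip a (trim_compl tr)).1.
  have mapE : mkseq b0 M = nseq M sig.
    apply: (@eq_from_nth _ 0); rewrite size_mkseq ?size_nseq // => i iM.
    by rewrite nth_mkseq // nth_nseq iM /b0 iM.
  have idc (I : Type) (f : I -> R) : conv ip f f by exact: conv_refl.
  apply: conv_trans (conv_sum hip (idc _ _) (conv_take ip b0 M).1) _; rewrite mapE.
  have ab : conv ip (sumf (ofs (nseq M sig)) (fun k => a (m k))) (fun k => b (m' k)).
    have am0 k : 0 < - a (m k) by rewrite oppr_gt0 (trim_neg tr).
    have gev := trimmed_gap_ev dom tr; rewrite -/rho -/x -Msig in gev.
    have h := conv_absorb_iter hip ip_ge0 sig0 am0 (trim_vanishing tr) (trim_divergent tr)
      (trim_sorted' tr) (trimmed_gap_ge0 tr) gev (trimmed_gap_bounded dom tr).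
    apply: conv_trans (conv_trans _ h) _; apply: conv_refl; last by move=> k; rewrite opprK.
    by case=> //= k; rewrite opprK.
  apply: conv_trans; last exact: (conv_complementary ip b (trim_compl' tr)).2.
  apply: conv_trans; last exact: (conv_sum hip ab (idc _ (fun k => b (e' k)))).
  have swap := @conv_swap3 _ _ _ (fun k => a (m k)) (ofs (nseq M sig)) (fun k => b (e' k)).
  apply: conv_trans _ swap.
  by apply: (conv_sum hip (idc _ _)); apply: (conv_sum hip (idc _ _)); apply: conv_refl.
- move=> al al0; rewrite !psum0E lowb0 (psi_neg_eq0 al0 (ltW sig0)) mulr0 add0r.
  exact: trim_rest tr al al0.
- split.
    rewrite !psum0E lowb0 psi0E (neg_eq0 (ltW sig0)) mulr0 add0r.
    by case/andP: (trim_rest0 tr).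
  move=> al /andP[al0 al1]; have al01 : 0 <= al <= 1 by rewrite !ltW.
  have [pA pB] := trimmed_phi dom tr al01.
  rewrite !psum0E lowb0 (low_phi al01 pae nae) => [|n]; last exact: dom_le1 dom _.
  rewrite (low_phi al01 pbe nbe) => [|n]; last exact: dom_le1' dom _.
  have -> : del = M%:R * sig + rho by rewrite Msig /x subrK.
  rewrite pA pB -!low0 /rho.
  have sig01 : 0 <= sig <= 1 by rewrite ltW //= (le_trans sigs).
  have := psi_small al01 sig01; rewrite -(ler_pM2l M0) mulr0 => ps.
  (* Once [al >= sig] a pivot contributes [- (1 - al) * sig], which restores the full [del]. For
     [al < s0] only the sign of its contribution is used. *)
  case: (leP s0 al) => sal.
    rewrite (psi_small_eq (ltW sig0) (le_trans sigs sal) (ltW al1)) mulrN mulrCA.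
    by lra.
  by move: ps; lra.
- have [pA pB] := trimmed_pos dom tr.
  rewrite (Sum_posneg pae nae) (Sumb0 id asb0) Msig /id (Sum_posneg pbe nbe) pA pB -!low0 /x /rho.
  by lra.
Qed.

(** [rho] comes before [s0], so that [s0] can later be chosen small in terms of [rho]. *)
Lemma zero_side (a b : nat -> R) (del : R) : dominates a b del ->
  exists2 rho : R, 0 < rho & forall s0 : R, 0 < s0 <= 1 -> summable_model a b del rho s0.
Proof.
move=> dom; have [na|na] := pselect (asum (fun n => neg (a n))).
  by exists del => [|s0 _]; [exact: dom_gt0 dom|exact: summable_model_refl].
have [m [e [m' [e' tr]]]] := exists_trimmed dom na.
exists (low (fun k => a (e k)) 0 - low (fun k => b (e' k)) 0).
  by rewrite subr_gt0; case/andP: (trim_rest0 tr).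
by move=> s0 s01; exact: (trimmed_model dom tr s01).
Qed.

End ZeroSide.

(** * Splitting a sequence between its accumulation points *)

Section AccumulationPoints.
Context {R : realType}.

Lemma infinite_unbounded (P : set nat) : infinite_set P <-> unbounded P.
Proof.
split=> [iP N|uP fP].
  apply: contrapT => nex; apply: iP.
  apply: (@sub_finite_set _ _ `I_N); last exact: finite_II.
  move=> n Pn /=; rewrite ltnNge; apply/negP => Nn; apply: nex; by exists n.
have [N hN] : exists N, forall n, P n -> (n < N)%N.
  have /finite_seqP[s sP] := fP.
  exists (\sum_(x <- s) x).+1 => n; rewrite sP /= => ns.
  by rewrite (big_rem n ns) /= ltnS leq_addr.
by have [n Nn /hN] := uP N; rewrite ltnNge Nn.
Qed.

(** Bolzano-Weierstrass: infinitely many terms in the segment would cluster at one of its points. *)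
Lemma no_accumulation_finite (f : nat -> R) (a b : R) :
  (forall x, a <= x <= b -> ~ accumulation_point f x) ->
  exists N, forall n, (N <= n)%N -> ~~ (a <= f n <= b).
Proof.
move=> nacc; apply: contrapT => nex.
have uP : unbounded (fun n => a <= f n <= b).
  move=> N; apply: contrapT => ne; apply: nex; exists N => n Nn.
  by apply/negP => h; apply: ne; exists n.
have [m [minj mP]] := @enumeration R _ uP.
have cK := @segment_compact R a b.
have [|p [pin pcl]] := cK ((fun k => f (m k)) @ \oo) _.
  by exists 0%N => // k _ /=; rewrite in_itv /=; apply/mP; exists k.
have pab : a <= p <= b by move: pin; rewrite /= in_itv.
apply: (nacc p pab) => eps eps0; apply/infinite_unbounded => N.
have [K hK] := inj_large minj N.
have hA : ((fun k => f (m k)) @ \oo) [set y | exists2 k, (K <= k)%N & y = f (m k)].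
  by exists K => // k Kk /=; exists k.
have hB : nbhs p (ball p eps) by exact: nbhsx_ballx.
have [y [[k Kk ->]]] := pcl _ _ hA hB.
by rewrite -ball_normE /= => h; exists (m k) => //; exact: hK.
Qed.

Lemma finite_pos_min (f : nat -> R) n : (forall k, (k < n)%N -> 0 < f k) ->
  exists2 r : R, 0 < r & forall k, (k < n)%N -> r <= f k.
Proof.
elim: n => [|n IH] f0; first by exists 1.
have [|r r0 hr] := IH; first by move=> k kn; apply: f0; exact: ltnW.
exists (Num.min r (f n)); first by rewrite lt_min r0 f0.
move=> k; rewrite ltnS leq_eqVlt ge_min => /predU1P[->|/hr ->//].
by rewrite lexx orbT.
Qed.

End AccumulationPoints.

(* [a] lists the terms of [x] below [c], and [a'] the values [1 - x n] for the other terms. *)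
Record splitting {R : realType} (x : nat -> R) (c : R) (a a' : nat -> R) : Prop := Splitting {
  splitting_index : exists e0 e1, [/\ complementary e0 e1,
    forall k, x (e0 k) = a k & forall k, x (e1 k) = 1 - a' k];
  splitting_le1 : forall k, a k <= 1;
  splitting_le1' : forall k, a' k <= 1;
  splitting_vanishing : vanishing (fun k => `|a k|);
  splitting_vanishing' : vanishing (fun k => `|a' k|);
  splitting_pos : asum (fun k => pos (a k));
  splitting_pos' : asum (fun k => pos (a' k));
  splitting_mid : forall al : R, 0 < al < 1 ->
    majf x al = (Sum (fun k => phi al (a k)) + Sum (fun k => phi (1 - al) (a' k)))%:E;
  splitting_low : forall be : R, be < 0 -> majf x be = (low a be)%:E;
  splitting_up : forall be : R, 1 < be -> majf x be = (low a' (1 - be))%:E;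
  splitting_neg : asum (fun k => neg (a k)) ->
    (\esum_(i in [set i | (x i < 0)%R]) (`|x i|%R)%:E < +oo)%E;
  splitting_neg' : asum (fun k => neg (a' k)) ->
    (\esum_(i in [set i | (1 < x i)%R]) (x i - 1)%:E < +oo)%E;
  splitting_slope : derivable (fun t : R => fine (majf x t)) c 1 ->
    derive1 (fun t : R => fine (majf x t)) c
    = Sum (fun k => pos (a' k)) - Sum (fun k => pos (a k))
}.

Section Decomposition.
Context {R : realType}.
Variables (x : nat -> R) (M c : R).
Hypothesis x_acc : forall y : R, accumulation_point x y <-> y = 0 \/ y = 1.
Hypothesis x_fin : (majf x (2^-1)%R < +oo)%E.
Hypothesis x_bnd : forall n, `|x n| <= M.
Hypothesis c01 : 0 < c < 1.

Let c0 : 0 < c. Proof. by case/andP: c01. Qed.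
Let c1 : c < 1. Proof. by case/andP: c01. Qed.

Let below (a b : R) : b < 0 \/ (0 < a /\ b < 1) \/ 1 < a ->
  exists N, forall n, (N <= n)%N -> ~~ (a <= x n <= b).
Proof.
move=> hab; apply: no_accumulation_finite => y /andP[ay yb] /x_acc[] e; subst y.
  by case: hab => [|[[]|]]; lra.
by case: hab => [|[[]|]]; lra.
Qed.

Let u al n := if 0 <= x n < al then x n else 0.
Let v al n := if al <= x n <= 1 then 1 - x n else 0.

Let u_ge0 al n : 0 <= u al n.
Proof. by rewrite /u; case: ifP => // /andP[]. Qed.

Let v_ge0 al n : 0 <= v al n.
Proof. by rewrite /v; case: ifP => // /andP[_]; rewrite subr_ge0. Qed.

Let majCE al : majC x al = \esum_(i in [set: nat]) (u al i)%:E.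
Proof.
rewrite /majC esum_mkcond; apply: eq_esum => i _; rewrite /u.
by case: ifPn => [/set_mem /= -> //|/negP h]; case: ifPn => // h'; case: h; apply/mem_set.
Qed.

Let majDE al : majD x al = \esum_(i in [set: nat]) (v al i)%:E.
Proof.
rewrite /majD esum_mkcond; apply: eq_esum => i _; rewrite /v.
by case: ifPn => [/set_mem /= -> //|/negP h]; case: ifPn => // h'; case: h; apply/mem_set.
Qed.

Let half01 : (0 < 2^-1 :> R) /\ (2^-1 < 1 :> R).
Proof. by split; rewrite ?invr_gt0 // invf_lt1 // ltr1n. Qed.

Let uv_half : asum (u 2^-1) /\ asum (v 2^-1).
Proof.
have [h0 h1] := half01; move: x_fin; rewrite /majf leNgt h0 /= h1 majCE majDE.
set A := \esum_(_ in _) _; set B := \esum_(_ in _) _ => lt.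
have A0 : (0 <= A)%E by apply: esum_ge0 => i _; rewrite lee_fin.
have B0 : (0 <= B)%E by apply: esum_ge0 => i _; rewrite lee_fin.
have h2 : 0 < 1 - 2^-1 :> R by rewrite subr_gt0.
have At : (A < +oo)%E.
  rewrite ltey; apply/eqP => e; move: lt; rewrite e gt0_muley ?lte_fin // addye //.
  by apply/eqP => e'; have := mule_ge0 (ltW h0 : (0 <= (2^-1)%:E)%E) B0; rewrite e'.
have Bt : (B < +oo)%E.
  rewrite ltey; apply/eqP => e; move: lt; rewrite e gt0_muley ?lte_fin // addey //.
  by apply/eqP => e'; have := mule_ge0 (ltW h2 : (0 <= (1 - 2^-1)%:E)%E) A0; rewrite e'.
by split; apply: asum_esum.
Qed.

Let phi_uv (al : R) n : 0 < al < 1 -> phi al (x n) = (1 - al) * u al n + al * v al n.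
Proof.
move=> /andP[al0 al1]; rewrite /u /v.
have [x0|x0] := ltP (x n) 0.
  rewrite phi_nonpos ?(ltW al0) ?(ltW al1) // ?(ltW x0) //=.
  by rewrite (leNgt al) (lt_trans x0 al0) /= !mulr0 addr0.
have [x1|x1] := ltP 1 (x n).
  rewrite -phi_sym phi_nonpos ?subr_ge0 ?subr_le0 ?gerBl ?(ltW x1) ?(ltW al0) ?(ltW al1) //=.
  by rewrite (ltNge (x n) al) (ltW (lt_trans al1 x1)) /= !mulr0 addr0.
rewrite andbT /= /phi psi_mid ?(ltW al0) ?(ltW al1) //.
have p1 : 0 <= (1 - al) * x n by rewrite mulr_ge0 // subr_ge0 ltW.
have p2 : 0 <= al * (1 - x n) by rewrite mulr_ge0 ?subr_ge0 // ltW.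
have [xa|xa] := ltP (x n) al.
  by rewrite mulr0 addr0 (@max_l _ _ _ (- (al * _))) ?opprK ?max_l //; lra.
by rewrite mulr0 add0r (@max_r _ _ (- ((1 - al) * _))) ?opprK ?max_l //; lra.
Qed.

(** This carries finiteness of [majf] from 1/2 to all of (0,1). *)
Lemma phi_half (al y : R) : 0 <= al <= 1 -> phi al y <= 2 * phi 2^-1 y.
Proof.
move=> /[dup] al01 /andP[al0 al1]; have [h0 h1] := half01.
have [y0|y0] := leP y 0; first by rewrite !phi_nonpos ?mulr0 // !ltW.
have [y1|y1] := leP 1 y.
  rewrite -(phi_sym al) -(phi_sym 2^-1) !phi_nonpos ?mulr0 // ?subr_le0 //.
    by rewrite subr_ge0 gerBl !ltW.
  by rewrite subr_ge0 al1 gerBl.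
have e : phi 2^-1 y = Num.min (2^-1 * y) (2^-1 * (1 - y)).
  rewrite /phi psi_mid ?(ltW h0) ?(ltW h1) //.
  have -> : - ((1 - 2^-1) * y) = - (2^-1 * y) by lra.
  rewrite -oppr_min opprK max_l // le_min !mulr_ge0 // ?subr_ge0 ltW //.
rewrite e /phi psi_mid //.
have p1 : 0 <= (1 - al) * (1 - y) by rewrite mulr_ge0 ?subr_ge0 // ltW.
have p2 : 0 <= al * y by rewrite mulr_ge0 // ltW.
have p3 : 0 <= al * (1 - y) by rewrite mulr_ge0 ?subr_ge0 // ltW.
have p4 : 0 <= (1 - al) * y by rewrite mulr_ge0 ?subr_ge0 // ltW.
rewrite ge_max; case: (lerP (2^-1 * y) (2^-1 * (1 - y))) => q1;
 case: (lerP (- ((1 - al) * y)) (- (al * (1 - y)))) => q2; apply/andP; split; lra.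
Qed.

Let asum_phix (al : R) : 0 < al < 1 -> asum (fun n => phi al (x n)).
Proof.
have [h0 h1] := half01; have [au av] := uv_half.
have ah : asum (fun n => phi 2^-1 (x n)).
  apply: (@eq_asum _ (fun n => (1 - 2^-1) * u 2^-1 n + 2^-1 * v 2^-1 n)).
    by move=> n; rewrite phi_uv // h0.
  by apply: asumD; exact: asumZ.
move=> /andP[/ltW al0 /ltW al1]; apply: asum_le (@asumZ _ 2 _ ah) => n.
by rewrite ger0_norm ?phi_ge0 // phi_half // al0.
Qed.

Let majf_mid (al : R) : 0 < al < 1 -> majf x al = (Sum (fun n => phi al (x n)))%:E.
Proof.
move=> /[dup] al01 /andP[al0 al1]; have ap := asum_phix al01.
have al1' : 0 < 1 - al by rewrite subr_gt0.
have au : asum (u al).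
  apply: asum_le (@asumZ _ (1 - al)^-1 _ ap) => n.
  rewrite ger0_norm // phi_uv // mulrDr mulKf ?gt_eqF // lerDl.
  by rewrite !mulr_ge0 ?invr_ge0 // ltW.
have av : asum (v al).
  apply: asum_le (@asumZ _ al^-1 _ ap) => n.
  rewrite ger0_norm // phi_uv // mulrDr (mulKf (lt0r_neq0 al0)) lerDr.
  by rewrite !mulr_ge0 ?invr_ge0 // ltW.
rewrite /majf leNgt al0 /= al1 majCE majDE !esum_Sum // -!EFinM -EFinD; congr EFin.
rewrite -!SumZ // -SumD; [|exact: asumZ|exact: asumZ].
by apply: eq_Sum => n; rewrite phi_uv.
Qed.

Lemma split_at : exists e0 e1 : nat -> nat, complementary e0 e1 /\
  ((forall k, x (e0 k) <= c) /\ (forall k, c < x (e1 k))).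
Proof.
have inf0 : accumulation_point x 0 by apply/x_acc; left.
have inf1 : accumulation_point x 1 by apply/x_acc; right.
have u0 : unbounded (fun n => x n <= c).
  move=> N; have /infinite_unbounded/(_ N)[n Nn /= hn] := inf0 c c0; exists n => //.
  by move: hn; rewrite sub0r normrN => /ltW; apply: le_trans; exact: ler_norm.
have u1 : unbounded (fun n => c < x n).
  have d0 : 0 < 1 - c by rewrite subr_gt0.
  move=> N; have /infinite_unbounded/(_ N)[n Nn /= hn] := inf1 _ d0; exists n => //.
  have := ler_norm (1 - x n); lra.
have [e0 [inj0 h0]] := @enumeration R _ u0; have [e1 [inj1 h1]] := @enumeration R _ u1.
exists e0, e1; split; last by split=> k; [apply/h0|apply/h1]; exists k.
split=> // [i j e|n].
  have p0 : x (e0 i) <= c by apply/h0; exists i.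
  have p1 : c < x (e1 j) by apply/h1; exists j.
  by move: p1; rewrite -e ltNge p0.
by have [h|h] := leP (x n) c; [left; apply/h0|right; apply/h1].
Qed.

Variables (e0 e1 : nat -> nat).
Hypothesis e01 : complementary e0 e1.
Hypothesis x_e0 : forall k, x (e0 k) <= c.
Hypothesis x_e1 : forall k, c < x (e1 k).

Let a k : R := x (e0 k).
Let a' k : R := 1 - x (e1 k).

Let va : vanishing (fun k => `|a k|).
Proof.
move=> eps eps0; have [inj0 _ _ _] := e01.
(* Terms away from 0 lie in [-M, -eps] or [eps, c]; the bound [M] makes the first a compact segment,
   and each contains finitely many terms. *)
have [|N1 hN1] := @below (- M) (- eps); first by left; rewrite oppr_lt0.
have [|N2 hN2] := @below eps c; first by right; left.
have [K hK] := inj_large inj0 (maxn N1 N2); exists K => k /hK; rewrite geq_max => /andP[/hN1 p1 /hN2].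
move: p1; have := x_bnd (e0 k); have := x_e0 k; rewrite -/(a k) => ac /[!ler_norml] /andP[q1 q2].
rewrite q1 ac andbT /= -!ltNge => r1 r2; by rewrite !ltW.
Qed.

Let va' : vanishing (fun k => `|a' k|).
Proof.
move=> eps eps0; have [_ inj1 _ _] := e01.
have [|N1 hN1] := @below (1 + eps) M; first by right; right; lra.
have [|N2 hN2] := @below c (1 - eps); first by right; left; split=> //; lra.
have [K hK] := inj_large inj1 (maxn N1 N2); exists K => k /hK; rewrite geq_max => /andP[/hN1 p1 /hN2].
move: p1; have := x_bnd (e1 k); have := x_e1 k; rewrite /a' => ac /[!ler_norml] /andP[q1 q2].
rewrite q2 (ltW ac) andbT /= -!ltNge => r1 r2; apply/andP; split; lra.
Qed.

(** Left of its peak the tent is linear, so summability of positive parts follows from finiteness of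
    [majf x] at [c]. *)
Let pos_phi (y : R) : y <= c -> pos y = (1 - c)^-1 * phi c y.
Proof.
move=> yc; have [y0|y0] := leP y 0.
  by rewrite phi_nonpos ?mulr0 ?(ltW c0) ?(ltW c1) // /pos max_r.
rewrite /phi psi_small_eq ?(ltW y0) ?(ltW c1) // opprK /pos !max_l ?(ltW y0) //.
  by rewrite mulrA mulVf ?mul1r // gt_eqF // subr_gt0.
by rewrite mulr_ge0 ?(ltW y0) // subr_ge0 ltW.
Qed.

Let pos_phi' (y : R) : c <= y -> pos (1 - y) = c^-1 * phi c y.
Proof.
move=> yc; have [y0|y0] := leP (1 - y) 0.
  rewrite -phi_sym phi_nonpos ?mulr0 ?subr_ge0 ?(ltW c1) ?gerBl ?(ltW c0) // /pos max_r //.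
rewrite -phi_sym /phi psi_small_eq ?(ltW y0) // ?gerBl ?(ltW c0) //; last by lra.
rewrite opprK /pos !max_l ?(ltW y0) //.
  by rewrite mulrA subKr mulVf ?mul1r // gt_eqF.
by rewrite mulr_ge0 ?(ltW y0) // subKr ltW.
Qed.

Let split_phi : asum (fun k => phi c (x (e0 k))) /\ asum (fun k => phi c (x (e1 k))).
Proof. by have [i0 i1 dj cv] := e01; exact: asum_split (asum_phix c01). Qed.

Let apos : asum (fun k => pos (a k)).
Proof.
by apply: eq_asum (@asumZ _ (1 - c)^-1 _ split_phi.1) => k; rewrite (pos_phi (x_e0 k)).
Qed.

Let apos' : asum (fun k => pos (a' k)).
Proof.
by apply: eq_asum (@asumZ _ c^-1 _ split_phi.2) => k; rewrite (pos_phi' (ltW (x_e1 k))).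
Qed.

Let majf_in (al : R) : 0 < al < 1 ->
  majf x al = (Sum (fun k => phi al (a k)) + Sum (fun k => phi (1 - al) (a' k)))%:E.
Proof.
move=> al01; have [i0 i1 dj cv] := e01.
rewrite majf_mid // (Sum_split i0 i1 dj cv (asum_phix al01)); congr (_ + _)%:E.
by apply: eq_Sum => k; rewrite phi_sym.
Qed.

Let outside (f : R -> R) (D : R -> bool) : (forall y, D y -> 0 <= f y) ->
  \esum_(i in [set i | D (x i)]) (f (x i))%:E =
  \esum_(i in [set: nat]) (if D (x i) then f (x i) else 0)%:E.
Proof.
move=> f0; rewrite esum_mkcond; apply: eq_esum => i _.
by case: ifPn => [/set_mem /= -> //|/negP h]; case: ifPn => // h'; case: h; apply/mem_set.
Qed.

Let outside_Sum (f : R -> R) (D : R -> bool) : (forall y, D y -> 0 <= f y) ->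
  asum (fun i => if D (x i) then f (x i) else 0) ->
  \esum_(i in [set i | D (x i)]) (f (x i))%:E = (Sum (fun i => if D (x i) then f (x i) else 0))%:E.
Proof.
move=> f0 af; rewrite outside // esum_Sum // => n; case: ifP => // /f0 //.
Qed.

Let psi_below (be y : R) : be < 0 -> (if y <= be then be - y else 0) = psi be y.
Proof.
move=> b0; rewrite psi_le0 ?(ltW b0) //; case: leP => h; first by rewrite max_l // subr_ge0.
by rewrite max_r // subr_le0 ltW.
Qed.

Let psi_above (be y : R) : 1 < be -> (if be <= y then y - be else 0) = psi be y.
Proof.
move=> b0; rewrite psi_ge1 ?(ltW b0) //; case: leP => h; first by rewrite max_l // subr_ge0.
by rewrite max_r // subr_le0 ltW.
Qed.

Let asum_two (f : R -> R) : asum (fun k => f (x (e0 k))) -> asum (fun k => f (x (e1 k))) ->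
  asum (fun n => f (x n)) /\
  Sum (fun n => f (x n)) = Sum (fun k => f (x (e0 k))) + Sum (fun k => f (x (e1 k))).
Proof.
have [i0 i1 dj cv] := e01 => h0 h1; have h := @asum_unsplit R e0 e1 i0 i1 dj cv (fun n => f (x n)) h0 h1.
by split=> //; exact: (Sum_split i0 i1 dj cv h).
Qed.

Let sum_zero (f : nat -> R) : (forall n, f n = 0) -> asum f /\ Sum f = 0.
Proof.
move=> f0; split; last by rewrite (eq_Sum f0) Sum0.
by apply: (@asum_fin _ _ 0) => n _.
Qed.

Let majf_low (be : R) : be < 0 -> majf x be = (low a be)%:E.
Proof.
move=> b0; rewrite /majf (ltW b0).
have [z1 z2] : asum (fun k => psi be (x (e1 k))) /\ Sum (fun k => psi be (x (e1 k))) = 0.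
  apply: sum_zero => k; rewrite psi_neg0 ?(ltW b0) // (le_trans (ltW b0)) //.
  exact: ltW (lt_trans c0 (x_e1 k)).
have [h1 h2] := @asum_two (psi be) (asum_psi_neg va b0) z1.
rewrite (@outside_Sum (fun y => be - y) (fun y => y <= be)).
- congr EFin; rewrite (eq_Sum (fun n => psi_below (x n) b0)) h2 z2 addr0 //.
- by move=> y h; rewrite subr_ge0.
- by apply: eq_asum h1 => n; rewrite psi_below.
Qed.

Let majf_up (be : R) : 1 < be -> majf x be = (low a' (1 - be))%:E.
Proof.
move=> b1; rewrite /majf leNgt (lt_trans ltr01 b1) /= ltNge (ltW b1) /=.
have [z1 z2] : asum (fun k => psi be (x (e0 k))) /\ Sum (fun k => psi be (x (e0 k))) = 0.
  apply: sum_zero => k; rewrite psi_ge1 ?(ltW b1) // max_r // subr_le0 (le_trans (x_e0 k)) //.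
  exact: ltW (lt_trans c1 b1).
have h : asum (fun k => psi be (x (e1 k))).
  have b0 : 1 - be < 0 by rewrite subr_lt0.
  by apply: eq_asum (asum_psi_neg va' b0) => k; rewrite psi_sym.
have [h1 h2] := @asum_two (psi be) z1 h.
rewrite (@outside_Sum (fun y => y - be) (fun y => be <= y)).
- congr EFin; rewrite (eq_Sum (fun n => psi_above (x n) b1)) h2 z2 add0r //.
  by apply: eq_Sum => n; rewrite psi_sym.
- by move=> y h'; rewrite subr_ge0.
- by apply: eq_asum h1 => n; rewrite psi_above.
Qed.

Let lower_sum : asum (fun k => neg (a k)) ->
  (\esum_(i in [set i | (x i < 0)%R]) (`|x i|%R)%:E < +oo)%E.
Proof.
move=> an.
have [z1 z2] : asum (fun k => neg (x (e1 k))) /\ Sum (fun k => neg (x (e1 k))) = 0.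
  apply: sum_zero => k; rewrite /neg max_r // oppr_le0; exact: ltW (lt_trans c0 (x_e1 k)).
have [h1 h2] := @asum_two neg an z1.
rewrite (@outside_Sum (fun y => `|y|) (fun y => y < 0)) ?ltry //.
apply: eq_asum h1 => n /=; case: ifP => [h|/negbT]; last by rewrite -neg_neq0 negbK => /eqP.
by rewrite neg_lt0 // ltr0_norm.
Qed.

Let upper_sum : asum (fun k => neg (a' k)) ->
  (\esum_(i in [set i | (1 < x i)%R]) (x i - 1)%:E < +oo)%E.
Proof.
move=> an.
have [z1 z2] : asum (fun k => neg (1 - x (e0 k))) /\ Sum (fun k => neg (1 - x (e0 k))) = 0.
  apply: sum_zero => k; rewrite /neg max_r // opprB subr_le0; exact: le_trans (x_e0 k) (ltW c1).
have [h1 h2] := @asum_two (fun y => neg (1 - y)) z1 an.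
rewrite (@outside_Sum (fun y => y - 1) (fun y => 1 < y)) ?ltry //.
  by move=> y h; rewrite subr_ge0 ltW.
apply: eq_asum h1 => n; case: ifP => [h|/negbT]; first by rewrite neg_lt0 ?subr_lt0 // opprB.
by rewrite -leNgt => h; rewrite /neg max_r // opprB subr_le0.
Qed.

(* No term lies just above [c], so [majf x] is affine on an interval to the right of [c] and its
   derivative at [c] can be computed there. *)
Let right_gap : exists2 r : R, 0 < r & c + r < 1 /\ forall k, c + r <= x (e1 k).
Proof.
have hc0 := c0; have hc1 := c1.
have mid : c < (c + 1) / 2 /\ (c + 1) / 2 < 1 by split; lra.
have [|N hN] := @below c ((c + 1) / 2); first by right; left; case: mid.
have [|r r0 hr] := @finite_pos_min R (fun n => if c < x n then x n - c else 1) N.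
  by move=> k _; case: ifP => // h; rewrite subr_gt0.
exists (Num.min r ((1 - c) / 2)).
  by rewrite lt_min r0 divr_gt0 // subr_gt0.
have m1 : Num.min r ((1 - c) / 2) <= r by rewrite ge_min lexx.
have m2 : Num.min r ((1 - c) / 2) <= (1 - c) / 2 by rewrite ge_min lexx orbT.
split=> [|k]; first by case: mid; lra.
have xk := x_e1 k; case: (ltnP (e1 k) N) => kN; first by have := hr _ kN; rewrite xk; lra.
by have := hN _ kN; rewrite (ltW xk) /= -ltNge; lra.
Qed.

Let slope : derivable (fun t : R => fine (majf x t)) c 1 ->
  derive1 (fun t : R => fine (majf x t)) c = Sum (fun k => pos (a' k)) - Sum (fun k => pos (a k)).
Proof.
set A := Sum (fun k => pos (a k)); set A' := Sum (fun k => pos (a' k)).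
have [r r0 [cr hr]] := right_gap.
have lin al : c <= al <= c + r -> fine (majf x al) = (1 - al) * A + al * A'.
  move=> /andP[ca ar]; have al1 : al < 1 := le_lt_trans ar cr.
  have al0 : 0 < al := lt_le_trans c0 ca.
  rewrite majf_in ?al0 //= -SumZ // -SumZ //; congr (_ + _); apply: eq_Sum => k.
    have [y0|y0] := leP (a k) 0.
      by rewrite phi_nonpos ?(ltW al0) ?(ltW al1) // /pos max_r // mulr0.
    rewrite /phi psi_small_eq ?(ltW y0) ?(ltW al1) ?(le_trans (x_e0 k)) // opprK.
    by rewrite /pos !max_l ?(ltW y0) // mulr_ge0 ?(ltW y0) // subr_ge0 ltW.
  have [y0|y0] := leP (a' k) 0.
    by rewrite phi_nonpos ?subr_ge0 ?gerBl ?(ltW al0) ?(ltW al1) // /pos max_r // mulr0.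
  have h : a' k <= 1 - al by rewrite /a'; have := hr k; lra.
  rewrite /phi psi_small_eq ?(ltW y0) ?gerBl ?(ltW al0) // opprK subKr.
  by rewrite /pos !max_l ?(ltW y0) // mulr_ge0 ?(ltW y0) // ltW.
move=> df; rewrite derive1E; pose D : R := 'D_(1 : R) (fun t : R => fine (majf x t)) c; rewrite -/D.
apply/eqP; rewrite -subr_eq0; apply/eqP/normr0_eq0/eqP.
rewrite eq_le normr_ge0 andbT; apply/ler_addgt0Pr => eps eps0; rewrite add0r.
have hD : (fun t : R => t^-1 *: (fine (majf x (t *: 1 + c)) - fine (majf x c))) t @[t --> 0^'] --> D.
  exact: df.
clearbody D; move: hD => /cvgrPdist_le /(_ eps eps0).
rewrite /dnbhs /within /= => /nbhs_ballP[h /= h0 hb].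
pose s := Num.min r h / 2.
have m0 : 0 < Num.min r h by rewrite lt_min r0.
have mr : Num.min r h <= r by rewrite ge_min lexx.
have mh : Num.min r h <= h by rewrite ge_min lexx orbT.
have [s0 sr sh] : [/\ 0 < s, s <= r & s < h] by rewrite /s; split; lra.
have := hb s; rewrite -ball_normE /= sub0r normrN gtr0_norm // => /(_ sh).
have -> : s *: (1 : R) = s by exact: mulr1.
rewrite gt_eqF // => /(_ isT); rewrite lin ?lin; last 2 first.
- by apply/andP; split; lra.
- by apply/andP; split; lra.
rewrite -[_ *: _]/(s^-1 * ((1 - (s + c)) * A + (s + c) * A' - ((1 - c) * A + c * A'))).
have -> : (1 - (s + c)) * A + (s + c) * A' - ((1 - c) * A + c * A') = s * (A' - A) by ring.
by rewrite mulKf ?gt_eqF.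
Qed.

Lemma complementary_splitting : splitting x c a a'.
Proof.
have x1 k : 0 <= x (e1 k) by exact: ltW (lt_trans c0 (x_e1 k)).
split=> //; first by exists e0, e1; split=> // k; rewrite /a' subKr.
- by move=> k; exact: le_trans (x_e0 k) (ltW c1).
- by move=> k; rewrite gerBl.
Qed.

End Decomposition.

Lemma exists_splitting {R : realType} (x : nat -> R) (M c : R) :
  (forall y : R, accumulation_point x y <-> y = 0 \/ y = 1) ->
  (majf x (2^-1)%R < +oo)%E -> (forall n, `|x n| <= M) -> 0 < c < 1 ->
  exists a a', splitting x c a a'.
Proof.
move=> x_acc x_fin x_bnd c01; have [e0 [e1 [e01 [h0 h1]]]] := split_at x_acc c01.
by do 2 eexists; exact: (complementary_splitting x_acc x_fin x_bnd c01 e01 h0 h1).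
Qed.

(** * Both ends together *)

Section Liminf.
Context {R : realType}.

Lemma limf_einf_fin (f : R -> \bar R) (F : set_system R) (L : R) :
  Filter F -> limf_einf f F = L%:E -> forall eta : R, 0 < eta ->
  (\forall b \near F, ((L - eta)%:E <= f b)%E) /\
  forall V : set R, F V -> exists2 b, V b & (f b <= (L + eta)%:E)%E.
Proof.
move=> FF; rewrite limf_einfE => e eta eta0; split=> [|V FV].
  have : ((L - eta)%:E < ereal_sup [set ereal_inf (f @` V) | V in F])%E.
    by rewrite e lte_fin ltrBlDr ltrDl.
  move=> /ereal_sup_gt[_ [V FV <-]] lt; apply: filterS FV => b Vb.
  by apply: le_trans (ltW lt) _; apply: ereal_inf_lbound; exists b.
have : (ereal_inf (f @` V) < (L + eta)%:E)%E.
  apply: (@le_lt_trans _ _ L%:E); last by rewrite lte_fin ltrDl.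
  by rewrite -e; apply: ereal_sup_ubound; exists V.
by move=> /ereal_inf_lt[_ [b Vb <-]] lt; exists b => //; exact: ltW.
Qed.

(** The limit inferior from the left at 0 equals [L]. The end 1 is brought to this form by the
    reflection of [be] to [1 - be]. *)
Definition left_liminf (f : R -> R) (L : R) := forall eta : R, 0 < eta ->
  (exists2 be0 : R, be0 < 0 & forall be : R, be0 < be < 0 -> L - eta <= f be) /\
  forall be0 : R, be0 < 0 -> exists2 be : R, be0 < be < 0 & f be <= L + eta.

Lemma left_liminfP (f : R -> \bar R) (g : R -> R) (L : R) :
  (forall be : R, be < 0 -> f be = (g be)%:E) ->
  limf_einf f (0 : R)^'- = L%:E -> left_liminf g L.
Proof.
move=> fg /limf_einf_fin h eta eta0; have [h1 h2] := h _ eta0; split.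
  move: h1; rewrite /at_left /within /= => /nbhs_ballP[e /= e0 he].
  exists (- e); first by rewrite oppr_lt0.
  move=> be /andP[b1 b2]; have := he be; rewrite -ball_normE /= sub0r normrN ltr0_norm //.
  by rewrite ltrNl fg // lee_fin => /(_ b1 b2).
move=> be0 b0; have [|be /andP[b1 b2]] := h2 [set b | be0 < b < 0].
  near=> b; apply/andP; split; near: b; [exact: nbhs_left_gt|exact: nbhs_left_lt].
by rewrite fg // lee_fin => le; exists be; rewrite ?b1.
Unshelve. all: by end_near.
Qed.

Lemma right_liminfP (f : R -> \bar R) (g : R -> R) (L : R) :
  (forall be : R, 1 < be -> f be = (g (1 - be))%:E) ->
  limf_einf f (1 : R)^'+ = L%:E -> left_liminf g L.
Proof.
move=> fg /limf_einf_fin h eta eta0; have [h1 h2] := h _ eta0; split.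
  move: h1; rewrite /at_right /within /= => /nbhs_ballP[e /= e0 he].
  exists (- e); first by rewrite oppr_lt0.
  move=> be /andP[b1 b2]; have := he (1 - be); rewrite -ball_normE /= subKr ltr0_norm //.
  have be1 : 1 < 1 - be by lra.
  by rewrite ltrNl fg // lee_fin subKr => /(_ b1 be1).
move=> be0 b0; have [|be /andP[b1 b2]] := h2 [set b | 1 < b < 1 - be0].
  near=> b; apply/andP; split; near: b; [exact: nbhs_right_gt|apply: nbhs_right_lt].
  lra.
rewrite fg // lee_fin => le; exists (1 - be) => //; apply/andP; split; lra.
Unshelve. all: by end_near.
Qed.

Lemma low_cvg (a : nat -> R) (eps : R) : asum (fun n => pos (a n)) ->
  asum (fun n => neg (a n)) -> 0 < eps ->
  exists2 be0 : R, be0 < 0 & forall be : R, be0 < be < 0 ->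
    `|Sum (fun n => neg (a n)) - low a be| <= eps.
Proof.
move=> ap an eps0.
have aa := asum_posneg ap an.
have := @psum_continuous R 0 a (or_introl erefl) aa 0.
move=> /cvgrPdist_le /(_ eps eps0) /nbhs_ballP[e /= e0 he].
exists (- e); first by rewrite oppr_lt0.
move=> be /andP[b1 b2]; have := he be; rewrite -ball_normE /= sub0r normrN ltr0_norm //.
by rewrite ltrNl !psum0E low0 => /(_ b1).
Qed.

(** When the negative part of [a] is summable, so is that of [b]; both [low] functions then tend to
    their totals, and the limit inferior is the difference of these totals. *)
Lemma liminf_dominates (a b : nat -> R) (del dL : R) :
  (forall n, a n <= 1) -> (forall n, b n <= 1) ->
  vanishing (fun n => `|a n|) -> vanishing (fun n => `|b n|) ->
  asum (fun n => pos (a n)) -> asum (fun n => pos (b n)) ->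
  (forall be : R, be < 0 -> low b be <= low a be) -> 0 < del <= dL ->
  left_liminf (fun be => low a be - low b be) dL ->
  (asum (fun n => neg (a n)) -> del = dL) -> dominates a b del.
Proof.
move=> a1 b1 va vb pa pb lowle /andP[del0 delL] lim eqL; split=> //.
- move=> eta /lim[[be0 b0 h] _]; exists be0 => // be /h; lra.
- exists (dL + 1) => be0 b0; exact: (lim _ ltr01).2.
- move=> na; have nb : asum (fun n => neg (b n)).
    apply: (@low_bounded_asum _ _ (Sum (fun n => neg (a n))) vb) => be b0.
    by apply: le_trans (lowle be b0) _; case/andP: (low_le_neg (ltW b0) na).
  split=> //; rewrite (eqL na); apply/eqP; rewrite -subr_eq0 -normr_le0.
  apply/ler_addgt0Pr => eps eps0; rewrite add0r.
  have e3 : 0 < eps / 3 by rewrite divr_gt0.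
  have [p p0 hp] := low_cvg pa na e3; have [q q0 hq] := low_cvg pb nb e3.
  have [[r r0 hr] hf] := lim _ e3.
  pose m := Num.max p (Num.max q r).
  have m0 : m < 0 by rewrite /m !gt_max p0 q0 r0.
  have [be /andP[b1' b2]] := hf m m0.
  move: b1'; rewrite /m !gt_max => /and3P[pb' qb rb].
  have := hp be; rewrite pb' b2 => /(_ isT); have := hq be; rewrite qb b2 => /(_ isT).
  have := hr be; rewrite rb b2 => /(_ isT).
  rewrite !ler_norml => h1 /andP[h2 h3] /andP[h4 h5] h6.
  apply/andP; split; lra.
Qed.

(** For small [al] the first [N] tents are at most [al] each, the tail of [f] is uniformly small,
    and the tents of [g] are at most [al] times its positive parts. *)
Lemma small_phi (f g : nat -> R) (eps : R) : asum (fun n => pos (f n)) ->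
  asum (fun n => pos (g n)) -> 0 < eps ->
  exists2 s : R, 0 < s & forall al : R, 0 <= al <= 1 -> al <= s ->
    Sum (fun n => phi al (f n)) + Sum (fun n => phi (1 - al) (g n)) <= eps.
Proof.
move=> pf pg eps0; have e3 : 0 < eps / 3 by rewrite divr_gt0.
have [N /(_ N (leqnn N)) hN] := Sum_tail pf e3.
pose G := Sum (fun n => pos (g n)).
have G0 : 0 <= G by apply: Sum_ge0 => // n; exact: pos_ge0.
have C0 : 0 < N%:R + G + 1 by rewrite ltr_wpDl // addr_ge0.
exists (eps / 3 / (N%:R + G + 1)); first by rewrite divr_gt0.
move=> al al01 als; have /andP[al0 al1] := al01.
have af : asum (fun n => phi al (f n)).
  exact: asum_phi.
have h1 : Sum (fun n => phi (1 - al) (g n)) <= al * G.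
  rewrite -SumZ //; apply: Sum_le => [||n].
  - apply: asum_le pg => n; rewrite ger0_norm ?phi_ge0 // phi_le_pos //.
    by rewrite subr_ge0 al1 gerBl.
  - exact: asumZ.
  - by have := phi_le1 (g n) al01; rewrite -phi_sym subKr.
have h2 : Sum (fun n => phi al (f n)) <= N%:R * al + eps / 3.
  rewrite (Sum_shift N af) lerD //.
    rewrite mulr_natl -{2}(subn0 N) -sumr_const_nat; apply: ler_sum => i _; exact: phi_le_al.
  apply: le_trans hN; apply: Sum_le => [||k].
  - exact: (asum_shift N af).
  - by apply: asum_norm; exact: (asum_shift N pf).
  - by rewrite ger0_norm ?pos_ge0 // phi_le_pos.
have h3 : (N%:R + G + 1) * al <= eps / 3 by rewrite mulrC -ler_pdivlMr.
lra.
Qed.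

End Liminf.

(** * Combining the models at 0 and 1 *)

Section TwoSides.
Context {R : realType} {H : lmodType R[i]}.
Variable (ip : H -> H -> R[i]).
Hypothesis hip : hform ip.
Hypothesis ip_ge0 : forall z, 0 <= ip z z.

Lemma conv_two_sides (a b a' b' : nat -> R) (del del' : R) (k : int) :
  dominates a b del -> dominates a' b' del' ->
  (forall al : R, 0 < al < 1 ->
    Sum (fun n => phi al (a n)) + Sum (fun n => phi (1 - al) (a' n)) <
    Sum (fun n => phi al (b n)) + Sum (fun n => phi (1 - al) (b' n))
      + (1 - al) * del + al * del') ->
  Sum (fun n => pos (a' n)) - Sum (fun n => pos (a n))
    - (Sum (fun n => pos (b' n)) - Sum (fun n => pos (b n))) = del' - del + k%:~R ->
  conv ip (sumf a (fun n => 1 - a' n)) (sumf b (fun n => 1 - b' n)).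
Proof.
move=> dom dom' strict trace.
have pa := dom_pos dom; have pb := dom_pos' dom; have del0 := dom_gt0 dom.
have pa' := dom_pos dom'; have pb' := dom_pos' dom'; have del0' := dom_gt0 dom'.
have [rho rho0 side] := zero_side hip ip_ge0 dom.
have [rho' rho0' side'] := zero_side hip ip_ge0 dom'.
have [s1 s10 hs1] := small_phi pa pa' (divr_gt0 rho0 (ltr0n R 4)).
have [s2 s20 hs2] := small_phi pa' pa (divr_gt0 rho0' (ltr0n R 4)).
pose s := Num.min 2^-1 (Num.min s1 s2).
have s0 : 0 < s by rewrite !lt_min s10 s20 invr_gt0 ltr0n.
have sh : s <= 2^-1 by rewrite ge_min lexx.
have ss1 : s <= s1 by rewrite !ge_min lexx orbT.
have ss2 : s <= s2 by rewrite !ge_min lexx !orbT.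
have s01 : 0 < s <= 1 by rewrite s0; lra.
have [K [X [a0 [b0 [[aa0 ab0 a01 b01] [ca cb] out [st mid] tr]]]]] := side s s01.
have [K' [X' [a0' [b0' [[aa0' ab0' a01' b01'] [ca' cb'] out' [st' mid'] tr']]]]] := side' s s01.
have pN (f : nat -> R) al : psum 1 (fun n => - f n) al = psum 0 f (1 - al).
  by apply: eq_Sum => n; rewrite add0r -[RHS]psi_sym subKr.
have pz (f : nat -> R) al : (forall n, f n <= 1) -> 1 <= al -> psum 0 f al = 0.
  move=> f1 al1; rewrite /psum (@eq_Sum _ _ (fun=> 0)) ?Sum0 // => n.
  by rewrite add0r psi_ge1 // max_r // subr_le0 (le_trans (f1 n)).
(* In the middle range the strict hypothesis applies with both full values. Within [s] of an end,
   the sum of tents is at most a quarter of [rho], while [rho] itself enters with a factor of at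
   least 1/2. *)
have inner (al : R) : 0 < al < 1 -> psum 0 b0 al + psum 0 b0' (1 - al) < psum 0 a0 al + psum 0 a0' (1 - al).
  move=> al01; have /andP[al0 al1] := al01.
  have al01' : 0 < 1 - al < 1 by apply/andP; split; lra.
  have h1 := mid al al01; have h2 := mid' _ al01'; rewrite subKr in h2.
  have h3 := strict al al01.
  have ge0 (f : nat -> R) be : 0 < be < 1 -> asum (fun n => pos (f n)) -> 0 <= Sum (fun n => phi be (f n)).
    move=> /andP[/ltW be0 /ltW be1] pf; apply: Sum_ge0 => [|n]; last exact: phi_ge0.
    by apply: asum_phi pf; rewrite be0.
  have q1 := ge0 b al al01 pb; have q2 := ge0 b' _ al01' pb'.
  case: (leP s al) h1 => sal h1; last first.
    have := hs1 al; rewrite (ltW al0) (ltW al1) => /(_ isT (le_trans (ltW sal) ss1)) h4.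
    move: h2; rewrite ifT; last by lra.
    have : 0 < al * del' by rewrite mulr_gt0.
    have : 2^-1 * rho <= (1 - al) * rho by rewrite ler_pM2r //; lra.
    lra.
  case: (leP s (1 - al)) h2 => sal' h2; first by lra.
  have := hs2 (1 - al); rewrite subKr subr_ge0 gerBl (ltW al0) (ltW al1) => /(_ isT).
  move=> /(_ (le_trans (ltW sal') ss2)) h4.
  have : 0 < (1 - al) * del by rewrite mulr_gt0 // subr_gt0.
  have : 2^-1 * rho' <= al * rho' by rewrite ler_pM2r //; lra.
  lra.
(* [conv_summable] counts the moves in each direction by a natural number, so the integer is written
   as a difference. *)
have [p [q pq]] : exists p q : nat, k = (p%:Z - q%:Z).
  by case: k {trace} => n; [exists n, 0%N; rewrite subr0|exists 0%N, n.+1; rewrite sub0r NegzE].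
have core : conv ip (sumf a0 (fun n => 1 + - a0' n)) (sumf b0 (fun n => 1 + - b0' n)).
  apply: (@conv_summable _ _ ip hip ip_ge0 _ _ _ _ q p) => //; try exact: asumN.
  - move=> al; rewrite /hsum !pN; have [al0|al0] := leP al 0.
      by rewrite (pz b0') ?(pz a0') ?lerD2r ?out //; lra.
    have [al1|al1] := leP 1 al.
      by rewrite (pz b0) ?(pz a0) // lerD2l out' // subr_le0.
    by apply: ltW; apply: inner; rewrite al0.
  - move=> al /andP[]; rewrite /hsum !pN le_eqVlt => /predU1P[<- _|al0].
      by rewrite subr0 (pz b0') ?(pz a0') // ltrD2r.
    rewrite le_eqVlt => /predU1P[->|al1]; last by apply: inner; rewrite al0.
    by rewrite subrr (pz b0) ?(pz a0) // ltrD2l.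
  - rewrite !SumN //; move: trace tr tr'; rewrite pq rmorphB /= -!pmulrn => trace tr tr'.
    lra.
have m1 : -1 != 0 :> R by rewrite oppr_eq0 oner_eq0.
have ca1 := @conv_affine _ _ _ hip _ _ (-1) 1 _ _ m1 ca'.
have cb1 := @conv_affine _ _ _ hip _ _ (-1) 1 _ _ m1 cb'.
have idc (I : Type) (f g : I -> R) : (forall i, g i = f i) -> conv ip f g by exact: conv_refl.
pose Y k := 1 - X' k.
have neg1 (I : Type) (f : I -> R) (g : nat -> R) : conv ip (fun i => -1 * sumf f g i + 1)
     (sumf (fun i => 1 - f i) (fun n => 1 + - g n)) /\
   conv ip (sumf (fun i => 1 - f i) (fun n => 1 + - g n)) (fun i => -1 * sumf f g i + 1).
  by split; apply: idc => -[z|z] /=; rewrite mulN1r addrC.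
have neg1' (g : nat -> R) : conv ip (fun n => 1 - g n) (fun n => -1 * g n + 1) /\
    conv ip (fun n => -1 * g n + 1) (fun n => 1 - g n).
  by split; apply: idc => n; rewrite mulN1r addrC.
have down := conv_sum hip ca (conv_trans (neg1' a').1 (conv_trans ca1 (neg1 _ X' a0').1)).
have up := conv_sum hip cb (conv_trans (neg1 _ X' b0').2 (conv_trans cb1 (neg1' b').2)).
have swap (g h : nat -> R) := @conv_interchange _ _ ip _ _ _ _ X g Y h.
have swap' (g h : nat -> R) := @conv_interchange _ _ ip _ _ _ _ X Y g h.
have mid_ := conv_sum hip (idc _ (sumf X Y) (sumf X Y) (fun=> erefl)) core.
exact: conv_trans down (conv_trans (swap _ _) (conv_trans mid_ (conv_trans (swap' _ _) up))).
Qed.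

Lemma conv_splitting (x a a' : nat -> R) (c : R) : splitting x c a a' ->
  conv ip x (sumf a (fun n => 1 - a' n)) /\ conv ip (sumf a (fun n => 1 - a' n)) x.
Proof.
move=> /splitting_index[e0 [e1 [ce h0 h1]]].
have [] := conv_complementary ip x ce.
by rewrite (funext h0) (funext h1).
Qed.

End TwoSides.

Section Boundedness.
Context {R : realType}.
Local Open Scope complex_scope.

Lemma bounded_diagonal (H : completeNormedModType R[i]) (ip : {dot H for Num.conj})
    (E : {linear H -> H}) (x : nat -> R) : induces_norm ip -> bounded_operator E ->
  is_diagonal ip E x -> exists M, forall n, `|x n| <= M.
Proof.
move=> ip_norm [M hM] [e [[on _] de]]; exists M => n.
have e1 : ip (e n) (e n) = 1 by rewrite on eqxx.
have ne : `|e n| = 1.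
  by apply/eqP; rewrite -(@pexpr_eq1 _ _ 2) // ip_norm e1.
have h : `|(x n)%:C| <= M%:C.
  by rewrite de; apply: le_trans (ip_unit_le ip_norm _ e1) _; have := hM (e n); rewrite ne mulr1.
by move: h; rewrite normc_def /= expr0n addr0 sqrtr_sqr lecR.
Qed.

End Boundedness.

Section Transfer.
Context {R : realType}.

Lemma esum_le_term (S : set nat) (f : nat -> R) j : (forall i, S i -> 0 <= f i) -> S j ->
  ((f j)%:E <= \esum_(i in S) (f i)%:E)%E.
Proof.
move=> f0 Sj; apply: esum_ge; exists [set j].
  by split; [exact: finite_set1|move=> i ->].
by rewrite fsbig_set1.
Qed.

(** Beyond the bound of [x] its majorization function is 0, so a term of [y] farther out would
    violate the inequality. Adding 2 puts the test points outside [0,1]. *)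
Lemma bounded_majorized (x y : nat -> R) (M : R) : (forall n, `|x n| <= M) ->
  (forall a : R, a < 0 \/ 1 < a -> (majf y a <= majf x a)%E) ->
  exists M', forall n, `|y n| <= M'.
Proof.
move=> xM yx; pose N := `|M| + 2; have M0 := normr_ge0 M; have Mn := ler_norm M.
exists N => n; rewrite leNgt; apply/negP => yN.
have [y0|y0] := leP 0 (y n).
  rewrite ger0_norm // in yN.
  have N1 : 1 < N by rewrite /N; lra.
  have := yx N (or_intror N1); rewrite /majf (lt_geF (lt_trans ltr01 N1)) (lt_gtF N1).
  rewrite [X in (_ <= X)%E](_ : _ = 0%E).
    apply/negP; rewrite -ltNge; apply: lt_le_trans (esum_le_term _ _ : ((y n - N)%:E <= _)%E).
    - by rewrite lte_fin subr_gt0.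
    - by move=> i /=; rewrite subr_ge0.
    - exact: ltW.
  rewrite (_ : [set i | _] = set0) ?esum_set0 //; apply/seteqP; split=> // i /=.
  by have := xM i; have := ler_norm (x i); rewrite /N; lra.
rewrite ltr0_norm // in yN.
have N1 : - N < 0 by rewrite /N; lra.
have := yx (- N) (or_introl N1); rewrite /majf (ltW N1).
rewrite [X in (_ <= X)%E](_ : _ = 0%E).
  apply/negP; rewrite -ltNge; apply: lt_le_trans (esum_le_term _ _ : ((- N - y n)%:E <= _)%E).
  - by rewrite lte_fin subr_gt0 ltrNr.
  - by move=> i /=; rewrite subr_ge0.
  - by rewrite /= lerNr ltW.
rewrite (_ : [set i | _] = set0) ?esum_set0 //; apply/seteqP; split=> // i /=.
by have := xM i; have := ler_norm (- x i); rewrite normrN /N; lra.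
Qed.

End Transfer.

Theorem theorem7p2 (R : realType) (lam d : nat -> R)
    (lam_acc : forall x : R, accumulation_point lam x <-> x = 0 \/ x = 1)
    (d_acc : forall x : R, accumulation_point d x <-> x = 0 \/ x = 1)
    (lam_fin : (majf lam (2^-1)%R < +oo)%E)
    (d_fin : (majf d (2^-1)%R < +oo)%E)
    (deltaL deltaU : \bar R)
    (deltaL_def :
       deltaL = limf_einf (fun b : R => majf lam b - majf d b)%E ((0:R)^'-))
    (deltaU_def :
       deltaU = limf_einf (fun b : R => majf lam b - majf d b)%E ((1:R)^'+))
    (delta_fin : (deltaL + deltaU < +oo)%E)
    (maj_out : forall a : R, a < 0 \/ 1 < a -> (majf d a <= majf lam a)%E)
    (delta0 delta1 : R)
    (delta0_itv : (0%:E <= delta0%:E <= deltaL)%E)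
    (delta1_itv : (0%:E <= delta1%:E <= deltaU)%E)
    (maj_in : forall a : R, 0 < a < 1 ->
       (majf lam a <= majf d a + ((1 - a) * delta0 + a * delta1)%:E)%E)
    (trace_cond : exists a : R,
       [/\ 0 < a < 1,
           derivable (fun t : R => fine (majf lam t)) a 1,
           derivable (fun t : R => fine (majf d t)) a 1 &
           exists k : int,
             derive1 (fun t : R => fine (majf lam t)) a
               - derive1 (fun t : R => fine (majf d t)) a
             = delta1 - delta0 + k%:~R])
    (lower_cond :
       (\esum_(i in [set i | (lam i < 0)%R]) (`|lam i|%R)%:E < +oo)%E ->
       (deltaL - delta0%:E <= deltaU - delta1%:E)%E)
    (upper_cond :
       (\esum_(i in [set i | (1 < lam i)%R]) (lam i - 1)%:E < +oo)%E ->
       (deltaU - delta1%:E <= deltaL - delta0%:E)%E)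
    (extreme_cond : delta0%:E = deltaL \/ delta1%:E = deltaU ->
       [/\ 0 < delta0, 0 < delta1 &
           forall a : R, 0 < a < 1 ->
             (majf lam a < majf d a + ((1 - a) * delta0 + a * delta1)%:E)%E])
    (H : completeNormedModType R[i]) (ip : {dot H for Num.conj})
    (ip_norm : induces_norm ip) (H_sep : separable_space H)
    (E : {linear H -> H})
    (E_bounded : bounded_operator E) (E_sa : self_adjoint ip E) :
  is_diagonal ip E lam -> is_diagonal ip E d.
Proof.
move=> lamE; have [M lamM] := bounded_diagonal ip_norm E_bounded lamE.
have [M' dM] := bounded_majorized lamM maj_out.
have [c [c01 dlam dd [k trace]]] := trace_cond.
(* Both sequences are cut at the point of the trace condition, where [splitting_slope] reads the
   derivatives as differences of sums of positive parts. *)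
have [a [a' sl]] := exists_splitting lam_acc lam_fin lamM c01.
have [b [b' sd]] := exists_splitting d_acc d_fin dM c01.
have /andP[delta00 delta0L] := delta0_itv; have /andP[delta10 delta1U] := delta1_itv.
have L0 := le_trans delta00 delta0L; have U0 := le_trans delta10 delta1U.
have [dL eL] : exists dL, deltaL = dL%:E.
  exists (fine deltaL); rewrite fineK // ge0_fin_numE //.
  by apply: le_lt_trans delta_fin; rewrite leeDl.
have [dU eU] : exists dU, deltaU = dU%:E.
  exists (fine deltaU); rewrite fineK // ge0_fin_numE //.
  by apply: le_lt_trans delta_fin; rewrite leeDr.
move: delta00 delta0L delta10 delta1U lower_cond upper_cond extreme_cond.
rewrite eL eU -!EFinB !lee_fin => {L0 U0} delta00 delta0L delta10 delta1U lower upper extreme.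
have limL : left_liminf (fun be => low a be - low b be) dL.
  apply: (@left_liminfP _ (fun b : R => majf lam b - majf d b)%E); last by rewrite -deltaL_def.
  by move=> be b0; rewrite (splitting_low sl) // (splitting_low sd).
have limU : left_liminf (fun be => low a' be - low b' be) dU.
  apply: (@right_liminfP _ (fun b : R => majf lam b - majf d b)%E); last by rewrite -deltaU_def.
  by move=> be b1; rewrite (splitting_up sl) // (splitting_up sd).
have lowle be : be < 0 -> low b be <= low a be.
  by move=> b0; have := maj_out be (or_introl b0); rewrite (splitting_low sl) // (splitting_low sd).
have lowle' be : be < 0 -> low b' be <= low a' be.
  move=> b0; have b1 : 1 < 1 - be by lra.
  have := maj_out _ (or_intror b1).
  by rewrite (splitting_up sl) // (splitting_up sd) // subKr.
have midle al : 0 < al < 1 ->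
    Sum (fun n => phi al (a n)) + Sum (fun n => phi (1 - al) (a' n)) <=
    Sum (fun n => phi al (b n)) + Sum (fun n => phi (1 - al) (b' n))
    + ((1 - al) * delta0 + al * delta1).
  by move=> al01; have := maj_in al al01; rewrite (splitting_mid sl) // (splitting_mid sd).
have midlt : delta0 = dL \/ delta1 = dU -> [/\ 0 < delta0, 0 < delta1 & forall al, 0 < al < 1 ->
    Sum (fun n => phi al (a n)) + Sum (fun n => phi (1 - al) (a' n)) <
    Sum (fun n => phi al (b n)) + Sum (fun n => phi (1 - al) (b' n))
    + ((1 - al) * delta0 + al * delta1)].
  move=> e; have [|p0 p1 lt] := extreme; first by case: e => ->; [left|right].
  split=> // al al01.
  by have := lt al al01; rewrite (splitting_mid sl) // (splitting_mid sd).
(* Shifting [delta0] and [delta1] by a common amount keeps every hypothesis, so they may be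
   chosen maximal: equality holds on a side where the spectrum is summable. *)
pose t := Num.min (dL - delta0) (dU - delta1).
have t0 : 0 <= t by rewrite le_min !subr_ge0 delta0L.
have tL : t <= dL - delta0 by rewrite ge_min lexx.
have tU : t <= dU - delta1 by rewrite ge_min lexx orbT.
have [del0 del0' strict] : [/\ 0 < delta0 + t, 0 < delta1 + t & forall al : R, 0 < al < 1 ->
    Sum (fun n => phi al (a n)) + Sum (fun n => phi (1 - al) (a' n)) <
    Sum (fun n => phi al (b n)) + Sum (fun n => phi (1 - al) (b' n))
      + (1 - al) * (delta0 + t) + al * (delta1 + t)].
  (* For [t > 0] the shift itself creates positivity and strictness; for [t = 0] one of the two
     values is extreme and the additional assumption supplies both. *)
  move: t0; rewrite le_eqVlt => /predU1P[t0|t0]; last first.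
    split; [lra|lra|move=> al al01; have := midle al al01; lra].
  have [|p0 p1 lt] := midlt.
    by move: t0; rewrite /t; case: leP => _ e; [left|right]; lra.
  by rewrite -t0 !addr0; split=> // al al01; have := lt al al01; lra.
have domL : dominates a b (delta0 + t).
  apply: (liminf_dominates (splitting_le1 sl) (splitting_le1 sd) (splitting_vanishing sl)
    (splitting_vanishing sd) (splitting_pos sl) (splitting_pos sd) lowle _ limL).
    by rewrite del0; lra.
  (* Summability triggers the comparison that makes this side attain the minimum [t], so the shifted
     value is [dL] itself. *)
  by move=> /(splitting_neg sl)/lower le; rewrite /t min_l //; lra.
have domU : dominates a' b' (delta1 + t).
  apply: (liminf_dominates (splitting_le1' sl) (splitting_le1' sd) (splitting_vanishing' sl)
    (splitting_vanishing' sd) (splitting_pos' sl) (splitting_pos' sd) lowle' _ limU).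
    by rewrite del0'; lra.
  by move=> /(splitting_neg' sl)/upper le; rewrite /t min_r //; lra.
have hip := dot_hform ip.
apply: (diagonal_conv ip_norm E_sa _ lamE).
apply: conv_trans (conv_splitting ip sl).1 (conv_trans _ (conv_splitting ip sd).2).
apply: (@conv_two_sides _ _ _ hip (ip_ge0 ip_norm) _ _ _ _ _ _ k domL domU strict).
by move: trace; rewrite (splitting_slope sl) // (splitting_slope sd) //; lra.
Qed.
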